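(* Let $N\ge 1$, let $0<q,t,u<1$, and let $\boldsymbol{\rho}^{+}=(\rho^{+}_{0},\dots,\rho^{+}_{N-1})$, $\boldsymbol{\rho}^{-}=(\rho^{-}_{1},\dots,\rho^{-}_{N})$ be two $N$-tuples of specializations of the ring of symmetric functions (in the formal sense explained in the context). With $$W^{\boldsymbol{\rho}^{+},\boldsymbol{\rho}^{-}}_{q,t;u}(\boldsymbol{\lambda},\boldsymbol{\mu})=u^{|\mu^{N}|}\prod_{i=1}^{N}Q_{\lambda^{i}/\mu^{i}}(\rho^{-}_{i};q,t)\,P_{\lambda^{i+1}/\mu^{i}}(\rho^{+}_{i};q,t),\qquad \lambda^{N+1}:=\lambda^{1},\ \rho^{+}_{N}:=\rho^{+}_{0},$$ for $\boldsymbol{\lambda}=(\lambda^{1},\dots,\lambda^{N})$, $\boldsymbol{\mu}=(\mu^{1},\dots,\mu^{N})\in\mathbb{Y}^{N}$, one has $$\sum_{\boldsymbol{\lambda},\boldsymbol{\mu}\in\mathbb{Y}^{N}}W^{\boldsymbol{\rho}^{+},\boldsymbol{\rho}^{-}}_{q,t;u}(\boldsymbol{\lambda},\boldsymbol{\mu})=\frac{1}{(u;u)_{\infty}}\,\frac{\prod_{i=0}^{N-1}\prod_{j=1}^{N}\tilde{\Pi}_{q,t;u}(\rho^{+}_{i};\rho^{-}_{j})}{\prod_{i=0}^{N-1}\prod_{j=1}^{i}\tilde{\Pi}_{q,t;0}(\rho^{+}_{i};\rho^{-}_{j})},$$ where $$\tilde{\Pi}_{q,t;u}(X;Y)=\prod_{i,j\ge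 1}\frac{(tx_{i}y_{j};q,u)_{\infty}}{(x_{i}y_{j};q,u)_{\infty}}.$$
   Context: $\mathbb{Y}$ is the set of all partitions. $P_{\lambda}(X;q,t)$ are the Macdonald symmetric functions: the basis of the ring of symmetric functions $\Lambda$ of the form $m_\lambda+\sum_{\mu<\lambda}c_{\lambda\mu}m_\mu$ (dominance order) that is orthogonal for the bilinear form $\langle p_\lambda,p_\mu\rangle_{q,t}=\delta_{\lambda\mu}\prod_{i\ge1} m_i(\lambda)!\,i^{m_i(\lambda)}\prod_{i=1}^{\ell(\lambda)}\frac{1-q^{\lambda_i}}{1-t^{\lambda_i}}$, and $Q_\lambda=P_\lambda/\langle P_\lambda,P_\lambda\rangle_{q,t}$. Skew functions are defined by $P_\lambda(X,Y)=\sum_\mu P_{\lambda/\mu}(X)P_\mu(Y)$ and $Q_\lambda(X,Y)=\sum_\mu Q_{\lambda/\mu}(X)Q_\mu(Y)$; they vanish unless $\mu\subset\lambda$. Pochhammer symbol: $(a;p_{1},\dots,p_{n})_{\infty}=\prod_{i_{1},\dots,i_{n}\ge 0}(1-ap_{1}^{i_{1}}\cdots p_{n}^{i_{n}})$, with $0^0=1$, so that $(a;q,0)_\infty=(a;q)_\infty$. Formal convention: the identity is understood formally (universally), i.e. $\rho^{+}_{i}$ is evaluation at an infinite alphabet $X^{i}$ and $\rho^{-}_{j}$ is evaluation at an infinite alphabet $Y^{j}$, all $2N$ alphabets being independent; so $F(\rho^+_i)=F(X^i)$, $F(\rho^-_j)=F(Y^j)$ for $F\in\Lambda$, $\tilde\Pi_{q,t;u}(\rho^+_i;\rho^-_j)=\tilde\Pi_{q,t;u}(X^i;Y^j)$,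 and the identity is one of formal power series in the variables of these alphabets. Equivalently, $p_n(\rho^{\pm}_i)$ are independent indeterminates and $\tilde\Pi_{q,t;u}(\rho^+;\rho^-)=\exp\left(\sum_{n>0}\frac{1-t^n}{1-q^n}\frac{1}{1-u^n}\frac{p_n(\rho^+)p_n(\rho^-)}{n}\right)$. *)

(* Defs.v *)
From HB Require Import structures.
From mathcomp Require Import all_boot all_order all_algebra finmap.
From mathcomp.multinomials Require Import monalg.
From mathcomp Require Import boolp classical_sets functions cardinality fsbigop.
From mathcomp Require Import reals topology normedtype sequences summability.

Set Implicit Arguments.
Unset Strict Implicit.
Unset Printing Implicit Defensive.

Import Order.TTheory GRing.Theory Num.Theory.
Import numFieldNormedType.Exports.

Local Open Scope classical_set_scope.
Local Open Scope ring_scope.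

(* Formal power series in the commuting variables indexed by V (possibly
   infinitely many), given by their coefficients on monomials. *)

Section FpsDef.
Context (V : choiceType) (K : comNzRingType).

Record fps := Fps { fcoef :> {cmonom V} -> K }.

Lemma fpsP (f g : fps) : (forall m, f m = g m) -> f = g.
Proof. by case: f g => [f] [g] /= /funext ->. Qed.

HB.instance Definition _ := gen_eqMixin fps.
HB.instance Definition _ := gen_choiceMixin fps.

Definition fps_zero : fps := Fps (fun=> 0).
Definition fps_opp (f : fps) : fps := Fps (fun m => - f m).
Definition fps_add (f g : fps) : fps := Fps (fun m => f m + g m).
Definition fps_scale (c : K) (f : fps) : fps := Fps (fun m => c * f m).
Definition fps_one : fps := Fps (fun m => (m == mone)%:R).
Definition fps_mul (f g : fps) : fps :=
  Fps (fun m => \sum_(p \in [set p : {cmonom V} * {cmonom V} |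
                                mmul p.1 p.2 = m]) f p.1 * g p.2).

Fact fps_addA : associative fps_add.
Proof. by move=> f g h; apply: fpsP => m /=; rewrite addrA. Qed.
Fact fps_addC : commutative fps_add.
Proof. by move=> f g; apply: fpsP => m /=; rewrite addrC. Qed.
Fact fps_add0 : left_id fps_zero fps_add.
Proof. by move=> f; apply: fpsP => m /=; rewrite add0r. Qed.
Fact fps_addN : left_inverse fps_zero fps_opp fps_add.
Proof. by move=> f; apply: fpsP => m /=; rewrite addNr. Qed.
HB.instance Definition _ :=
  GRing.isZmodule.Build fps fps_addA fps_addC fps_add0 fps_addN.

Lemma finite_cmdiv (m : {cmonom V}) :
  finite_set [set a | exists b, mmul a b = m].
Proof.
pose dec (h : {ffun finsupp m -> 'I_(mdeg m).+1}) : {cmonom V} :=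
  [cmonom (h i : nat) | i : finsupp m]%M.
apply: (@sub_finite_set _ _ (dec @` setT)); last exact: finite_image.
move=> a [b abm].
have le_m i : (a i <= m i)%N by rewrite -abm cmM leq_addr.
have le_deg i : (m i <= mdeg m)%N.
  rewrite mdegE; case: mdomP => // im.
  by rewrite (big_fsetD1 i) //= leq_addr.
exists [ffun i : finsupp m => inord (a (val i)) : 'I_(mdeg m).+1] => //.
apply/eqP/cmP => i; rewrite cmE /= fsfun_ffun.
case: insubP => [j _ <-|im] /=; first by rewrite ffunE inordK // ltnS (leq_trans (le_m _)).
by apply/esym/eqP; rewrite -leqn0 (leq_trans (le_m i)) // leqn0 cmE_eq0.
Qed.


Lemma fps_mulE (E : {fset {cmonom V}}) (f g : fps) (m : {cmonom V}) :
    (forall a b, mmul a b = m -> a \in E) ->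
  fps_mul f g m =
    \sum_(a <- E) \sum_(b <- E) (mmul a b == m)%:R * (f a * g b).
Proof.
move=> Em.
have Em2 a b : mmul a b = m -> b \in E by rewrite mulmC => /Em.
rewrite /= (eq_fsbigr (fun p => (mmul p.1 p.2 == m)%:R * (f p.1 * g p.2)));
  last by move=> p /set_mem /= ->; rewrite eqxx mul1r.
rewrite (fsbig_fwiden [seq (a, b) | a <- E, b <- E]) ?big_allpairs //.
- move=> [a b] /= abm; apply/allpairsP; exists (a, b) => /=.
  by split=> //; [apply: Em abm | apply: Em2 abm].
- by apply: allpairs_uniq => // -[? ?] [? ?].
- by move=> p [_] /= /eqP /negbTE; rewrite /preimage /= => ->; rewrite mul0r.
Qed.

Lemma big_fset_pick (E : {fset {cmonom V}}) (F : {cmonom V} -> K) x :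
  x \in E -> (forall y, y != x -> F y = 0) -> \sum_(y <- E) F y = F x.
Proof.
move=> xE F0; rewrite (big_fsetD1 x) //= big_seq big1 ?addr0 // => y.
by rewrite !inE => /andP[/F0].
Qed.

Definition cmdivs (m : {cmonom V}) : {fset {cmonom V}} :=
  fset_set [set a | exists b, mmul a b = m].

Lemma cmdivsP m a : reflect (exists b, mmul a b = m) (a \in cmdivs m).
Proof.
rewrite in_fset_set; last exact: finite_cmdiv.
by apply: (iffP idP) => [/set_mem|/mem_set].
Qed.

Lemma mem_cmdivs m a b : mmul a b = m -> a \in cmdivs m.
Proof. by move=> abm; apply/cmdivsP; exists b. Qed.

Fact fps_mulC : commutative fps_mul.
Proof.
move=> f g; apply: fpsP => m.
rewrite !(fps_mulE _ _ (@mem_cmdivs m)).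
rewrite exchange_big; apply: eq_bigr => a _; apply: eq_bigr => b _.
by rewrite mulmC [f _ * _]mulrC.
Qed.

Fact fps_mulDl : left_distributive fps_mul fps_add.
Proof.
move=> f g h; apply: fpsP => m.
rewrite [RHS](_ : _ = fps_mul f h m + fps_mul g h m) //.
rewrite !(fps_mulE _ _ (@mem_cmdivs m)).
rewrite -big_split; apply: eq_bigr => a _.
by rewrite -big_split; apply: eq_bigr => b _; rewrite /= mulrDl mulrDr.
Qed.

Fact fps_mul1 : left_id fps_one fps_mul.
Proof.
move=> f; apply: fpsP => m.
rewrite (fps_mulE _ _ (@mem_cmdivs m)).
have m1 : mone \in cmdivs m by apply/cmdivsP; exists m; rewrite mul1m.
have mm : m \in cmdivs m by apply/cmdivsP; exists mone; rewrite mulm1.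
rewrite (big_fset_pick m1) => [|a /negbTE a1]; last first.
  by apply: big1 => b _; rewrite /= a1 mul0r mulr0.
rewrite (big_fset_pick mm) => [|b /negbTE bm]; last by rewrite mul1m bm mul0r.
by rewrite mul1m /= !eqxx !mul1r.
Qed.

Fact fps_mulA : associative fps_mul.
Proof.
suff lassoc f g h m : fps_mul (fps_mul f g) h m =
    \sum_(x <- cmdivs m) \sum_(y <- cmdivs m) \sum_(z <- cmdivs m)
      (mmul (mmul x y) z == m)%:R * (f x * g y * h z).
  move=> f g h; apply: fpsP => m; rewrite lassoc fps_mulC lassoc.
  under eq_bigr do rewrite exchange_big /=.
  rewrite exchange_big; apply: eq_bigr => x _.
  apply: eq_bigr => y _; apply: eq_bigr => z _.
  rewrite [mmul (mmul y z) x]mulmC mulmA.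
  by rewrite -[f x * _ * _]mulrA [f x * _]mulrC.
rewrite (fps_mulE _ _ (@mem_cmdivs m)).
transitivity (\sum_(a <- cmdivs m) \sum_(x <- cmdivs m) \sum_(y <- cmdivs m)
    \sum_(z <- cmdivs m)
      (mmul x y == a)%:R * ((mmul a z == m)%:R * (f x * g y * h z))).
  rewrite !big_seq; apply: eq_bigr => a /cmdivsP[c acm].
  have aE x y : mmul x y = a -> x \in cmdivs m.
    by move=> xya; apply: (@mem_cmdivs _ _ (mmul y c)); rewrite mulmA xya.
  rewrite (fps_mulE _ _ aE).
  under eq_bigr do rewrite mulr_suml mulr_sumr.
  rewrite exchange_big /=; apply: eq_bigr => x _.
  under eq_bigr do rewrite mulr_suml mulr_sumr.
  rewrite exchange_big /=; apply: eq_bigr => y _; apply: eq_bigr => z _.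
  by rewrite -mulrA mulrCA.
rewrite exchange_big /=; apply: eq_bigr => x _.
rewrite exchange_big /=; apply: eq_bigr => y _.
rewrite exchange_big /=; apply: eq_bigr => z _.
have [xyzm|xyzm] := eqVneq (mmul (mmul x y) z) m.
  rewrite (big_fset_pick (mem_cmdivs xyzm)) ?xyzm ?eqxx ?mul1r // => a.
  by rewrite eq_sym => /negbTE ->; rewrite mul0r.
rewrite mul0r big1 // => a _; have [<-|_] := eqVneq; last by rewrite mul0r.
by rewrite (negbTE xyzm) mul0r mulr0.
Qed.

Fact fps_1neq0 : fps_one != 0 :> fps.
Proof.
apply/eqP => /(congr1 (fun f : fps => f mone)) /eqP.
by rewrite /= eqxx oner_eq0.
Qed.

HB.instance Definition _ := GRing.Zmodule_isComNzRing.Build fps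
  fps_mulA fps_mulC fps_mul1 fps_mulDl fps_1neq0.

Fact fps_scaleA (a b : K) (f : fps) :
  fps_scale a (fps_scale b f) = fps_scale (a * b) f.
Proof. by apply: fpsP => m /=; rewrite mulrA. Qed.
Fact fps_scale1 : left_id 1 fps_scale.
Proof. by move=> f; apply: fpsP => m /=; rewrite mul1r. Qed.
Fact fps_scaleDr : right_distributive fps_scale +%R.
Proof. by move=> a f g; apply: fpsP => m /=; rewrite mulrDr. Qed.
Fact fps_scaleDl (f : fps) : {morph fps_scale^~ f : a b / a + b}.
Proof. by move=> a b; apply: fpsP => m /=; rewrite mulrDl. Qed.
HB.instance Definition _ := GRing.Zmodule_isLmodule.Build K fps
  fps_scaleA fps_scale1 fps_scaleDr fps_scaleDl.

Fact fps_scaleAl (a : K) (f g : fps) : a *: (f * g) = (a *: f) * g.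
Proof.
apply: fpsP => m.
rewrite [LHS](_ : _ = a * fps_mul f g m) //.
rewrite [RHS](_ : _ = fps_mul (a *: f) g m) // !(fps_mulE _ _ (@mem_cmdivs m)) mulr_sumr.
apply: eq_bigr => x _; rewrite mulr_sumr; apply: eq_bigr => y _.
by rewrite mulrCA !mulrA.
Qed.
HB.instance Definition _ := GRing.Lmodule_isLalgebra.Build K fps fps_scaleAl.
HB.instance Definition _ := GRing.Lalgebra_isComAlgebra.Build K fps.

Definition fps_unit : {pred fps} := [pred f | `[< exists g : fps, g * f = 1 >]].
Definition fps_inv (f : fps) : fps := xget f [set g | g * f = 1].

Fact fps_mulVx : {in fps_unit, left_inverse 1 fps_inv *%R}.
Proof. by move=> f /asboolP[g gf1]; rewrite /fps_inv; case: xgetP => // /(_ g). Qed.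
Fact fps_unitPl (f g : fps) : g * f = 1 -> fps_unit f.
Proof. by move=> gf1; apply/asboolP; exists g. Qed.
Fact fps_inv_out : {in [predC fps_unit], fps_inv =1 id}.
Proof.
move=> f /asboolPn nf; rewrite /fps_inv; case: xgetP => // g _ gf1.
by case: nf; exists g.
Qed.
HB.instance Definition _ := GRing.ComNzRing_hasMulInverse.Build fps
  fps_mulVx fps_unitPl fps_inv_out.

Lemma fcoefD (f g : fps) m : (f + g) m = f m + g m.
Proof. by []. Qed.
Lemma fcoefN (f : fps) m : (- f) m = - f m.
Proof. by []. Qed.
Lemma fcoef1 m : (1 : fps) m = (m == mone)%:R.
Proof. by []. Qed.
Lemma fcoefZ a (f : fps) m : (a *: f) m = a * f m.
Proof. by []. Qed.
Lemma fcoefM (f g : fps) m : (f * g) m =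
  \sum_(p \in [set p : {cmonom V} * {cmonom V} | mmul p.1 p.2 = m])
    f p.1 * g p.2.
Proof. by []. Qed.

End FpsDef.

Arguments fps V K : clear implicits.

Definition fps_var (V : choiceType) (K : comNzRingType) (v : V) : fps V K :=
  Fps (fun m => (m == ucm v)%:R).

Section Rename.
Context (V V' : choiceType) (e : V -> V').

Definition mrename (m : {cmonom V}) : {cmonom V'} :=
  \big[mmul/mone]_(i <- finsupp m) expcmn (ucm (e i)) (m i).

(* The substitution x_v := y_(e v); the sum has at most one term when e is
   injective, the only case in which it is used. *)
Definition fps_rename (K : comNzRingType) (f : fps V K) : fps V' K :=
  Fps (fun m' => \sum_(m \in [set m | mrename m = m']) f m).

Lemma expcmnE (W : choiceType) (m : {cmonom W}) n i :
  expcmn m n i = (n * m i)%N.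
Proof.
rewrite /expcmn; case: n => [|n]; first by rewrite /= onecmE.
by rewrite iteropS; elim: n => [|n IHn]; rewrite ?mul1n //= mulcmE IHn mulSn.
Qed.

Lemma mdeg_expcmn (W : choiceType) (m : {cmonom W}) n :
  mdeg (expcmn m n) = (n * mdeg m)%N.
Proof.
rewrite /expcmn; case: n => [|n]; first exact: mdeg1.
rewrite iteropS; elim: n => [|n IHn]; first by rewrite mul1n.
by rewrite /= [LHS](mdegM m) IHn mulSn.
Qed.

Lemma mrenameE m j :
  mrename m j = (\sum_(i <- finsupp m) (e i == j) * m i)%N.
Proof.
rewrite /mrename; elim/big_rec2: _ => [|i k x _ <-]; first by rewrite cm1.
by rewrite cmM expcmnE cmU mulnC.
Qed.

Lemma mrename_inj m i : injective e -> mrename m (e i) = m i.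
Proof.
move=> e_inj; rewrite mrenameE; case: (mdomP m i) => im.
  rewrite (big_fsetD1 i) //= eqxx mul1n big_seq big1 ?addn0 // => k.
  by rewrite !inE (inj_eq e_inj) => /andP[/negbTE ->].
rewrite big_seq big1 // => k km; rewrite (inj_eq e_inj).
by case: eqP => // kE; rewrite -kE km in im.
Qed.

End Rename.

Section Symf.
Context (K : comNzRingType).

Definition fps_symmetric (f : fps nat K) : Prop :=
  forall s : nat -> nat, bijective s ->
  forall m m' : {cmonom nat}, (forall i, m' (s i) = m i) -> f m' = f m.

Definition fps_bounded_degree (f : fps nat K) : Prop :=
  exists d, forall m : {cmonom nat}, (d < mdeg m)%N -> f m = 0.

Definition symf_pred : {pred fps nat K} :=
  [pred f | `[< fps_symmetric f /\ fps_bounded_degree f >]].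

Fact symf_subalg : GRing.subalg_closed symf_pred.
Proof.
split.
- apply/asboolP; split.
    move=> s [s' sK s'K] m m' mm'; rewrite !fcoef1.
    suff -> : (m' == mone) = (m == mone) by [].
    apply/eqP/eqP => [m'1|m1]; apply/eqP/cmP => i.
      by rewrite -mm' m'1 !cm1.
    by rewrite -(s'K i) mm' m1 !cm1.
  exists 0%N => m; rewrite fcoef1; case: eqVneq => // ->.
  by rewrite mdeg1.
- move=> a f g /asboolP[fs [df fd]] /asboolP[gs [dg gd]]; apply/asboolP; split.
    move=> s sb m m' mm'; rewrite !fcoefD !fcoefZ.
    by rewrite (fs s sb m m') // (gs s sb m m').
  exists (maxn df dg) => m; rewrite gtn_max => /andP[mf mg].
  by rewrite fcoefD fcoefZ fd // gd // mulr0 addr0.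
move=> f g /asboolP[fs [df fd]] /asboolP[gs [dg gd]]; apply/asboolP; split.
  move=> s sb m m' mm'; have [s' sK s'K] := sb.
  have s_inj := can_inj sK; have s'_inj := can_inj s'K.
  rewrite !fcoefM (@reindex_fsbig _ _ _ _ _
    (fun p => (mrename s p.1, mrename s p.2))
    [set p | mmul p.1 p.2 = m]).
    apply: eq_fsbigr => -[a b] _ /=.
    by rewrite (fs s sb a) ?(gs s sb b) // => i; rewrite mrename_inj.
  split.
  - move=> [a b] /= abm; apply/eqP/cmP => i; rewrite -(s'K i) mm' -abm !cmM.
    by rewrite !mrename_inj.
  - move=> [a b] [c d] _ _ [ac bd]; congr (_, _); apply/eqP/cmP => i.
      by rewrite -(mrename_inj a i s_inj) ac mrename_inj.
    by rewrite -(mrename_inj b i s_inj) bd mrename_inj.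
  - move=> [a b] /= abm'; exists (mrename s' a, mrename s' b) => /=.
      apply/eqP/cmP => i; rewrite -(mm' i) -abm' !cmM -{1 2}(sK i).
      by rewrite !mrename_inj // sK.
    congr (_, _); apply/eqP/cmP => i; rewrite -{1}(s'K i) !mrename_inj //.
exists (df + dg)%N => m mlarge; rewrite fcoefM fsbig1 // => -[a b] /= abm.
move: mlarge; rewrite -abm mdegM => mlarge.
have [adf|dfa] := leqP (mdeg a) df; last by rewrite fd // mul0r.
have [bdg|dgb] := leqP (mdeg b) dg; last by rewrite gd // mulr0.
by rewrite ltnNge leq_add in mlarge.
Qed.
HB.instance Definition _ :=
  GRing.isSubalgClosed.Build K (fps nat K) symf_pred symf_subalg.

(* Lambda, as the symmetric power series of bounded degree in x_0, x_1, ... *)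
Record symf := Symf { symf_val :> fps nat K; _ : symf_val \in symf_pred }.

HB.instance Definition _ := [isSub for symf_val].
HB.instance Definition _ := [Choice of symf by <:].
HB.instance Definition _ := [SubChoice_isSubAlgebra of symf by <:].
HB.instance Definition _ := [SubNzRing_isSubComNzRing of symf by <:].
End Symf.

Record intpart :=
  IntPart { parts :> seq nat; _ : sorted geq parts && (0%N \notin parts) }.
HB.instance Definition _ := [isSub for parts].
HB.instance Definition _ := [Countable of intpart by <:].

Definition psize (lam : intpart) : nat := sumn lam.

Definition dominance_lt (mu lam : intpart) : Prop :=
  [/\ mu != lam, psize mu = psize lam
    & forall k, (sumn (take k mu) <= sumn (take k lam))%N].

Section Bases.
Context (K : comNzRingType).

Definition monom_series (lam : intpart) : fps nat K :=
  Fps (fun m => (perm_eq [seq m i | i <- finsupp m] lam)%:R).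

Fact monom_series_symf lam : monom_series lam \in @symf_pred K.
Proof.
apply/asboolP; split.
  move=> s sb m m' mm' /=; congr ((_ : bool)%:R).
  have /permPl -> // : perm_eq [seq m' i | i <- finsupp m']
                               [seq m i | i <- finsupp m].
  apply: (@perm_trans _ [seq m' i | i <- map s (finsupp m)]); last first.
    by rewrite -map_comp (eq_map mm').
  apply: perm_map; apply: uniq_perm; first exact: fset_uniq.
    by rewrite map_inj_uniq ?fset_uniq //; apply: bij_inj.
  move=> j; have [s' sK s'K] := sb; rewrite -(s'K j).
  by rewrite (mem_map (bij_inj sb)) -!cmE_neq0 mm'.
exists (psize lam) => m large /=; case: (boolP (perm_eq _ _)) => // /perm_sumn mE.
by move: large; rewrite /psize -mE mdegE sumnE big_map ltnn.
Qed.

Definition symf_m (lam : intpart) : symf K := Symf (monom_series_symf lam).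

(* p_n = \sum_i x_i ^ n, for n > 0. *)
Definition power_series (n : nat) : fps nat K :=
  Fps (fun m => `[< exists i, m = expcmn (ucm i) n >]%:R).

Fact power_series_symf n : power_series n \in @symf_pred K.
Proof.
apply/asboolP; split.
  move=> s [s' sK s'K] m m' mm' /=; congr ((_ : bool)%:R).
  apply/asboolP/asboolP => -[i mE].
    exists (s' i); apply/eqP/cmP => j; rewrite -mm' mE !expcmnE !cmU.
    by rewrite (can2_eq s'K sK).
  exists (s i); apply/eqP/cmP => j; rewrite -(s'K j) mm' mE !expcmnE !cmU.
  by rewrite (can_eq sK).
exists n => m large /=; case: asboolP => // -[i mE].
suff dm : mdeg m = n by rewrite dm ltnn in large.
by rewrite mE mdeg_expcmn mdegU muln1.
Qed.

Definition symf_p1 (n : nat) : symf K := Symf (power_series_symf n).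

Definition symf_p (lam : intpart) : symf K := \prod_(i <- lam) symf_p1 i.
End Bases.

Arguments symf_m {K} lam.
Arguments symf_p {K} lam.

(* F(X), for the alphabet of the variables X 0, X 1, ..., assumed distinct. *)
Definition symf_at (K : comNzRingType) (V : choiceType) (X : nat -> V)
  (F : symf K) : fps V K := fps_rename X F.

Section Macdonald.
Context (R : realType).
Implicit Types (q t : R) (lam mu : intpart).

(* Indices i > |lam| contribute a factor 1 to the first product. *)
Definition macdonald_norm q t lam : R :=
  (\prod_(1 <= i < (psize lam).+1)
      ((count_mem i lam)`! * i ^ count_mem i lam)%:R) *
  \prod_(i <- lam) ((1 - q ^+ i) / (1 - t ^+ i)).

Definition is_macdonald_form q t
    (form : {bilinear symf R -> symf R -> R | *%R & *%R}) : Prop :=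
  forall lam mu, form (symf_p lam) (symf_p mu) =
    if lam == mu then macdonald_norm q t lam else 0.

(* Being a basis of Lambda is implied by unitriangularity. *)
Definition is_macdonald_P
    (form : {bilinear symf R -> symf R -> R | *%R & *%R})
    (P : intpart -> symf R) : Prop :=
  (forall lam, exists c : intpart -> R,
     P lam = symf_m lam +
       \sum_(mu \in [set mu | dominance_lt mu lam]) c mu *: symf_m mu) /\
  (forall lam mu, lam != mu -> form (P lam) (P mu) = 0).

Definition macdonald_Q
    (form : {bilinear symf R -> symf R -> R | *%R & *%R})
    (P : intpart -> symf R) (lam : intpart) : symf R :=
  (form (P lam) (P lam))^-1 *: P lam.

(* x_0, y_0, x_1, y_1, ...: the union of the alphabets X and Y. *)
Definition alphabet_union (k : nat) : nat + nat :=
  if odd k then inr k./2 else inl k./2.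

(* F_lam(X, Y) = \sum_mu Fsk_(lam / mu)(X) F_mu(Y), coefficientwise. For the
   homogeneous bases P and Q only the mu with |mu| the degree of the monomial
   in Y contribute, so each sum is finite, and this determines Fsk. *)
Definition is_skew (F : intpart -> symf R)
    (Fsk : intpart -> intpart -> symf R) : Prop :=
  forall lam (m : {cmonom (nat + nat)%type}),
    symf_at alphabet_union (F lam) m =
    \sum_(mu \in [set: intpart])
      (symf_at inl (Fsk lam mu) * symf_at inr (F mu)) m.

End Macdonald.

Section Limits.
Context (R : realType) (V : choiceType).

(* Infinite products are coefficientwise limits, and infinite sums of series
   are coefficientwise unconditional sums: the coefficients are real series
   that do not reduce to finite sums. *)
Definition fps_lim (F : nat -> fps V R) : fps V R :=
  Fps (fun m => limn (fun n => F n m)).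

Definition fps_has_sum (I : choiceType) (F : I -> fps V R) (S : fps V R) :
    Prop :=
  forall m : {cmonom V}, partial_sum (fun i => F i m) @ totally --> S m.

(* (a; p_1, ..., p_n)_oo, as the limit of the products over i_1, ..., i_n < k. *)
Definition qpochhammer (n : nat) (a : fps V R) (ps : n.-tuple R) : fps V R :=
  fps_lim (fun k => \prod_(i : {ffun 'I_n -> 'I_k})
    (1 - (\prod_(l < n) tnth ps l ^+ i l) *: a)).

Definition Pi_tilde (q t u : R) (X Y : nat -> V) : fps V R :=
  fps_lim (fun k => \prod_(i < k) \prod_(j < k)
    (qpochhammer (t *: (fps_var R (X i) * fps_var R (Y j))) [tuple q; u] /
     qpochhammer (fps_var R (X i) * fps_var R (Y j)) [tuple q; u])).

End Limits.

(* The variables of 2N independent infinite alphabets. *)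
Definition alphabets (N : nat) : choiceType := ('I_N * nat + 'I_N * nat)%type.

(* The alphabet of rho^+_i, i = 0, ..., N - 1. *)
Definition Xplus (N : nat) (i : 'I_N) (k : nat) : alphabets N := inl (i, k).

(* The alphabet of rho^-_(j + 1), j = 0, ..., N - 1. *)
Definition Yminus (N : nat) (j : 'I_N) (k : nat) : alphabets N := inr (j, k).

(* N = n + 1; lam i and mu i stand for lambda^(i + 1) and mu^(i + 1), so that
   ordS i is the index both of lambda^(i + 2) and of rho^+_(i + 1), cyclically,
   and mu ord_max is mu^N. *)
Definition periodic_weight (R : realType) (n : nat) (u : R)
    (Psk Qsk : intpart -> intpart -> symf R)
    (lam mu : {ffun 'I_n.+1 -> intpart}) : fps (alphabets n.+1) R :=
  u ^+ psize (mu ord_max) *: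
  \prod_(i < n.+1)
    (symf_at (Yminus i) (Qsk (lam i) (mu i)) *
     symf_at (Xplus (ordS i)) (Psk (lam (ordS i)) (mu i))).

(* Main.v *)
From HB Require Import structures.
From mathcomp Require Import all_boot all_order all_algebra finmap perm.
From mathcomp.multinomials Require Import monalg.
From mathcomp Require Import boolp classical_sets cardinality fsbigop.
From mathcomp Require Import reals topology normedtype sequences summability.
From mathcomp Require Import ring lra zify.
Require Import Defs.

Set Implicit Arguments.
Unset Strict Implicit.
Unset Printing Implicit Defensive.

Import Order.TTheory GRing.Theory Num.Theory.
Import numFieldNormedType.Exports.

Local Open Scope classical_set_scope.
Local Open Scope ring_scope.

(** The sum is the trace of the composition, around a cycle, of the operators on
    symmetric functions whose matrices are the skew functions, together with
    the degree operator [u ^+ |mu^N|]. A trace does not depend on the basis, so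
    the Macdonald functions [P] and their dual functions [Q] may be replaced by
    the power sums and their dual basis ([cyclic_basis_change]): the
    deformation of the scalar product only survives in the norms. In the basis
    of power sums the skew functions are explicit products of binomial terms
    ([pskew]).

    In that basis, inserting the derivation [d / d p_n] in the trace and moving
    it around the cycle gives a linear equation: it commutes with the skewing
    operators in the alphabets [Xplus], it commutes with the operators in the
    alphabets [Yminus] up to a multiple of [p_n(Yminus)], and it is multiplied by
    [u ^ n] when it crosses the degree operator. Solving that equation
    ([kweight_solve]) yields the factors [1 / (1 - u ^ n)]. Since the same
    insertion measures the dependence of the sum on [p_n(Xplus)], the result is a
    first order equation for the Euler (degree) derivation of the sum
    ([euler_coef_psum]). The product on the right-hand side satisfies the same
    equation ([macdonald_product_euler]), because the logarithmic derivative of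
    [Pi_tilde] is the series with coefficients
    [(1 - t^n) / ((1 - q^n) (1 - u^n))] in the products [p_n(X) p_n(Y)]
    ([Pi_tilde_euler]). A solution is determined by its constant term
    ([euler_unique]); the constant term of the sum is the generating function of
    partitions at [u], that of the product is [1 / (u; u)_oo]
    ([euler_prod_cvg]).

    The coefficients are infinite series, so that the argument requires absolute
    convergence, for the Macdonald functions as well as for the power sums. For
    a family of norm [N], the coefficients of the skew functions indexed by [l]
    and [k] are bounded by [sqrt (N l / N k)] up to factors of subexponential
    growth in the sizes ([pskew_bound], and [skewP_bound] through the Bessel
    inequality). These quotients telescope around the cycle, and the power of [u]
    absorbs the rest ([cyclic_summable]). The trace identity is applied to the
    truncations to partitions of size at most [D], which are stable under the
    change of basis, and [D] tends to infinity ([has_sum_exhaust]). *)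

(** * Formal power series and the Euler derivation *)

Section FpsBasics.
Context (V : choiceType) (K : comNzRingType).
Implicit Types (f g h : fps V K) (m a b : {cmonom V}).

Lemma fcoefME f g m : (f * g) m =
  \sum_(a <- cmdivs m) \sum_(b <- cmdivs m) (mmul a b == m)%:R * (f a * g b).
Proof. exact: (fps_mulE _ _ (@mem_cmdivs _ m)). Qed.

Lemma eq_fcoefM f g f' g' m :
    (forall a b, mmul a b = m -> f a * g b = f' a * g' b) ->
  (f * g) m = (f' * g') m.
Proof.
move=> fg; rewrite !fcoefME; apply: eq_bigr => a _; apply: eq_bigr => b _.
by case: eqP => [/fg ->|]; rewrite ?mul0r.
Qed.

Lemma fcoefB f g m : (f - g) m = f m - g m.
Proof. by []. Qed.

Lemma fcoef_sum (I : Type) (r : seq I) (P : pred I) (F : I -> fps V K) m :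
  (\sum_(i <- r | P i) F i) m = \sum_(i <- r | P i) F i m.
Proof. by elim/big_rec2: _ => // i x y _ <-. Qed.

Lemma mmul_eq1 a b : mmul a b = mone -> a = mone /\ b = mone.
Proof. by move=> /eqP; rewrite cmM_eq1 => /andP[/eqP -> /eqP ->]. Qed.

Lemma mone_cmdivs m : mone \in cmdivs m.
Proof. by apply: (@mem_cmdivs _ _ _ m); rewrite mul1m. Qed.

Lemma fcoefM1 f g : (f * g) mone = f mone * g mone.
Proof.
rewrite fcoefME (big_fset_pick (mone_cmdivs _)) => [|a].
  rewrite (big_fset_pick (mone_cmdivs _)) ?mul1m ?eqxx ?mul1r // => b.
  by rewrite mul1m => /negbTE ->; rewrite mul0r.
move=> /eqP a1; rewrite big1 // => b _; case: eqP => [/mmul_eq1[]//|_].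
by rewrite mul0r.
Qed.

Lemma fcoef_prod1 (I : Type) (r : seq I) (P : pred I) (F : I -> fps V K) :
  (\prod_(i <- r | P i) F i) mone = \prod_(i <- r | P i) (F i mone).
Proof.
by elim/big_rec2: _ => [|i x y _ <-]; rewrite ?fcoef1 ?eqxx ?fcoefM1.
Qed.

Lemma fcoef_scale1 (c : K) m : (c%:A : fps V K) m = c * (m == mone)%:R.
Proof. by []. Qed.

Definition homog d f := forall m, mdeg m != d -> f m = 0.

Lemma homogM d e f g : homog d f -> homog e g -> homog (d + e)%N (f * g).
Proof.
move=> fd ge m; apply: contraNeq; rewrite fcoefME => /eqP fg.
apply: contra_notT fg => mde; rewrite big1 // => a _; rewrite big1 // => b _.
case: eqP => [abm|]; rewrite ?mul0r // mul1r.
have [ad|/fd ->] := eqVneq (mdeg a) d; last by rewrite mul0r.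
have [be|/ge ->] := eqVneq (mdeg b) e; last by rewrite mulr0.
by move: mde; rewrite -abm mdegM ad be eqxx.
Qed.

Lemma homog1 : homog 0 1.
Proof. by move=> m; rewrite mdeg_eq0 fcoef1 => /negbTE ->. Qed.

Lemma homogX d f n : homog d f -> homog (d * n)%N (f ^+ n).
Proof.
move=> fd; elim: n => [|n IH]; first by rewrite muln0; apply: homog1.
by rewrite mulnS exprS; apply: homogM.
Qed.

Lemma homog_prod (I : Type) (r : seq I) (F : I -> fps V K) (d : I -> nat) :
  (forall i, homog (d i) (F i)) ->
  homog (\sum_(i <- r) d i)%N (\prod_(i <- r) F i).
Proof.
move=> Fd; elim/big_rec2: _ => [|i n f _ nf]; first exact: homog1.
exact: homogM.
Qed.

Lemma homogZ d c f : homog d f -> homog d (c *: f).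
Proof. by move=> fd m /fd mf; rewrite fcoefZ mf mulr0. Qed.

Lemma homogD d f g : homog d f -> homog d g -> homog d (f + g).
Proof. by move=> fd gd m md; rewrite fcoefD fd // gd // addr0. Qed.

Lemma homog_sum (I : Type) (r : seq I) (P : pred I) (F : I -> fps V K) d :
  (forall i, P i -> homog d (F i)) -> homog d (\sum_(i <- r | P i) F i).
Proof.
move=> Fd; elim/big_rec: _ => [|i f Pi fd] //; apply: homogD => //; exact: Fd.
Qed.

Lemma homogX_lt f n m : f mone = 0 -> (mdeg m < n)%N -> (f ^+ n) m = 0.
Proof.
move=> f1; elim: n m => // n IH m mn; rewrite exprS.
rewrite (@eq_fcoefM f (f ^+ n) 0 0) ?mul0r // => a b abm.
have [->|a1] := eqVneq a mone; first by rewrite f1 !mul0r.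
rewrite IH ?mulr0 //.
have a0 : (0 < mdeg a)%N by rewrite lt0n mdeg_eq0.
by move: mn; rewrite -abm mdegM; lia.
Qed.

(** The geometric series in [1 - f] inverts [f]. *)
Lemma fps_unit1 f : f mone = 1 -> f \is a GRing.unit.
Proof.
move=> f1; pose h := 1 - f.
have h1 : h mone = 0 by rewrite fcoefB f1 fcoef1 eqxx subrr.
pose g : fps V K := Fps (fun m => (\sum_(j < (mdeg m).+1) h ^+ j) m).
have gE d a : (mdeg a <= d)%N -> g a = (\sum_(j < d.+1) h ^+ j) a.
  move=> ad; rewrite /g /= !fcoef_sum (big_ord_widen d.+1 (fun j => (h ^+ j) a)) //.
  rewrite [RHS](bigID (fun j : 'I_d.+1 => (j < (mdeg a).+1)%N)) /=.
  rewrite [X in _ = _ + X]big1 ?addr0 // => j.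
  by rewrite ltnS -ltnNge => /(homogX_lt h1).
apply/asboolP; exists g; apply: fpsP => m; set d := mdeg m.
rewrite (@eq_fcoefM _ _ (\sum_(j < d.+1) h ^+ j) (- (h - 1))) => [|a b abm].
  rewrite mulrN mulrC -subrX1 opprB fcoefB [X in _ - X]homogX_lt ?subr0 //.
rewrite (gE d) /d -?abm ?mdegM ?leq_addr //.
by rewrite /h opprB subKr.
Qed.

(** The derivation that multiplies the homogeneous component of degree [d] by
    [d]. A series with invertible constant term is determined by its constant
    term and its logarithmic derivative for [euler], which is how both sides of
    the identity are compared; unlike the logarithm, it needs no series. *)
Definition euler f : fps V K := Fps (fun m => (mdeg m)%:R * f m).

Lemma eulerM f g : euler (f * g) = euler f * g + f * euler g.
Proof.
apply: fpsP => m; rewrite fcoefD [LHS](_ : _ = (mdeg m)%:R * (f * g) m) //.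
rewrite !fcoefME.
rewrite mulr_sumr -big_split; apply: eq_bigr => a _ /=.
rewrite mulr_sumr -big_split; apply: eq_bigr => b _ /=.
case: eqP => [<-|]; rewrite ?mul0r ?mulr0 ?addr0 //.
by rewrite mdegM natrD; ring.
Qed.

Lemma euler1 : euler 1 = 0.
Proof.
apply: fpsP => m; rewrite [LHS](_ : _ = (mdeg m)%:R * (m == mone)%:R) //.
by case: eqP => [->|_]; rewrite ?mulr0 // mdeg1 mul0r.
Qed.

Lemma euler_homog d f : homog d f -> euler f = d%:R *: f.
Proof.
move=> fd; apply: fpsP => m; rewrite /=.
by have [<-//|/fd ->] := eqVneq (mdeg m) d; rewrite !mulr0.
Qed.

Lemma euler_prod (I : Type) (r : seq I) (P : pred I) (F S : I -> fps V K) :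
    (forall i, P i -> euler (F i) = S i * F i) ->
  euler (\prod_(i <- r | P i) F i) =
  (\sum_(i <- r | P i) S i) * \prod_(i <- r | P i) F i.
Proof.
move=> FS; elim: r => [|i r IH]; first by rewrite !big_nil euler1 mul0r.
rewrite !big_cons; case: ifP => // Pi.
by rewrite eulerM FS // IH; ring.
Qed.

Lemma euler_inv f S : f \is a GRing.unit -> euler f = S * f ->
  euler f^-1 = - S * f^-1.
Proof.
move=> uf fS; have := euler1.
rewrite -(mulVr uf) eulerM fS => /eqP; rewrite addr_eq0 => /eqP e.
by rewrite -[LHS](mulrK uf) e mulrCA mulVr // mulr1 mulNr.
Qed.

End FpsBasics.

Arguments homog {V K}.

(** Since [S] has no constant term, the recursion
    [mdeg m * f m = \sum S a * f b] over [a * b = m] only involves coefficients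
    [f b] of degree less than [mdeg m]. *)
Lemma euler_unique (V : choiceType) (R : numFieldType) (S f g : fps V R) :
    S mone = 0 -> euler f = S * f -> euler g = S * g -> f mone = g mone ->
  f = g.
Proof.
move=> S1 fS gS fg1; apply: fpsP => m.
have [k mk] := ubnP (mdeg m); elim: k m mk => // k IH m mk.
have [->//|m1] := eqVneq m mone.
have m0 : (mdeg m)%:R != 0 :> R by rewrite pnatr_eq0 mdeg_eq0.
apply: (mulfI m0); rewrite -[LHS]/(euler f m) -[RHS]/(euler g m) fS gS.
apply: eq_fcoefM => a b abm.
have [->|a1] := eqVneq a mone; first by rewrite S1 !mul0r.
rewrite IH //; have a0 : (0 < mdeg a)%N by rewrite lt0n mdeg_eq0.
by move: mk; rewrite -abm mdegM; lia.
Qed.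

(** * Evaluation at an alphabet *)

Section RenameMorph.
Context (V V' : choiceType) (e : V -> V').
Hypothesis e_inj : injective e.
Implicit Types (m : {cmonom V}).

Lemma mrename_out m j : (forall i, e i != j) -> mrename e m j = 0%N.
Proof. by move=> ej; rewrite mrenameE big1 // => i _; rewrite (negbTE (ej i)). Qed.

Lemma mrename_injective : injective (mrename e).
Proof.
move=> m m' mm; apply/eqP/cmP => i.
by rewrite -(mrename_inj m i e_inj) mm mrename_inj.
Qed.

Lemma mrename1 : mrename e mone = mone.
Proof. by rewrite /mrename mdom1 big_seq_fset0. Qed.

Lemma mrenameM m m' :
  mrename e (mmul m m') = mmul (mrename e m) (mrename e m').
Proof.
apply/eqP/cmP => j; rewrite cmM.
have [[i <-]|] := pselect (exists i, e i = j); first by rewrite !mrename_inj // cmM.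
move=> /forallNP ej; rewrite !mrename_out // => i; exact/eqP/ej.
Qed.

(** A divisor of a renamed monomial only involves renamed variables; this makes
    [fps_rename] multiplicative. *)
Lemma mrename_factor m a b : mmul a b = mrename e m ->
  exists2 a', a = mrename e a' & exists2 b', b = mrename e b' & mmul a' b' = m.
Proof.
move=> abm.
have fac c d : mmul c d = mrename e m -> exists c', c = mrename e c'.
  move=> cdm; exists [cmonom c (e i) | i in finsupp m]%M; apply/eqP/cmP => j.
  have le_c : (c j <= mrename e m j)%N by rewrite -cdm cmM leq_addr.
  have [[i eij]|] := pselect (exists i, e i = j); last first.
    move=> /forallNP ej.
    have ej' i : e i != j by apply/eqP/ej.
    rewrite (mrename_out _ ej'); apply/eqP; rewrite -leqn0.
    by rewrite (leq_trans le_c) // (mrename_out _ ej').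
  rewrite -eij mrename_inj // cmE fsfun_fun; case: ifP => // im.
  apply/eqP; rewrite -leqn0; move: le_c; rewrite -eij mrename_inj //.
  by move/leq_trans; apply; rewrite leqn0 cmE_eq0 im.
have [a' aE] := fac _ _ abm; have [b' bE] : exists b', b = mrename e b'.
  by apply: (fac b a); rewrite mulmC.
exists a' => //; exists b' => //; apply: mrename_injective.
by rewrite mrenameM -aE -bE.
Qed.

Lemma mdeg_mrename m : mdeg (mrename e m) = mdeg m.
Proof.
rewrite /mrename mdeg_prod mdegE; apply: eq_bigr => i _.
by rewrite mdeg_expcmn mdegU muln1.
Qed.

Context (K : comNzRingType).
Implicit Types f g : fps V K.

Lemma rename_coef f m : fps_rename e f (mrename e m) = f m.
Proof.
rewrite /fps_rename /= (_ : [set _ | _] = [set m]%classic) ?fsbig_set1 //.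
by apply/seteqP; split=> [m' /mrename_injective|m' ->].
Qed.

Lemma rename_out f (m' : {cmonom V'}) : (forall m, mrename e m <> m') -> fps_rename e f m' = 0.
Proof. by move=> mm; apply: fsbig1 => m /mm. Qed.

Lemma renameD f g : fps_rename e (f + g) = fps_rename e f + fps_rename e g.
Proof.
apply: fpsP => m; rewrite fcoefD.
have [[m' <-]|/forallNP mm] := pselect (exists m', mrename e m' = m).
  by rewrite !rename_coef.
by rewrite !rename_out // addr0.
Qed.

Lemma renameZ c f : fps_rename e (c *: f) = c *: fps_rename e f.
Proof.
apply: fpsP => m; rewrite fcoefZ.
have [[m' <-]|/forallNP mm] := pselect (exists m', mrename e m' = m).
  by rewrite !rename_coef.
by rewrite !rename_out // mulr0.
Qed.

Lemma rename1 : fps_rename e 1 = 1 :> fps V' K.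
Proof.
apply: fpsP => m.
have [[m' <-]|/forallNP mm] := pselect (exists m', mrename e m' = m).
  rewrite rename_coef !fcoef1 -[X in _ = (_ == X)%:R]mrename1.
  by rewrite (inj_eq mrename_injective).
rewrite rename_out // fcoef1; case: eqP => // m1; case: (mm mone).
by rewrite mrename1.
Qed.

Lemma renameM f g : fps_rename e (f * g) = fps_rename e f * fps_rename e g.
Proof.
apply: fpsP => m.
have [[m' <-]|/forallNP mm] := pselect (exists m', mrename e m' = m); last first.
  rewrite rename_out // (@eq_fcoefM _ _ _ _ 0 0) ?mul0r // => a b abm.
  have [[a' aE]|/forallNP aN] := pselect (exists a', mrename e a' = a).
    have [[b' bE]|/forallNP bN] := pselect (exists b', mrename e b' = b).
      by case: (mm (mmul a' b')); rewrite mrenameM aE bE.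
    by rewrite (rename_out g bN) !mulr0.
  by rewrite (rename_out f aN) !mul0r.
rewrite rename_coef !fcoefM [RHS](@reindex_fsbig _ _ _ _ _
  (fun p => (mrename e p.1, mrename e p.2)) [set p | mmul p.1 p.2 = m']%classic).
  by apply: eq_fsbigr => p _; rewrite -[f p.1]rename_coef -[g p.2]rename_coef.
split.
- by move=> [a b] /= <-; rewrite mrenameM.
- by move=> [a b] [c d] _ _ [/mrename_injective -> /mrename_injective ->].
- move=> [a b] /= /mrename_factor[a' -> [b' -> abm]].
  by exists (a', b').
Qed.

End RenameMorph.

Lemma homog_rename (V V' : choiceType) (K : comNzRingType) (e : V -> V')
    (f : fps V K) d :
  injective e -> homog d f -> homog d (fps_rename e f).
Proof.
move=> e_inj fd m.
have [[m' <-]|/forallNP mm] := pselect (exists m', mrename e m' = m).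
  by rewrite mdeg_mrename // rename_coef // => /fd.
by rewrite rename_out.
Qed.

Section SymfAt.
Context (K : comNzRingType) (V : choiceType) (X : nat -> V).
Hypothesis X_inj : injective X.
Implicit Types F G : symf K.

Lemma symf_atD F G : symf_at X (F + G) = symf_at X F + symf_at X G.
Proof. exact: renameD. Qed.

Lemma symf_atZ c F : symf_at X (c *: F) = c *: symf_at X F.
Proof. exact: renameZ. Qed.

Lemma symf_at0 : symf_at X (0 : symf K) = 0.
Proof. by rewrite -[0 in LHS](scale0r (0 : symf K)) symf_atZ scale0r. Qed.

Lemma symf_at1 : symf_at X (1 : symf K) = 1.
Proof. exact: rename1. Qed.

Lemma symf_atM F G : symf_at X (F * G) = symf_at X F * symf_at X G.
Proof. exact: renameM. Qed.

Lemma symf_at_sum (I : Type) (r : seq I) (P : pred I) (F : I -> symf K) :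
  symf_at X (\sum_(i <- r | P i) F i) = \sum_(i <- r | P i) symf_at X (F i).
Proof. exact: (big_morph _ symf_atD symf_at0). Qed.

Lemma symf_at_prod (I : Type) (r : seq I) (P : pred I) (F : I -> symf K) :
  symf_at X (\prod_(i <- r | P i) F i) = \prod_(i <- r | P i) symf_at X (F i).
Proof. exact: (big_morph _ symf_atM symf_at1). Qed.

Definition pw (n : nat) : fps V K := symf_at X (symf_p1 K n).

Lemma symf_at_p lam : symf_at X (symf_p lam) = \prod_(i <- lam) pw i.
Proof. exact: symf_at_prod. Qed.

Lemma mrename_ucmX i n :
  mrename X (expcmn (ucm i) n) = expcmn (ucm (X i)) n.
Proof.
apply/eqP/cmP => j; rewrite expcmnE cmU.
have [[k <-]|] := pselect (exists k, X k = j).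
  by rewrite mrename_inj // expcmnE cmU (inj_eq X_inj).
move=> /forallNP Xj; rewrite mrename_out => [|k]; last exact/eqP/Xj.
by case: eqP => [/Xj|_] //=; rewrite muln0.
Qed.

Lemma pwE n m : pw n m = `[< exists i, m = expcmn (ucm (X i)) n >]%:R.
Proof.
have [[m' <-]|/forallNP mm] := pselect (exists m', mrename X m' = m).
  rewrite /pw /symf_at rename_coef //=; congr (nat_of_bool _)%:R.
  apply: asbool_equiv_eq; split=> -[i mE]; exists i.
    by rewrite mE mrename_ucmX.
  by apply: (mrename_injective X_inj); rewrite mE mrename_ucmX.
rewrite /pw /symf_at rename_out //.
case: asboolP => // -[i mE]; case: (mm (expcmn (ucm i) n)).
by rewrite mE mrename_ucmX.
Qed.

Lemma homog_pw n : homog n (pw n).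
Proof.
move=> m; rewrite pwE; case: asboolP => // -[i ->].
by rewrite mdeg_expcmn mdegU muln1 eqxx.
Qed.

End SymfAt.

Lemma inl_inj : injective (@inl nat nat). Proof. by move=> i j []. Qed.
Lemma inr_inj : injective (@inr nat nat). Proof. by move=> i j []. Qed.
Lemma alphabet_union_inj : injective alphabet_union.
Proof.
move=> i j; rewrite /alphabet_union.
case oi: (odd i); case oj: (odd j) => // -[hij];
by rewrite -(odd_double_half i) -(odd_double_half j) oi oj hij.
Qed.

Lemma pw_union (K : comNzRingType) n : (0 < n)%N ->
  pw K alphabet_union n = pw K inl n + pw K inr n.
Proof.
move=> n0.
have a_inj := alphabet_union_inj; have l_inj := inl_inj; have r_inj := inr_inj.
apply: fpsP => m; rewrite fcoefD !pwE //.
case: asboolP => [[i ->]|mN].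
  rewrite /alphabet_union; case: ifP => _.
    rewrite asboolF ?asboolT ?add0r //; first by exists i./2.
    move=> [j] /eqP/cmP/(_ (inr i./2)); rewrite !expcmnE !cmU eqxx muln1 muln0.
    by move=> n00; rewrite n00 in n0.
  rewrite asboolT ?asboolF ?addr0 //; last by exists i./2.
  move=> [j] /eqP/cmP/(_ (inl i./2)); rewrite !expcmnE !cmU eqxx muln1 muln0.
  by move=> n00; rewrite n00 in n0.
rewrite !asboolF ?addr0 // => -[i mE]; apply: mN.
  by exists i.*2.+1; rewrite /alphabet_union /= odd_double /= uphalf_double.
by exists i.*2; rewrite /alphabet_union /= odd_double /= doubleK.
Qed.

(** * Partitions by multiplicities *)

(** Partitions are handled through the multiplicities of their parts: a skew
    power sum is a product over part sizes, and adding a part changes a single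
    multiplicity. *)
Definition mult (lam : intpart) (i : nat) : nat := count_mem i lam.

Fact mkpart_subproof (s : seq nat) :
  sorted geq (sort geq [seq i <- s | i != 0%N]) &&
  (0%N \notin sort geq [seq i <- s | i != 0%N]).
Proof.
by rewrite sort_sorted ?mem_sort ?mem_filter.
Qed.

Definition mkpart (s : seq nat) : intpart := IntPart (mkpart_subproof s).

Lemma mult_mkpart s i : mult (mkpart s) i = if i == 0%N then 0%N else count_mem i s.
Proof.
rewrite /mult /= count_sort count_filter; case: eqP => [->|/eqP i0].
  by rewrite (eq_count (a2 := pred0)) ?count_pred0 // => j /=; case: eqP.
by apply: eq_count => j /=; case: eqP => // ->; rewrite i0.
Qed.

Lemma mult0 lam : mult lam 0 = 0%N.
Proof. by apply/count_memPn; have /andP[] := valP lam. Qed.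

Lemma intpart_eq (lam mu : intpart) :
  (forall i, mult lam i.+1 = mult mu i.+1) -> lam = mu.
Proof.
move=> lm; have {}lm i : mult lam i = mult mu i by case: i => //; rewrite !mult0.
have [/andP[ls _] /andP[ms _]] := (valP lam, valP mu).
apply: val_inj; apply: (@sorted_eq _ geq) => //.
- by move=> a b c /= ab bc; apply: leq_trans ab.
- by move=> a b /= /andP[ab ba]; apply/eqP; rewrite eqn_leq ab ba.
by apply/allP => i _; apply/eqP/lm.
Qed.

Lemma mult_psize lam i : (psize lam <= i)%N -> mult lam i.+1 = 0%N.
Proof.
move=> li; apply/count_memPn/negP => il; move: li; apply/negP; rewrite -ltnNge.
by rewrite /psize sumnE (big_rem _ il) /= leq_addr.
Qed.

Lemma prod_parts (A : comNzRingType) (x : nat -> A) lam M :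
    (forall i, (M <= i)%N -> mult lam i.+1 = 0%N) ->
  \prod_(i <- lam) x i = \prod_(i < M) x i.+1 ^+ mult lam i.+1.
Proof.
move=> lM; have /andP[_ l0] := valP lam.
have {l0} : all (fun i => (0 < i <= M)%N) lam.
  apply/allP => -[|i] il; first by rewrite il in l0.
  rewrite /= ltnNge; apply/negP => /lM/count_memPn; by rewrite il.
rewrite /mult; elim: (val lam : seq nat) => [_|a s IH /=].
  by rewrite big_nil big1 // => i _; rewrite expr0.
case/andP; case: a => // a aM sM; rewrite big_cons IH //.
under [RHS]eq_bigr do rewrite exprD.
rewrite big_split /=; congr (_ * _).
rewrite (bigD1 (Ordinal aM)) //= eqxx expr1 big1 ?mulr1 // => i.
by rewrite -val_eqE /= eqSS eq_sym => /negbTE ->.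
Qed.

Lemma psizeE lam M : (forall i, (M <= i)%N -> mult lam i.+1 = 0%N) ->
  psize lam = (\sum_(i < M) mult lam i.+1 * i.+1)%N.
Proof.
move=> lM; have /andP[_ l0] := valP lam.
have {l0} : all (fun i => (0 < i <= M)%N) lam.
  apply/allP => -[|i] il; first by rewrite il in l0.
  rewrite /= ltnNge; apply/negP => /lM/count_memPn; by rewrite il.
rewrite /psize /mult; elim: (val lam : seq nat) => [_|a s IH /=].
  by rewrite big1 // => i _.
case/andP; case: a => // a aM sM; rewrite IH //.
under [RHS]eq_bigr do rewrite mulnDl.
rewrite big_split /=; congr (_ + _)%N.
rewrite (bigD1 (Ordinal aM)) //= eqxx mul1n big1 ?addn0 // => i.
by rewrite -val_eqE /= eqSS eq_sym => /negbTE ->.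
Qed.

(** The new part is [n.+1], so that every [n] gives a partition. *)
Definition addp (n : nat) (lam : intpart) : intpart := mkpart (n.+1 :: lam).

Lemma mult_addp n lam i : mult (addp n lam) i.+1 = ((n == i) + mult lam i.+1)%N.
Proof. by rewrite mult_mkpart /= eqSS. Qed.

Lemma addp_inj n : injective (addp n).
Proof.
move=> l m lm; apply: intpart_eq => i; have := congr1 (mult^~ i.+1) lm.
by rewrite !mult_addp => /addnI.
Qed.

Lemma addp_surj n lam : mult lam n.+1 != 0%N -> exists mu, lam = addp n mu.
Proof.
rewrite -lt0n => ln; exists (mkpart (rem n.+1 lam)); apply: intpart_eq => i.
rewrite mult_addp mult_mkpart /= count_rem /=.
have nl : n.+1 \in val lam by rewrite -has_pred1 has_count.
rewrite nl /= eqSS; case: eqP => [<-|] /=; last by rewrite add0n subn0.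
by rewrite -/(mult lam n.+1) subnKC.
Qed.

Lemma psize_addp n lam : psize (addp n lam) = (n.+1 + psize lam)%N.
Proof.
rewrite /psize /= (perm_sumn (permEl (perm_sort _ _))) /=; congr (_ + _)%N.
have /andP[_ l0] := valP lam; congr sumn; apply/all_filterP/allP => i il.
by apply/eqP => i0; rewrite i0 in il; case/negP: l0.
Qed.

Definition of_mult (M : nat) (h : nat -> nat) : intpart :=
  mkpart (flatten [seq nseq (h i) i.+1 | i <- iota 0 M]).

Lemma mult_of_mult M h i : mult (of_mult M h) i.+1 = if (i < M)%N then h i else 0%N.
Proof.
rewrite mult_mkpart /= count_flatten -map_comp sumnE big_map.
rewrite -[M in iota _ M]subn0 -/(index_iota 0 M) big_mkord.
under eq_bigr do rewrite /= count_nseq /=.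
case: ifP => iM; last first.
  by rewrite big1 // => j _; case: eqP => // -[ji]; rewrite -ji ltn_ord in iM.
rewrite (bigD1 (Ordinal iM)) //= eqxx mul1n big1 ?addn0 // => j.
by rewrite -val_eqE /= eqSS => /negbTE ->.
Qed.

Definition emptyp : intpart := mkpart [::].

(** Bounded families of multiplicities enumerate partitions injectively, which
    turns sums over partitions into products of finite sums. *)
Definition boxpart (D M : nat) (h : {ffun 'I_D -> 'I_M.+1}) : intpart :=
  of_mult D (fun i => oapp h ord0 (insub i)).

Section Boxpart.
Context (D M : nat).
Implicit Type h : {ffun 'I_D -> 'I_M.+1}.

Lemma mult_boxpart h (i : 'I_D) : mult (boxpart h) i.+1 = h i.
Proof. by rewrite mult_of_mult ltn_ord (valK i). Qed.

Lemma mult_boxpart0 h i : (D <= i)%N -> mult (boxpart h) i.+1 = 0%N.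
Proof. by rewrite mult_of_mult leqNgt => /negbTE ->. Qed.

Lemma boxpart_inj : injective (@boxpart D M).
Proof.
by move=> h g hg; apply/ffunP => i; apply: val_inj; rewrite -[LHS]mult_boxpart hg mult_boxpart.
Qed.

Lemma boxpart_onto l : (forall i, (D <= i)%N -> mult l i.+1 = 0%N) ->
  (forall i, (mult l i.+1 <= M)%N) -> exists h, boxpart h = l.
Proof.
move=> lD lM; exists [ffun i : 'I_D => inord (mult l i.+1)].
apply: intpart_eq => i; have [iD|Di] := ltnP i D; last by rewrite mult_boxpart0 // lD.
by rewrite -[i]/(nat_of_ord (Ordinal iD)) mult_boxpart ffunE inordK // ltnS.
Qed.

Lemma mult_le_psize l i : (mult l i.+1 <= psize l)%N.
Proof.
have [il|/mult_psize ->//] := ltnP i (psize l).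
rewrite [leqRHS](@psizeE l (psize l)) => [|j]; last exact: mult_psize.
by rewrite (bigD1 (Ordinal il)) //= mulnS -addnA leq_addr.
Qed.

Lemma boxpart_psize l : (psize l <= D)%N -> (psize l <= M)%N ->
  exists h, boxpart h = l.
Proof.
move=> lD lM; apply: boxpart_onto => i; last exact: leq_trans (mult_le_psize l i) lM.
by move=> Di; rewrite mult_psize // (leq_trans lD).
Qed.

Lemma psize_boxpart h : psize (boxpart h) = (\sum_(i < D) h i * i.+1)%N.
Proof.
rewrite (psizeE (mult_boxpart0 h)); apply: eq_bigr => i _.
by rewrite mult_boxpart.
Qed.

End Boxpart.

Lemma finite_psize_le d : finite_set [set l | (psize l <= d)%N].
Proof.
apply: (@sub_finite_set _ _ (@boxpart d d @` setT)); last exact: finite_image.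
by move=> l /= ld; have [h] := boxpart_psize ld ld; exists h.
Qed.

(** The finite sets over which the traces are truncated. *)
Definition parts_le (d : nat) : {fset intpart} := fset_set [set l | (psize l <= d)%N].

Lemma mem_parts_le d l : (l \in parts_le d) = (psize l <= d)%N.
Proof.
rewrite in_fset_set; last exact: finite_psize_le.
by apply/idP/idP => [/set_mem|/mem_set].
Qed.

(** * Skew power sums *)

Section Pskew.
Context (A : comNzRingType) (x : nat -> A).
Implicit Types lam mu : intpart.

(** The coefficient of [b ^+ m] in [(y + b) ^+ l]. *)
Definition binx (y : A) (l m : nat) : A := 'C(l, m)%:R * y ^+ (l - m).

Lemma binx0 y l m : (l < m)%N -> binx y l m = 0.
Proof. by move=> lm; rewrite /binx bin_small // mul0r. Qed.

Lemma binxSS y l m : binx y l.+1 m.+1 = y * binx y l m.+1 + binx y l m.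
Proof.
rewrite /binx subSS binS natrD mulrDl; congr (_ + _).
have [lm|ml] := leqP l m; first by rewrite bin_small // !mul0r mulr0.
by rewrite mulrCA -exprS -subSn.
Qed.

Lemma binxS0 y l : binx y l.+1 0 = y * binx y l 0.
Proof. by rewrite /binx !bin0 !subn0 !mul1r exprS. Qed.

Lemma binx_diag y l m : m.+1%:R * binx y l.+1 m.+1 = l.+1%:R * binx y l m.
Proof. by rewrite /binx subSS !mulrA -!natrM -mul_bin_diag. Qed.

Lemma binx_up y l m :
  y * (m.+1%:R * binx y l m.+1) = (l - m)%:R * binx y l m.
Proof.
rewrite /binx; have [lm|ml] := leqP l m.
  have -> : (l - m = 0)%N by apply/eqP; rewrite subn_eq0.
  by rewrite bin_small // !(mul0r, mulr0).
set z := y ^+ _; transitivity ((m.+1 * 'C(l, m.+1))%:R * (y * z)).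
  by rewrite natrM; ring.
by rewrite /z -exprS subnSK // mul_bin_left natrM mulrA.
Qed.

(** The coefficient of [p_mu(Y)] in [p_lam(X, Y)], in terms of the power sums
    [x] of [X]. *)
Definition pskew lam mu : A :=
  \prod_(i < maxn (psize lam) (psize mu))
    binx (x i.+1) (mult lam i.+1) (mult mu i.+1).

Lemma pskewE M lam mu :
    (forall i, (M <= i)%N -> mult lam i.+1 = 0%N) ->
    (forall i, (M <= i)%N -> mult mu i.+1 = 0%N) ->
  pskew lam mu = \prod_(i < M) binx (x i.+1) (mult lam i.+1) (mult mu i.+1).
Proof.
pose F i := binx (x i.+1) (mult lam i.+1) (mult mu i.+1).
suff gen a b : (a <= b)%N ->
    (forall i, (a <= i)%N -> mult lam i.+1 = 0%N /\ mult mu i.+1 = 0%N) ->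
    \prod_(i < a) F i = \prod_(i < b) F i.
  move=> lM mM; rewrite /pskew -/(F _); set D := maxn _ _.
  transitivity (\prod_(i < D + M) F i).
    apply: gen; first exact: leq_addr.
    by move=> i; rewrite geq_max => /andP[? ?]; rewrite !mult_psize.
  by apply/esym/gen; [exact: leq_addl|move=> i Mi; rewrite lM ?mM].
move=> ab ab0; rewrite (big_ord_widen _ _ ab) big_mkcond /=; apply: eq_bigr => i _.
case: ltnP => // /ab0[l0 m0]; by rewrite /F l0 m0 /binx bin0 mulr1.
Qed.

(** Adding a part [n.+1] to either partition changes a single factor. *)
Lemma pskew_split n lam mu : exists r : A, [/\
  pskew lam mu = binx (x n.+1) (mult lam n.+1) (mult mu n.+1) * r,
  pskew (addp n lam) mu = binx (x n.+1) (mult lam n.+1).+1 (mult mu n.+1) * r,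
  pskew lam (addp n mu) = binx (x n.+1) (mult lam n.+1) (mult mu n.+1).+1 * r &
  pskew (addp n lam) (addp n mu) =
    binx (x n.+1) (mult lam n.+1).+1 (mult mu n.+1).+1 * r].
Proof.
pose M := (n.+1 + (psize lam + psize mu))%N.
have nM : (n < M)%N by rewrite ltn_addr.
have l0 i : (M <= i)%N -> mult lam i.+1 = 0%N.
  by move=> Mi; rewrite mult_psize //; apply: leq_trans Mi; rewrite /M; lia.
have m0 i : (M <= i)%N -> mult mu i.+1 = 0%N.
  by move=> Mi; rewrite mult_psize //; apply: leq_trans Mi; rewrite /M; lia.
have la i : (M <= i)%N -> mult (addp n lam) i.+1 = 0%N.
  move=> Mi; rewrite mult_addp l0 //; case: eqP => // ni; move: Mi nM; lia.
have ma i : (M <= i)%N -> mult (addp n mu) i.+1 = 0%N.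
  move=> Mi; rewrite mult_addp m0 //; case: eqP => // ni; move: Mi nM; lia.
pose N : 'I_M := Ordinal nM.
exists (\prod_(i < M | i != N) binx (x i.+1) (mult lam i.+1) (mult mu i.+1)).
split; rewrite (@pskewE M) // (bigD1 N) //= ?mult_addp ?eqxx ?add1n //;
  congr (_ * _); apply: eq_bigr => i; rewrite -val_eqE /= eq_sym => /negbTE iN;
  by rewrite ?mult_addp ?iN.
Qed.

Lemma pskew_addpp n lam mu : pskew (addp n lam) (addp n mu) =
  x n.+1 * pskew lam (addp n mu) + pskew lam mu.
Proof.
by have [r [-> _ -> ->]] := pskew_split n lam mu; rewrite binxSS mulrDl mulrA.
Qed.

Lemma pskew_addp0 n lam mu : mult mu n.+1 = 0%N ->
  pskew (addp n lam) mu = x n.+1 * pskew lam mu.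
Proof.
by have [r [-> -> _ _]] := pskew_split n lam mu => ->; rewrite binxS0 mulrA.
Qed.

Lemma pskew_diag n lam mu :
  (mult mu n.+1).+1%:R * pskew (addp n lam) (addp n mu) =
  (mult lam n.+1).+1%:R * pskew lam mu.
Proof.
by have [r [-> _ _ ->]] := pskew_split n lam mu; rewrite [LHS]mulrA binx_diag -mulrA.
Qed.

Lemma pskew_0addp n lam mu : mult lam n.+1 = 0%N -> pskew lam (addp n mu) = 0.
Proof.
by have [r [_ _ -> _]] := pskew_split n lam mu => ->; rewrite binx0 // mul0r.
Qed.

Lemma pskew_up n lam mu :
  x n.+1 * ((mult mu n.+1).+1%:R * pskew lam (addp n mu)) =
  (mult lam n.+1 - mult mu n.+1)%:R * pskew lam mu.
Proof.
have [r [-> _ -> _]] := pskew_split n lam mu.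
by rewrite [_%:R * (_ * r)]mulrA [LHS]mulrA binx_up mulrA.
Qed.

Lemma pskew_neq0 lam mu : pskew lam mu != 0 ->
  forall i, (mult mu i.+1 <= mult lam i.+1)%N.
Proof.
move=> p0 i; rewrite leqNgt; apply/negP => lm.
have [im|mi] := ltnP i (psize mu); last by rewrite (mult_psize mi) in lm.
have iM : (i < maxn (psize lam) (psize mu))%N by rewrite leq_max im orbT.
by case/eqP: p0; rewrite /pskew (bigD1 (Ordinal iM)) //= binx0 // mul0r.
Qed.

End Pskew.

Lemma sum_fset_image (A : nmodType) (I : finType) (J : choiceType) (f : I -> J)
    (S : {fset J}) (T : J -> A) : injective f ->
    (forall i, T (f i) != 0 -> f i \in S) ->
    (forall j, T j != 0 -> exists i, f i = j) ->
  \sum_(i : I) T (f i) = \sum_(j <- S) T j.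
Proof.
move=> f_inj fS Tf.
transitivity (\sum_(j <- [seq j <- map f (index_enum I) | T j != 0]) T j).
  rewrite big_filter big_map [RHS]big_mkcond; apply: eq_bigr => i _.
  by case: eqP.
transitivity (\sum_(j <- [seq j <- S | T j != 0]) T j); last first.
  by rewrite big_filter [LHS]big_mkcond; apply: eq_bigr => i _; case: eqP.
apply: perm_big; apply: uniq_perm; rewrite ?filter_uniq ?fset_uniq //.
  by rewrite map_inj_uniq // index_enum_uniq.
move=> j; rewrite !mem_filter; case: eqP => //= /eqP Tj.
have [i ij] := Tf j Tj; rewrite -ij fS ?ij //; by apply/mapP; exists i.
Qed.

(** Expanding [\prod_(i in lam) (x i + y i)] part by part. *)
Lemma prod_union (A : comNzRingType) (x y : nat -> A) lam (S : {fset intpart}) :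
    (forall mu, (psize mu <= psize lam)%N -> mu \in S) ->
  \prod_(i <- lam) (x i + y i) =
  \sum_(mu <- S) pskew x lam mu * \prod_(i <- mu) y i.
Proof.
move=> lamS; pose M := psize lam.
have l0 i : (M <= i)%N -> mult lam i.+1 = 0%N by move/mult_psize.
rewrite -(@sum_fset_image _ _ _ (@boxpart M M)).
- rewrite (prod_parts _ l0).
  transitivity (\prod_(i < M) \sum_(k < M.+1)
      binx (x i.+1) (mult lam i.+1) k * y i.+1 ^+ k).
    apply: eq_bigr => i _; rewrite exprDn.
    have lM1 : ((mult lam i.+1).+1 <= M.+1)%N by rewrite ltnS mult_le_psize.
    rewrite (big_ord_widen _ (fun k =>
      (x i.+1 ^+ (mult lam i.+1 - k) * y i.+1 ^+ k) *+ 'C(mult lam i.+1, k)) lM1).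
    rewrite big_mkcond; apply: eq_bigr => k _; rewrite /= ltnS.
    case: leqP => [_|lk]; last by rewrite binx0 // mul0r.
    by rewrite /binx -mulrA mulr_natl.
  rewrite bigA_distr_bigA; apply: eq_bigr => h _.
  rewrite (pskewE _ l0 (mult_boxpart0 h)) (prod_parts _ (mult_boxpart0 h)) -big_split.
  by apply: eq_bigr => i _; rewrite mult_boxpart.
- exact: boxpart_inj.
- move=> h; have [->|/pskew_neq0 hl _] := eqVneq (pskew x lam (boxpart h)) 0.
    by rewrite mul0r eqxx.
  apply: lamS; rewrite (psizeE (mult_boxpart0 h)) (psizeE l0); apply: leq_sum => i _.
  by rewrite leq_mul2r hl orbT.
- move=> mu; have [->|/pskew_neq0 ml _] := eqVneq (pskew x lam mu) 0.
    by rewrite mul0r eqxx.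
  apply: boxpart_onto => i; last exact: leq_trans (ml i) (mult_le_psize lam i).
  by move=> Mi; apply/eqP; rewrite -leqn0 -(l0 _ Mi).
Qed.

Lemma pskew_morph (A B : comNzRingType) (phi : A -> B) (x : nat -> A)
    (y : nat -> B) lam mu :
  (forall a b, phi (a * b) = phi a * phi b) ->
  (forall k, phi k%:R = k%:R) -> (forall n, phi (x n) = y n) ->
  phi (pskew x lam mu) = pskew y lam mu.
Proof.
move=> phiM phin phix.
have phi1 : phi 1 = 1 by rewrite -[1 in LHS]/(1%:R) phin.
rewrite /pskew (big_morph phi phiM phi1); apply: eq_bigr => i _.
rewrite /binx phiM phin; congr (_ * _).
elim: (_ - _)%N => [|n IH]; first by rewrite !expr0.
by rewrite !exprS phiM phix IH.
Qed.

Lemma pskew_delta (A : comNzRingType) (x : nat -> A) lam mu :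
  (forall n, x n.+1 = 0) -> pskew x lam mu = (lam == mu)%:R.
Proof.
move=> x0; case: (eqVneq lam mu) => [->|lm].
  by rewrite /pskew big1 // => i _; rewrite /binx binn subnn mulr1.
apply/eqP; apply: contraTT lm => p0; rewrite negbK; apply/eqP/intpart_eq => i.
have ml := pskew_neq0 p0.
apply/eqP; rewrite eqn_leq ml andbT leqNgt; apply/negP => mli.
have [il|/mult_psize l0] := ltnP i (psize lam); last by rewrite l0 in mli.
have iM : (i < maxn (psize lam) (psize mu))%N by rewrite leq_max il.
case/eqP: p0; rewrite /pskew (bigD1 (Ordinal iM)) //= /binx x0 expr0n.
by rewrite subn_eq0 leqNgt mli mulr0 mul0r.
Qed.

Lemma pskew_homog (V : choiceType) (K : comNzRingType) (x : nat -> fps V K)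
    lam mu m : (forall n, homog n.+1 (x n.+1)) ->
  pskew x lam mu m != 0 -> (psize mu + mdeg m = psize lam)%N.
Proof.
move=> hx pm.
have p0 : pskew x lam mu != 0 by apply: contraNneq pm => ->.
have ml := pskew_neq0 p0; pose M := maxn (psize lam) (psize mu).
have l0 i : (M <= i)%N -> mult lam i.+1 = 0%N.
  by rewrite geq_max => /andP[/mult_psize].
have m0 i : (M <= i)%N -> mult mu i.+1 = 0%N.
  by rewrite geq_max => /andP[_ /mult_psize].
have hp : homog (\sum_(i < M) i.+1 * (mult lam i.+1 - mult mu i.+1))%N
    (pskew x lam mu).
  rewrite /pskew -/M.
  apply: (@homog_prod _ _ _ _ _
    (fun i : 'I_M => i.+1 * (mult lam i.+1 - mult mu i.+1))%N) => i.
  rewrite /binx mulr_natl -scaler_nat.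
  by apply: homogZ; apply: homogX.
have -> : mdeg m = (\sum_(i < M) i.+1 * (mult lam i.+1 - mult mu i.+1))%N.
  by apply/eqP; apply: contraNT pm => /hp ->.
rewrite (psizeE l0) (psizeE m0) -big_split; apply: eq_bigr => i _ /=.
by rewrite [(i.+1 * _)%N]mulnC -mulnDl subnKC.
Qed.

Section Norm.
Context (R : realType) (q t : R).
Hypotheses (q01 : 0 < q < 1) (t01 : 0 < t < 1).

(** The factor that the deformation of the scalar product adds to a part
    [n.+1]. *)
Definition kap n : R := (1 - q ^+ n.+1) / (1 - t ^+ n.+1).

Lemma onesub_gt0 (v : R) n : 0 < v < 1 -> 0 < 1 - v ^+ n.+1.
Proof.
by case/andP => v0 v1; rewrite subr_gt0 exprn_ilt1 // ltW.
Qed.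

Lemma kap_gt0 n : 0 < kap n.
Proof. by rewrite divr_gt0 ?onesub_gt0. Qed.

Definition normf n (k : nat) : R := k`!%:R * (n.+1%:R * kap n) ^+ k.

Lemma macdonald_normE M lam : (forall i, (M <= i)%N -> mult lam i.+1 = 0%N) ->
  macdonald_norm q t lam = \prod_(i < M) normf i (mult lam i.+1).
Proof.
move=> lM; rewrite /macdonald_norm (prod_parts (fun i => (1 - q ^+ i) / (1 - t ^+ i)) lM).
rewrite big_add1 /= big_mkord.
have -> : \prod_(i < psize lam)
    ((count_mem i.+1 lam)`! * i.+1 ^ count_mem i.+1 lam)%:R =
    \prod_(i < M) ((mult lam i.+1)`! * i.+1 ^ mult lam i.+1)%:R :> R.
  pose F i : R := ((mult lam i.+1)`! * i.+1 ^ mult lam i.+1)%:R.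
  have gen a b : (a <= b)%N -> (forall i, (a <= i)%N -> mult lam i.+1 = 0%N) ->
      \prod_(i < a) F i = \prod_(i < b) F i.
    move=> ab a0; rewrite (big_ord_widen _ F ab) big_mkcond.
    by apply: eq_bigr => i _; case: ltnP => // /a0 i0; rewrite /F i0.
  rewrite -/(F _) (gen _ _ (leq_addr M (psize lam))); last by move=> i /mult_psize.
  by apply/esym/gen => //; apply: leq_addl.
rewrite -big_split; apply: eq_bigr => i _.
by rewrite /= -/(kap i) /normf [in RHS]exprMn natrM natrX mulrA.
Qed.

Lemma normf_gt0 n k : 0 < normf n k.
Proof. by rewrite mulr_gt0 ?ltr0n ?fact_gt0 // exprn_gt0 // mulr_gt0 ?kap_gt0. Qed.

Lemma macdonald_norm_gt0 lam : 0 < macdonald_norm q t lam.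
Proof.
rewrite (@macdonald_normE (psize lam)) => [|i /mult_psize //].
by rewrite prodr_gt0 // => i _; apply: normf_gt0.
Qed.

Lemma macdonald_norm_addp n lam : macdonald_norm q t (addp n lam) =
  (mult lam n.+1).+1%:R * (n.+1%:R * kap n) * macdonald_norm q t lam.
Proof.
pose M := (n.+1 + psize lam)%N; have nM : (n < M)%N by rewrite ltn_addr.
have l0 i : (M <= i)%N -> mult lam i.+1 = 0%N.
  by move=> Mi; rewrite mult_psize //; apply: leq_trans Mi; rewrite leq_addl.
have la i : (M <= i)%N -> mult (addp n lam) i.+1 = 0%N.
  by move=> Mi; rewrite mult_addp l0 //; case: eqP => // ni; move: Mi nM; lia.
rewrite (macdonald_normE l0) (macdonald_normE la) (bigD1 (Ordinal nM)) //=.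
rewrite [in RHS](bigD1 (Ordinal nM)) //=.
rewrite mult_addp eqxx add1n [RHS]mulrA; congr (_ * _).
  rewrite /normf factS natrM exprS.
  by rewrite mulrACA.
apply: eq_bigr => i; rewrite -val_eqE /= eq_sym mult_addp => /negbTE ->.
by rewrite add0n.
Qed.

End Norm.

(** * Power sums as a basis of the symmetric functions *)

(** Comparing the exponents on an interval of variables, zeros included, makes
    two multisets of exponents into two tuples of the same size. *)
Lemma perm_eq_extend (N : nat) (m : {cmonom nat}) :
    (forall i, i \in finsupp m -> (i < N)%N) ->
  perm_eq [seq m i | i <- iota 0 N]
    ([seq m i | i <- finsupp m] ++ nseq (N - #|` finsupp m|) 0%N).
Proof.
move=> mN; pose s := [seq i <- iota 0 N | i \in finsupp m].
pose s' := [seq i <- iota 0 N | i \notin finsupp m].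
have ps : perm_eq s (finsupp m).
  apply: uniq_perm; rewrite ?filter_uniq ?iota_uniq ?fset_uniq // => i.
  by rewrite mem_filter mem_iota add0n /=; case im: (i \in _) => //=; rewrite mN.
have s'0 : [seq m i | i <- s'] = nseq (N - #|` finsupp m|) 0%N.
  have -> : (N - #|` finsupp m| = size s')%N.
    rewrite -(perm_size ps); have := count_predC (mem (finsupp m)) (iota 0 N).
    rewrite size_iota !size_filter => NE.
    by rewrite -[X in (X - _)%N]NE addKn.
  have : {in s', forall i, m i = 0%N}.
    by move=> i; rewrite mem_filter => /andP[]; rewrite -cmE_eq0 => /eqP.
  elim: s' => //= i r IH ir; rewrite ir ?mem_head // IH // => j jr.
  by rewrite ir // inE jr orbT.
rewrite -s'0 -(permPr (perm_cat (perm_map m ps) (perm_refl _))) -map_cat.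
by apply: perm_map; rewrite perm_sym perm_filterC.
Qed.

(** Monomials with the same exponents are exchanged by a finite permutation of
    the variables. *)
Lemma symmetric_coef (K : comNzRingType) (f : fps nat K) (m m' : {cmonom nat}) :
    fps_symmetric f ->
    perm_eq [seq m i | i <- finsupp m] [seq m' i | i <- finsupp m'] ->
  f m = f m'.
Proof.
move=> fs mm'; pose N := (\max_(i <- finsupp m ++ finsupp m') i).+1.
have mN i : i \in finsupp m -> (i < N)%N.
  by move=> im; rewrite ltnS (@leq_bigmax_seq _ _ xpredT id) // mem_cat im.
have m'N i : i \in finsupp m' -> (i < N)%N.
  by move=> im; rewrite ltnS (@leq_bigmax_seq _ _ xpredT id) // mem_cat im orbT.
clearbody N.
have mS : #|` finsupp m| = #|` finsupp m'|.
  by have := perm_size mm'; rewrite !size_map.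
have pN : perm_eq [tuple m i | i < N] [tuple m' i | i < N].
  have tE (h : {cmonom nat}) : [tuple h i | i < N] = [seq h i | i <- iota 0 N] :> seq nat.
    by rewrite /= -val_enum_ord -map_comp.
  rewrite !tE (permPl (perm_eq_extend mN)) (permPr (perm_eq_extend m'N)) mS.
  by rewrite perm_cat2r.
have [s sE] := tuple_permP pN.
pose g (p : {perm 'I_N}) i := if insub i is Some j then p j : nat else i.
have gE p (j : 'I_N) : g p j = p j by rewrite /g (valK j).
have g0 p i : (N <= i)%N -> g p i = i.
  by move=> Ni; rewrite /g insubF //; apply/negbTE; rewrite -leqNgt.
have gK p : cancel (g p) (g (p^-1)%g).
  move=> i; have [iN|Ni] := ltnP i N; last by rewrite !g0.
  by rewrite -[i]/(nat_of_ord (Ordinal iN)) gE gE permK.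
have gK' : cancel (g (s^-1)%g) (g s) by have := gK (s^-1)%g; rewrite invgK.
symmetry; apply: (fs (g s)); first by exists (g (s^-1)%g).
move=> i; have [iN|Ni] := ltnP i N.
  rewrite -[i]/(nat_of_ord (Ordinal iN)) gE; set j := Ordinal iN.
  have : [tuple m i | i < N] = [tuple tnth [tuple m' i | i < N] (s i) | i < N].
    exact: val_inj.
  by move/(congr1 (fun u => tnth u j)); rewrite !tnth_mktuple.
rewrite g0 //.
have hN (h : {cmonom nat}) : (forall i, i \in finsupp h -> (i < N)%N) -> h i = 0%N.
  by move=> hN; apply/eqP; rewrite cmE_eq0; apply/negP => /hN; rewrite ltnNge Ni.
by rewrite !hN.
Qed.

Definition xmon (lam : intpart) : {cmonom nat} :=
  [cmonom nth 0%N lam i | i in seq_fset tt (iota 0 (size lam))]%M.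

Lemma xmonE lam i : xmon lam i = nth 0%N lam i.
Proof.
rewrite cmE fsfun_fun seq_fsetE mem_iota add0n /=.
by case: ltnP => // /(nth_default 0%N) ->.
Qed.

Lemma xmon_perm lam : perm_eq [seq xmon lam i | i <- finsupp (xmon lam)] lam.
Proof.
have lE : [seq xmon lam i | i <- iota 0 (size lam)] = lam.
  rewrite -[RHS](mkseq_nth 0%N) /mkseq; apply: eq_map => i; exact: xmonE.
rewrite -[X in perm_eq _ X]lE; apply/perm_map/uniq_perm.
- exact: fset_uniq.
- exact: iota_uniq.
move=> i; rewrite -cmE_neq0 xmonE mem_iota add0n /=.
have [il|li] := ltnP i (size lam); last by rewrite nth_default.
have /andP[_ l0] := valP lam; have := mem_nth 0%N il.
by apply: contraTneq => ->.
Qed.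

Lemma intpart_perm (lam mu : intpart) : perm_eq lam mu -> lam = mu.
Proof. by move=> /seq.permP lm; apply: intpart_eq => i; apply: lm. Qed.

Definition exponents (m : {cmonom nat}) : intpart := mkpart [seq m i | i <- finsupp m].

Lemma exponents_perm (m : {cmonom nat}) : perm_eq [seq m i | i <- finsupp m] (exponents m).
Proof.
rewrite /exponents /mkpart /= perm_sym perm_sort; apply/permPl.
rewrite (_ : [seq i <- _ | _] = [seq m i | i <- finsupp m]) //.
by apply/all_filterP/allP => _ /mapP[i im ->]; rewrite cmE_neq0.
Qed.

Lemma psize_exponents (m : {cmonom nat}) : psize (exponents m) = mdeg m.
Proof. by rewrite /psize -(perm_sumn (exponents_perm m)) sumnE big_map. Qed.

Definition parts_of (d : nat) : {fset intpart} :=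
  [fset l in parts_le d | psize l == d]%fset.

Lemma mem_parts_of d l : (l \in parts_of d) = (psize l == d).
Proof.
by rewrite !inE mem_parts_le; case: eqP => [->|]; rewrite ?andbF ?leqnn.
Qed.

Section Span.
Context (K : comNzRingType).

Lemma symf_valD (F G : symf K) : symf_val (F + G) = symf_val F + symf_val G.
Proof. by []. Qed.
Lemma symf_valZ c (F : symf K) : symf_val (c *: F) = c *: symf_val F.
Proof. by []. Qed.
Lemma symf_valM (F G : symf K) : symf_val (F * G) = symf_val F * symf_val G.
Proof. by []. Qed.

Lemma symf_val_sum (I : Type) (r : seq I) (P : pred I) (F : I -> symf K) :
  symf_val (\sum_(i <- r | P i) F i) = \sum_(i <- r | P i) symf_val (F i).
Proof. exact: (big_morph _ symf_valD). Qed.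

Lemma symf_mE (lam : intpart) m : (symf_m lam : symf K) m = (exponents m == lam)%:R.
Proof.
rewrite /symf_m /=; congr (nat_of_bool _)%:R.
rewrite (permPl (exponents_perm m)); apply/idP/eqP => [/intpart_perm //|->].
exact: perm_refl.
Qed.

Lemma exponents_xmon lam : exponents (xmon lam) = lam.
Proof.
apply: intpart_perm; rewrite -(permPl (exponents_perm _)); exact: xmon_perm.
Qed.

Lemma homog_symf_m lam : homog (psize lam) (symf_m lam : symf K).
Proof.
move=> m; rewrite symf_mE -psize_exponents.
by case: (eqVneq (exponents m) lam) => [->|//]; rewrite eqxx.
Qed.

Lemma symf_coef_eq (F : symf K) m m' : exponents m = exponents m' -> F m = F m'.
Proof.
move=> mm'; have /asboolP[Fs _] := valP F; apply: symmetric_coef => //.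
by rewrite (permPl (exponents_perm m)) mm' perm_sym exponents_perm.
Qed.

(** A symmetric function is determined by its coefficients on one monomial for
    each partition. *)
Lemma symf_m_span d (F : symf K) : homog d F ->
  F = \sum_(mu <- parts_of d) F (xmon mu) *: symf_m mu.
Proof.
move=> Fd; apply: val_inj; rewrite /= symf_val_sum; apply: fpsP => m.
rewrite fcoef_sum.
under eq_bigr do rewrite symf_valZ fcoefZ symf_mE.
have [md|/Fd F0] := eqVneq (mdeg m) d; last first.
  rewrite big1_fset ?F0 // => mu _ _.
  case: eqP => [E|_]; last by rewrite mulr0.
  by rewrite (@symf_coef_eq F (xmon mu) m) ?F0 ?mul0r // exponents_xmon.
have em : exponents m \in parts_of d by rewrite mem_parts_of psize_exponents md.
rewrite (big_fsetD1 _ em) /= eqxx mulr1 big1_fset ?addr0.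
  by apply: symf_coef_eq; rewrite exponents_xmon.
by move=> mu; rewrite !inE eq_sym => /andP[/negbTE -> _] _; rewrite mulr0.
Qed.

Lemma homog_symf_p lam : homog (psize lam) (symf_p lam : symf K).
Proof.
rewrite /symf_p (big_morph _ symf_valM (erefl (symf_val 1))) /psize sumnE.
apply: homog_prod => i m; rewrite /= ; case: asboolP => // -[j ->].
by rewrite mdeg_expcmn mdegU muln1 eqxx.
Qed.

End Span.

(** * Change of basis from power sums to Macdonald functions *)

Section FinMatrix.
Context (F : fieldType) (T : finType).
Implicit Types a b : T -> T -> F.

Let mx a : 'M[F]_#|T| := \matrix_(i, j) a (enum_val i) (enum_val j).

Let sum_enum (f : T -> F) : \sum_x f x = \sum_(i < #|T|) f (enum_val i).
Proof. by rewrite (reindex _ (onW_bij _ (@enum_val_bij T))). Qed.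

Lemma fun_inverse_comm a b :
    (forall x y, \sum_z a x z * b z y = (x == y)%:R) ->
  forall x y, \sum_z b x z * a z y = (x == y)%:R.
Proof.
move=> ab x y; have /mulmx1C ba : mx a *m mx b = 1%:M.
  apply/matrixP => i j; rewrite !mxE -(inj_eq enum_val_inj) -ab sum_enum.
  by apply: eq_bigr => k _; rewrite !mxE.
have := congr1 (fun M : 'M_#|T| => M (enum_rank x) (enum_rank y)) ba.
rewrite !mxE (inj_eq enum_rank_inj) => <-; rewrite sum_enum.
by apply: eq_bigr => k _; rewrite !mxE !enum_rankK.
Qed.

Lemma free_left_inverse a :
    (forall c : T -> F, (forall y, \sum_x c x * a x y = 0) -> forall x, c x = 0) ->
  exists b, forall x y, \sum_z b x z * a z y = (x == y)%:R.
Proof.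
move=> a_free; have ua : mx a \in unitmx.
  rewrite -row_free_unit -kermx_eq0; apply/eqP/row_matrixP => i; rewrite row0.
  apply/rowP => j; pose c x := row i (kermx (mx a)) ord0 (enum_rank x).
  have c0 : forall y, \sum_x c x * a x y = 0.
    move=> y; rewrite sum_enum.
    transitivity ((kermx (mx a) *m mx a) i (enum_rank y)); last first.
      by rewrite mulmx_ker mxE.
    rewrite [RHS]mxE; apply: eq_bigr => k _.
    by rewrite /c enum_valK [mx a _ _]mxE enum_rankK [row _ _ _ _]mxE.
  by have := a_free c c0 (enum_val j); rewrite /c enum_valK => ->; rewrite mxE.
exists (fun x y => invmx (mx a) (enum_rank x) (enum_rank y)) => x y.
transitivity ((invmx (mx a) *m mx a) (enum_rank x) (enum_rank y)); last first.
  by rewrite mulVmx // mxE (inj_eq enum_rank_inj).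
rewrite [RHS]mxE sum_enum; apply: eq_bigr => k _.
by rewrite enum_valK [mx a _ _]mxE enum_rankK.
Qed.

End FinMatrix.

(** The index sets below are finite subsets of the type of all partitions, on
    which matrices are functions of two partitions. *)

Section FsetMatrix.
Context (F : fieldType) (J : choiceType) (S : {fset J}).
Implicit Types a b : J -> J -> F.

Lemma fset_inverse_comm a b :
    {in S &, forall x y, \sum_(z <- S) a x z * b z y = (x == y)%:R} ->
  {in S &, forall x y, \sum_(z <- S) b x z * a z y = (x == y)%:R}.
Proof.
move=> ab x y xS yS; rewrite big_seq_fsetE.
rewrite (@fun_inverse_comm _ _ (fun u v : S => a (val u) (val v))
  (fun u v => b (val u) (val v)) _ [` xS]%fset [` yS]%fset) //.
by move=> u v; rewrite -val_eqE -ab ?fsvalP // big_seq_fsetE.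
Qed.

Lemma fset_left_inverse a :
    (forall c : J -> F, {in S, forall y, \sum_(x <- S) c x * a x y = 0} ->
       {in S, forall x, c x = 0}) ->
  exists b, {in S &, forall x y, \sum_(z <- S) b x z * a z y = (x == y)%:R}.
Proof.
move=> a_free.
have [|b ba] := @free_left_inverse _ _ (fun u v : S => a (val u) (val v)).
  move=> c c0 x; pose c' j := oapp c 0 (insub j : option S).
  have c'E u : c' (val u) = c u by rewrite /c' valK.
  rewrite -c'E; apply: a_free; last exact: fsvalP.
  move=> y yS; rewrite big_seq_fsetE -[RHS](c0 [` yS]%fset).
  by apply: eq_bigr => u _; rewrite c'E.
pose b' i j := oapp (fun u => oapp (b u) 0 (insub j : option S)) 0 (insub i : option S).
exists b' => x y xS yS; rewrite big_seq_fsetE -[RHS](ba [` xS]%fset [` yS]%fset).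
apply: eq_bigr => u _; congr (_ * _).
by rewrite /b' valK /= insubT.
Qed.

End FsetMatrix.

Section MacdonaldBasis.
Context (R : realType) (q t : R).
Hypotheses (q01 : 0 < q < 1) (t01 : 0 < t < 1).
Context (form : {bilinear symf R -> symf R -> R | *%R & *%R}).
Context (P : intpart -> symf R).
Hypotheses (formE : is_macdonald_form q t form) (PE : is_macdonald_P form P).

Local Notation z := (macdonald_norm q t).
Let z_gt0 lam : 0 < z lam := macdonald_norm_gt0 q01 t01 lam.

Lemma form_sum_p (S : {fset intpart}) (a b : intpart -> R) :
  form (\sum_(l <- S) a l *: symf_p l) (\sum_(l <- S) b l *: symf_p l) =
  \sum_(l <- S) a l * b l * z l.
Proof.
rewrite linear_sumlz big_seq [RHS]big_seq; apply: eq_bigr => l lS.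
rewrite linear_sumr (big_fsetD1 l) //= big1_fset ?addr0 => [|m].
  by rewrite linearZl_LR linearZr_LR /= formE eqxx; ring.
rewrite in_fsetD1 => /andP[ml _] _.
by rewrite linearZl_LR linearZr_LR /= formE eq_sym (negbTE ml); ring.
Qed.

(** The Macdonald form makes the power sums independent, and there are as many
    of them in each degree as monomial functions. *)
Lemma symf_p_span d (F : symf R) : homog d F ->
  exists a : intpart -> R, F = \sum_(l <- parts_of d) a l *: symf_p l.
Proof.
move=> Fd; pose L (l m : intpart) := (symf_p l : symf R) (xmon m).
have pL l : l \in parts_of d ->
    symf_p l = \sum_(m <- parts_of d) L l m *: symf_m m :> symf R.
  rewrite mem_parts_of => /eqP ld; apply: symf_m_span; rewrite -ld.
  exact: homog_symf_p.
have [|b bL] := @fset_left_inverse _ _ (parts_of d) L.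
  move=> c c0 l lS.
  have s0 : \sum_(m <- parts_of d) c m *: symf_p m = 0 :> symf R.
    transitivity (\sum_(m <- parts_of d)
        (\sum_(k <- parts_of d) c k * L k m) *: symf_m m : symf R).
      under [RHS]eq_bigr do rewrite scaler_suml.
      rewrite exchange_big /= big_seq [RHS]big_seq; apply: eq_bigr => m mS.
      by rewrite pL // scaler_sumr; apply: eq_bigr => k _; rewrite scalerA.
    by rewrite big_seq big1 // => m mS; rewrite c0 // scale0r.
  have := form_sum_p (parts_of d) c (fun m => (m == l)%:R).
  rewrite s0 linear0l (big_fsetD1 l) //= eqxx big1_fset ?addr0 => [|m].
    by move/eqP; rewrite eq_sym mulr1 mulf_eq0 (gt_eqF (z_gt0 l)) orbF => /eqP.
  by rewrite in_fsetD1 => /andP[/negbTE -> _] _; rewrite mulr0 mul0r.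
have mp m : m \in parts_of d ->
    symf_m m = \sum_(l <- parts_of d) b m l *: symf_p l :> symf R.
  move=> mS; transitivity (\sum_(k <- parts_of d)
      (\sum_(l <- parts_of d) b m l * L l k) *: symf_m k : symf R).
    rewrite (big_fsetD1 m) //= bL // eqxx scale1r big1_fset ?addr0 // => k.
    by rewrite in_fsetD1 => /andP[km kS] _; rewrite bL // eq_sym (negbTE km) scale0r.
  under eq_bigr do rewrite scaler_suml.
  rewrite exchange_big /= big_seq [RHS]big_seq; apply: eq_bigr => l lS.
  by rewrite pL // scaler_sumr; apply: eq_bigr => k _; rewrite scalerA.
exists (fun l => \sum_(m <- parts_of d) F (xmon m) * b m l).
rewrite {1}(symf_m_span Fd).
under [RHS]eq_bigr do rewrite scaler_suml.
rewrite exchange_big /= big_seq [RHS]big_seq; apply: eq_bigr => m mS.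
by rewrite mp // scaler_sumr; apply: eq_bigr => l _; rewrite scalerA.
Qed.

Lemma homog_P lam : homog (psize lam) (P lam).
Proof.
have [c ->] := PE.1 lam; rewrite symf_valD; apply: homogD.
  exact: homog_symf_m.
rewrite symf_val_sum big_seq; apply: homog_sum => mu mul.
rewrite symf_valZ; apply: homogZ.
suff <- : psize mu = psize lam by exact: homog_symf_m.
apply: contrapT => ne; move: mul.
case: finite_supportP => // X XS XE _ /XS /= [] [_]. by [].
Qed.

Lemma P_xmon lam : P lam (xmon lam) = 1.
Proof.
have [c ->] := PE.1 lam; rewrite symf_valD fcoefD symf_mE exponents_xmon eqxx.
rewrite symf_val_sum fcoef_sum big_seq big1 ?addr0 // => mu mul.
rewrite symf_valZ fcoefZ symf_mE exponents_xmon.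
suff /negbTE -> : lam != mu by rewrite mulr0.
rewrite eq_sym; apply: contrapT => ne; move: mul.
by case: finite_supportP => // X XS XE _ /XS /= [] [].
Qed.

Lemma macdonald_expansion : exists A : intpart -> intpart -> R, forall lam,
  P lam = \sum_(l <- parts_of (psize lam)) A lam l *: symf_p l /\
  forall l, psize l != psize lam -> A lam l = 0.
Proof.
have /choice[a aE] : forall lam, exists a : intpart -> R,
    P lam = \sum_(l <- parts_of (psize lam)) a l *: symf_p l.
  by move=> lam; apply: symf_p_span; apply: homog_P.
exists (fun lam l => if psize l == psize lam then a lam l else 0) => lam; split.
  rewrite [LHS]aE big_seq [RHS]big_seq; apply: eq_bigr => l.
  by rewrite mem_parts_of => ->.
by move=> l /negbTE ->.
Qed.

Lemma parts_of_le (F : intpart -> symf R) d D : (d <= D)%N ->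
    (forall l, psize l != d -> F l = 0) ->
  \sum_(l <- parts_of d) F l = \sum_(l <- parts_le D) F l.
Proof.
move=> dD F0; apply: big_fset_incl => [|l lD].
  by apply/fsubsetP => l; rewrite mem_parts_of mem_parts_le => /eqP ->.
by rewrite mem_parts_of => /F0.
Qed.

Section Expansion.
Context (A : intpart -> intpart -> R).
Hypothesis AE : forall lam,
  P lam = \sum_(l <- parts_of (psize lam)) A lam l *: symf_p l /\
  forall l, psize l != psize lam -> A lam l = 0.

Lemma P_le lam D : (psize lam <= D)%N ->
  P lam = \sum_(l <- parts_le D) A lam l *: symf_p l.
Proof.
move=> lD; rewrite {1}(AE lam).1 (parts_of_le lD) // => l /(AE lam).2 ->.
by rewrite scale0r.
Qed.

Definition norm_mac lam := form (P lam) (P lam).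

Lemma normPE lam D : (psize lam <= D)%N ->
  norm_mac lam = \sum_(l <- parts_le D) A lam l ^+ 2 * z l.
Proof.
by move=> lD; rewrite /norm_mac {1 2}(P_le lD) form_sum_p; under eq_bigr do rewrite -expr2.
Qed.

Lemma normP_gt0 lam : 0 < norm_mac lam.
Proof.
have term0 l : 0 <= A lam l ^+ 2 * z l by rewrite mulr_ge0 ?sqr_ge0 // ltW.
rewrite (normPE (leqnn _)) lt_neqAle sumr_ge0 // andbT eq_sym.
apply/eqP => s0.
have Al l : l \in parts_le (psize lam) -> A lam l = 0.
  move=> lS; apply/eqP; rewrite -sqrf_eq0.
  have /eqP := s0; rewrite (big_fsetD1 l) //= paddr_eq0 ?sumr_ge0 //.
  by rewrite mulf_eq0 (gt_eqF (z_gt0 l)) orbF => /andP[].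
have := P_xmon lam; rewrite (P_le (leqnn _)) big_seq big1 => [|l lS].
  by move/eqP; rewrite eq_sym oner_eq0.
by rewrite Al // scale0r.
Qed.

(** The inverse of the transition matrix [A]: as both the power sums and the
    [P lam] are orthogonal, it is the transpose of [A] up to the norms. *)
Definition inv_coef s mu := z s * A mu s / norm_mac mu.

Lemma A_Ainv D : {in parts_le D &, forall lam mu,
  \sum_(s <- parts_le D) A lam s * inv_coef s mu = (lam == mu)%:R}.
Proof.
move=> lam mu; rewrite !mem_parts_le => lD mD.
have -> : \sum_(s <- parts_le D) A lam s * inv_coef s mu =
    form (P lam) (P mu) / norm_mac mu.
  rewrite (P_le lD) (P_le mD) form_sum_p mulr_suml; apply: eq_bigr => s _.
  by rewrite /inv_coef; ring.
have [->|ne] := eqVneq lam mu; first by rewrite divff // gt_eqF ?normP_gt0.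
by rewrite PE.2 // mul0r.
Qed.

Lemma Ainv_A D : {in parts_le D &, forall s r,
  \sum_(mu <- parts_le D) inv_coef s mu * A mu r = (s == r)%:R}.
Proof. by apply: (@fset_inverse_comm _ _ _ A inv_coef); exact: A_Ainv. Qed.

Lemma Ainv0 s mu : psize s != psize mu -> inv_coef s mu = 0.
Proof. by move=> sm; rewrite /inv_coef (AE mu).2 // mulr0 mul0r. Qed.

(** The matrix of the skew power sums, transported to the basis [P]. It is the
    skew Macdonald function ([skew_PE] below). *)
Definition skew_mac lam mu : symf R :=
  \sum_(r <- parts_of (psize lam)) \sum_(s <- parts_of (psize mu))
    (A lam r * inv_coef s mu) *: pskew (symf_p1 R) r s.

Lemma skewP_le lam mu D : (psize lam <= D)%N -> (psize mu <= D)%N ->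
  skew_mac lam mu = \sum_(r <- parts_le D) \sum_(s <- parts_le D)
    (A lam r * inv_coef s mu) *: pskew (symf_p1 R) r s.
Proof.
move=> lD mD; rewrite /skew_mac (parts_of_le lD) => [|r rl]; last first.
  by rewrite big1 // => s _; rewrite (AE lam).2 // mul0r scale0r.
apply: eq_bigr => r _; rewrite (parts_of_le mD) // => s sm.
by rewrite Ainv0 // mulr0 scale0r.
Qed.

End Expansion.
End MacdonaldBasis.

(** * Skew functions in the basis of power sums *)

Lemma symf_at_nat (K : comNzRingType) (V : choiceType) (X : nat -> V) k :
  injective X -> symf_at X (k%:R : symf K) = k%:R.
Proof.
move=> X_inj; rewrite -[k%:R in LHS]scaler_nat symf_atZ // symf_at1 //.
by rewrite scaler_nat.
Qed.

Lemma symf_at_pskew (K : comNzRingType) (V : choiceType) (X : nat -> V) l m :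
  injective X ->
  symf_at X (pskew (symf_p1 K) l m) = pskew (pw K X) l m.
Proof.
move=> X_inj; apply: (pskew_morph (phi := symf_at X)) => //.
- exact: symf_atM.
- by move=> k; apply: symf_at_nat.
Qed.

(** A monomial in two disjoint alphabets factors in a single way into a monomial
    of each. *)
Lemma fcoefM_inlr (K : comNzRingType) (f g : fps nat K) (a b : {cmonom nat}) :
  (fps_rename inl f * fps_rename inr g : fps (nat + nat)%type K)
    (mmul (mrename inl a) (mrename inr b)) = f a * g b.
Proof.
have l_inj := inl_inj; have r_inj := inr_inj.
have lr (c : {cmonom nat}) i : mrename (@inl nat nat) c (inr i) = 0%N.
  by rewrite mrename_out.
have rl (c : {cmonom nat}) i : mrename (@inr nat nat) c (inl i) = 0%N.
  by rewrite mrename_out.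
set m := mmul _ _.
have am : mrename inl a \in cmdivs m by apply: mem_cmdivs (erefl m).
have bm : mrename inr b \in cmdivs m.
  by apply: (@mem_cmdivs _ _ _ (mrename inl a)); rewrite mulmC.
rewrite fcoefME (big_fset_pick am) => [|c ca].
  rewrite (big_fset_pick bm) => [|d db].
    by rewrite eqxx mul1r !rename_coef.
  case: eqP => [dm|]; last by rewrite mul0r.
  case/eqP: db; apply/eqP/cmP => v; have /eqP/cmP/(_ v) := dm.
  by rewrite !cmM => /addnI.
rewrite big1 // => d _; case: eqP => [cdm|]; rewrite ?mul0r // mul1r.
have [[c' cE]|/forallNP cN] := pselect (exists c', mrename inl c' = c); last first.
  by rewrite rename_out // mul0r.
have [[d' dE]|/forallNP dN] := pselect (exists d', mrename inr d' = d); last first.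
  by rewrite mulrC rename_out // mul0r.
case/eqP: ca; rewrite -cE; congr mrename; apply/eqP/cmP => i.
have /eqP/cmP/(_ (inl i)) := cdm.
by rewrite -cE -dE !cmM !rl !addn0 !mrename_inj.
Qed.

Section SkewBasis.
Context (R : realType) (q t : R).
Hypotheses (q01 : 0 < q < 1) (t01 : 0 < t < 1).
Context (form : {bilinear symf R -> symf R -> R | *%R & *%R}).
Context (P : intpart -> symf R).
Hypotheses (formE : is_macdonald_form q t form) (PE : is_macdonald_P form P).
Context (A : intpart -> intpart -> R).
Hypothesis AE : forall lam,
  P lam = \sum_(l <- parts_of (psize lam)) A lam l *: symf_p l /\
  forall l, psize l != psize lam -> A lam l = 0.

Local Notation N := (norm_mac form P).
Local Notation Ainv := (inv_coef q t form P A).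
Local Notation skewP := (skew_mac q t form P A).

(** The coefficient of a fixed monomial of the first alphabet in [P lam] is a
    combination of the [P nu] in the second one, and these are independent since
    they are orthogonal with nonzero norms. *)
Lemma skew_unique F G : is_skew P F -> is_skew P G ->
  forall lam mu, F lam mu = G lam mu.
Proof.
move=> FP GP lam mu; apply: val_inj; apply: fpsP => a.
pose d := psize mu; pose c nu := F lam nu a - G lam nu a.
have coefE H b : is_skew P H -> symf_at alphabet_union (P lam)
    (mmul (mrename inl a) (mrename inr b)) =
    \sum_(nu <- parts_of (mdeg b)) H lam nu a * P nu b.
  move=> HP; rewrite (HP lam).
  rewrite (@fsbigTE _ _ _ _ (parts_of (mdeg b))) => [|nu].
    by apply: eq_bigr => nu _; apply: fcoefM_inlr.
  rewrite mem_parts_of fcoefM_inlr eq_sym => /(homog_P PE) ->.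
  by rewrite mulr0.
have s0 : \sum_(nu <- parts_of d) c nu *: P nu = 0.
  apply: val_inj; rewrite /= symf_val_sum; apply: fpsP => b.
  rewrite fcoef_sum big_seq.
  have [bd|bd] := eqVneq (mdeg b) d; last first.
    rewrite big1 // => nu; rewrite mem_parts_of => /eqP nud.
    by rewrite symf_valZ fcoefZ (homog_P PE) ?mulr0 // nud.
  rewrite -big_seq -bd; under eq_bigr do rewrite symf_valZ fcoefZ mulrBl.
  by rewrite sumrB -!coefE // subrr.
have : form (\sum_(nu <- parts_of d) c nu *: P nu) (P mu) = c mu * N mu.
  rewrite linear_sumlz (big_fsetD1 mu) ?mem_parts_of //= big1_fset ?addr0.
    by rewrite linearZl_LR.
  move=> nu; rewrite in_fsetD1 => /andP[ne _] _.
  by rewrite linearZl_LR /= PE.2 // mulr0.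
rewrite s0 linear0l => /esym/eqP; rewrite mulf_eq0.
by rewrite (gt_eqF (normP_gt0 q01 t01 formE PE AE mu)) orbF subr_eq0 => /eqP.
Qed.

Lemma symf_p_union lam D : (psize lam <= D)%N ->
  symf_at alphabet_union (symf_p lam : symf R) =
  \sum_(s <- parts_le D) pskew (pw R inl) lam s * symf_at inr (symf_p s).
Proof.
move=> lD; rewrite symf_at_p; last exact: alphabet_union_inj.
have /andP[_ l0] := valP lam.
rewrite big_seq (eq_bigr (fun i => pw R inl i + pw R inr i)) => [|i il].
  rewrite -big_seq (@prod_union _ _ _ _ (parts_le D)) => [|mu ml].
    by apply: eq_bigr => s _; rewrite symf_at_p //; apply: inr_inj.
  by rewrite mem_parts_le (leq_trans ml).
by apply: pw_union; rewrite lt0n; apply: contraTneq il => ->.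
Qed.

(** Expanding [P lam] in power sums, splitting each power sum over the two
    alphabets, and going back from power sums to the basis [P] in the second
    alphabet. *)
Lemma skewP_is_skew : is_skew P skewP.
Proof.
move=> lam m; pose D := maxn (psize lam) (mdeg m).
have lD : (psize lam <= D)%N by rewrite leq_maxl.
have rmD : (mdeg m <= D)%N by rewrite leq_maxr.
rewrite (@fsbigTE _ _ _ _ (parts_le D)) => [|mu]; last first.
  rewrite mem_parts_le -ltnNge => muD.
  rewrite (@eq_fcoefM _ _ _ _ 0 0) ?mul0r // => a b abm.
  rewrite (homog_rename inr_inj (@homog_P _ _ _ PE mu)) ?mulr0 // neq_ltn.
  by rewrite (leq_ltn_trans _ muD) // (leq_trans _ rmD) // -abm mdegM leq_addl.
rewrite -fcoef_sum; congr (fcoef _ m).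
rewrite (P_le AE lD) symf_at_sum; last exact: alphabet_union_inj.
under eq_bigr do rewrite (symf_atZ alphabet_union_inj).
transitivity (\sum_(r <- parts_le D) \sum_(s <- parts_le D)
    A lam r *: (pskew (pw R inl) r s * symf_at inr (symf_p s))).
  rewrite !big_seq; apply: eq_bigr => r; rewrite mem_parts_le => rD.
  by rewrite (symf_p_union rD) scaler_sumr.
transitivity (\sum_(r <- parts_le D) \sum_(s <- parts_le D)
   \sum_(mu <- parts_le D)
    ((A lam r * Ainv s mu) *: pskew (pw R inl) r s) * symf_at inr (P mu)).
  apply: eq_bigr => r _; rewrite big_seq [RHS]big_seq; apply: eq_bigr => s sD.
  have -> : symf_p s = \sum_(mu <- parts_le D) Ainv s mu *: P mu.
    transitivity (\sum_(mu <- parts_le D) \sum_(l <- parts_le D)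
       (Ainv s mu * A mu l) *: (symf_p l : symf R)).
      rewrite exchange_big /=; under eq_bigr do rewrite -scaler_suml.
      rewrite (big_fsetD1 s) //= (Ainv_A q01 t01 formE PE AE) // eqxx scale1r.
      rewrite big1_fset ?addr0 // => l; rewrite in_fsetD1 => /andP[ls lD'] _.
      by rewrite (Ainv_A q01 t01 formE PE AE) // eq_sym (negbTE ls) scale0r.
    rewrite big_seq [RHS]big_seq; apply: eq_bigr => mu; rewrite mem_parts_le => muD.
    by rewrite (P_le AE muD) scaler_sumr; apply: eq_bigr => l _; rewrite scalerA.
  rewrite symf_at_sum; last exact: inr_inj.
  rewrite mulr_sumr scaler_sumr; apply: eq_bigr => mu _.
  rewrite symf_atZ; last exact: inr_inj.
  by rewrite -scalerAr -scalerAl scalerA.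
under eq_bigr do rewrite exchange_big.
rewrite exchange_big /= !big_seq; apply: eq_bigr => mu; rewrite mem_parts_le => muD.
rewrite (skewP_le q t form AE lD muD) symf_at_sum; last exact: inl_inj.
rewrite mulr_suml; apply: eq_bigr => r _.
rewrite symf_at_sum; last exact: inl_inj.
rewrite mulr_suml; apply: eq_bigr => s _.
by rewrite symf_atZ ?symf_at_pskew //; apply: inl_inj.
Qed.

Lemma skew_PE Psk : is_skew P Psk -> forall lam mu, Psk lam mu = skewP lam mu.
Proof. by move=> PskE; apply: skew_unique => //; apply: skewP_is_skew. Qed.

Lemma skew_QE Qsk : is_skew (macdonald_Q form P) Qsk ->
  forall lam mu, Qsk lam mu = (N mu / N lam) *: skewP lam mu.
Proof.
move=> QskE lam mu.
have N0 l : N l != 0 by rewrite gt_eqF // (normP_gt0 q01 t01 formE PE AE).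
have := @skew_PE (fun l m => (N l / N m) *: Qsk l m) _ lam mu.
move=> <- => [|l m]; first by rewrite scalerA mulrA divfK ?divff ?scale1r.
have := QskE l m; rewrite /macdonald_Q symf_atZ; last exact: alphabet_union_inj.
rewrite fcoefZ => /(congr1 (fun v => N l * v)); rewrite mulrA divff ?mul1r // => ->.
rewrite mulr_fsumr; apply: eq_fsbigr => nu _.
rewrite !symf_atZ; [|exact: inl_inj|exact: inr_inj].
by rewrite -scalerAr -scalerAl !fcoefZ mulrA.
Qed.

End SkewBasis.

(** * Basis independence of cyclic sums *)

Section CyclicSum.
Context (K : comNzRingType) (T : finType) (n : nat).
Local Notation I := 'I_n.+1.
Implicit Types (C : I -> T -> T -> K).

Lemma ordS_bij : bijective (@ordS n.+1).
Proof. exact: (Bijective (@ordSK n.+1) (@ord_predK n.+1)). Qed.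

(** Around the cycle each [a] meets the [c] of the next factor, and their
    product is the identity. *)
Lemma cyclic_conj C (c a : T -> T -> K) :
    (forall r s, \sum_l c r l * a l s = (r == s)%:R) ->
  \sum_(l : {ffun I -> T}) \prod_i
    (\sum_r \sum_s c r (l i) * C i r s * a (l (ordS i)) s) =
  \sum_(l : {ffun I -> T}) \prod_i C i (l i) (l (ordS i)).
Proof.
move=> ca.
transitivity (\sum_(l : {ffun I -> T}) \sum_(f : {ffun I -> T})
    \sum_(g : {ffun I -> T}) \prod_i
      (c (f i) (l i) * C i (f i) (g i) * a (l (ordS i)) (g i))).
  apply: eq_bigr => l _; rewrite bigA_distr_bigA; apply: eq_bigr => f _.
  by rewrite bigA_distr_bigA.
rewrite exchange_big; apply: eq_bigr => f _; rewrite exchange_big /=.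
pose g0 : {ffun I -> T} := [ffun i => f (ordS i)].
have gE (g : {ffun I -> T}) : \sum_(l : {ffun I -> T})
    \prod_i (c (f i) (l i) * C i (f i) (g i) * a (l (ordS i)) (g i)) =
    (\prod_i C i (f i) (g i)) * (g == g0)%:R.
  transitivity (\sum_(l : {ffun I -> T}) (\prod_i C i (f i) (g i)) *
      \prod_i (c (f i) (l i) * a (l i) (g (ord_pred i)))).
    apply: eq_bigr => l _; rewrite !big_split /=.
    have -> : \prod_i a (l i) (g (ord_pred i)) = \prod_i a (l (ordS i)) (g i).
      rewrite (reindex_inj (bij_inj ordS_bij)) /=.
      by apply: eq_bigr => i _; rewrite ordSK.
    by rewrite mulrA; congr (_ * _); rewrite mulrC.
  rewrite -mulr_sumr; congr (_ * _).
  rewrite -(bigA_distr_bigA (fun i l => c (f i) l * a l (g (ord_pred i)))).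
  under eq_bigr do rewrite ca.
  rewrite -natr_prod; congr _%:R.
  case: eqVneq => [->|gg0]; first by rewrite big1 // => i _; rewrite ffunE ord_predK eqxx.
  have [i fg] : exists i, f i != g (ord_pred i).
    apply/existsP; rewrite -negb_forall; apply: contra gg0 => /forallP fg.
    by apply/eqP/ffunP => i; rewrite ffunE (eqP (fg (ordS i))) ordSK.
  by rewrite (bigD1 i) //= (negbTE fg) mul0n.
under eq_bigr do rewrite gE.
rewrite (bigD1 g0) //= eqxx mulr1 [X in _ + X]big1; last first.
  by move=> g /negbTE ->; rewrite mulr0.
rewrite addr0.
by apply: eq_bigr => i _; rewrite ffunE.
Qed.

(** The sum over the cycle [l_1 - m_1 - l_2 - m_2 ...] is a trace, so it does not
    change under a change of basis [a] with inverse [c] that commutes with the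
    diagonal weights [w]. *)
Lemma cyclic_basis_change (c a : T -> T -> K) (y x : I -> T -> T -> K)
    (w : I -> T -> K) :
    (forall r s, \sum_l c r l * a l s = (r == s)%:R) ->
    (forall i r s, \sum_l c r l * w i l * a l s = w i s * (r == s)%:R) ->
  \sum_(l : {ffun I -> T}) \sum_(m : {ffun I -> T}) \prod_i
    (w i (m i) * (\sum_r \sum_s c r (l i) * y i r s * a (m i) s) *
     (\sum_r \sum_s a (l (ordS i)) r * x (ordS i) r s * c s (m i))) =
  \sum_(l : {ffun I -> T}) \sum_(m : {ffun I -> T}) \prod_i
    (w i (m i) * y i (l i) (m i) * x (ordS i) (l (ordS i)) (m i)).
Proof.
move=> ca caw.
pose C i r r' := \sum_s w i s * y i r s * x (ordS i) r' s.
transitivity (\sum_(l : {ffun I -> T}) \prod_i C i (l i) (l (ordS i))); last first.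
  apply: eq_bigr => l _; rewrite -(bigA_distr_bigA (fun i s =>
    w i s * y i (l i) s * x (ordS i) (l (ordS i)) s)).
  by [].
rewrite -(cyclic_conj C ca); apply: eq_bigr => l _.
rewrite -(bigA_distr_bigA (fun i m =>
  w i m * (\sum_r \sum_s c r (l i) * y i r s * a m s) *
     (\sum_r \sum_s a (l (ordS i)) r * x (ordS i) r s * c s m))).
apply: eq_bigr => i _.
transitivity (\sum_r \sum_r' \sum_s \sum_s'
  (c r (l i) * y i r s * (a (l (ordS i)) r' * x (ordS i) r' s')) *
    \sum_m c s' m * w i m * a m s).
  under eq_bigr => m _.
    rewrite -mulrA mulr_suml mulr_sumr; under eq_bigr => r _.
      rewrite mulr_sumr mulr_sumr; under eq_bigr => r' _.
        rewrite mulr_suml mulr_sumr; under eq_bigr => s _.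
          rewrite !mulr_sumr; over.
        over.
      over.
    over.
  rewrite exchange_big; apply: eq_bigr => r _.
  rewrite exchange_big; apply: eq_bigr => r' _.
  rewrite exchange_big; apply: eq_bigr => s _.
  rewrite exchange_big; apply: eq_bigr => s' _.
  by rewrite mulr_sumr; apply: eq_bigr => m _; ring.
apply: eq_bigr => r _; apply: eq_bigr => r' _.
rewrite /C mulr_sumr mulr_suml; apply: eq_bigr => s _.
under eq_bigr do rewrite caw.
rewrite (bigD1 s) //= eqxx mulr1 [X in _ + X]big1; first by rewrite addr0; ring.
by move=> s' /negbTE ->; rewrite !mulr0.
Qed.

End CyclicSum.

(** * Unconditional sums *)

#[local] Existing Instance totally_filter.

Lemma ler_sum_fsub (R : numDomainType) (I : choiceType) (F : I -> R)
    (A B : {fset I}) : (A `<=` B)%fset -> (forall i, 0 <= F i) ->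
  \sum_(i <- A) F i <= \sum_(i <- B) F i.
Proof.
move=> AB F0; rewrite [leRHS](big_fsetID _ (mem A)) /=.
have -> : [fset x in B | x \in A]%fset = A.
  by apply/fsetP => x; rewrite !inE andbC; case xA: (x \in A) => //=; apply: (fsubsetP AB).
by rewrite lerDl sumr_ge0.
Qed.

Section HasSum.
Context (R : realType).

Definition has_sum (I : choiceType) (F : I -> R) (S : R) : Prop :=
  partial_sum F @ totally --> S.

Lemma has_sumP (I : choiceType) (F : I -> R) S :
  has_sum F S <-> forall e, 0 < e -> exists A : {fset I},
    forall B : {fset I}, (A `<=` B)%fset -> `|S - \sum_(i <- B) F i| < e.
Proof.
split=> [FS e e0|FS].
  have /cvgrPdist_lt/(_ e e0) := FS.
  move=> [A _ AB].
  by exists A => B /AB; rewrite /= /partial_sum big_seq_fsetE.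
apply/cvgrPdist_lt => e e0; have [A AB] := FS e e0.
by exists A => // B /AB; rewrite /= /partial_sum big_seq_fsetE.
Qed.

Section Basic.
Context (I : choiceType).
Implicit Types F G : I -> R.

Lemma has_sum_unique F S S' : has_sum F S -> has_sum F S' -> S = S'.
Proof. exact: cvg_unique. Qed.

Lemma eq_has_sum F G S : F =1 G -> has_sum F S -> has_sum G S.
Proof. by move=> /funext ->. Qed.

Lemma has_sumD F G S T : has_sum F S -> has_sum G T ->
  has_sum (fun i => F i + G i) (S + T).
Proof.
move=> FS GT; rewrite /has_sum (_ : partial_sum _ = partial_sum F \+ partial_sum G).
  exact: cvgD.
by apply/funext => A; rewrite /partial_sum big_split.
Qed.

Lemma has_sumZ c F S : has_sum F S -> has_sum (fun i => c * F i) (c * S).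
Proof.
move=> FS; rewrite /has_sum (_ : partial_sum _ = (fun A => c * partial_sum F A)).
  by apply: cvgMr.
by apply/funext => A; rewrite /partial_sum mulr_sumr.
Qed.

Lemma has_sum0 : has_sum (fun _ : I => 0 : R) 0.
Proof.
by apply/has_sumP => e e0; exists fset0 => B _; rewrite big1 // subrr normr0.
Qed.

Lemma has_sum_big (J : Type) (r : seq J) (P : pred J) (F : J -> I -> R) S :
    (forall j, P j -> has_sum (F j) (S j)) ->
  has_sum (fun i => \sum_(j <- r | P j) F j i) (\sum_(j <- r | P j) S j).
Proof.
move=> FS; elim: r => [|j r IH].
  rewrite big_nil; apply: eq_has_sum has_sum0 => i; by rewrite big_nil.
rewrite big_cons; case: ifP => Pj.
  apply: (eq_has_sum _ (has_sumD (FS j Pj) IH)) => i; by rewrite big_cons Pj.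
apply: eq_has_sum IH => i; by rewrite big_cons Pj.
Qed.

Definition abs_summable F : Prop :=
  exists C, forall B : {fset I}, \sum_(i <- B) `|F i| <= C.

Lemma ge0_has_sum F : (forall i, 0 <= F i) -> abs_summable F ->
  exists S, has_sum F S.
Proof.
move=> F0 [C FC]; pose E := [set x | exists B : {fset I}, x = \sum_(i <- B) F i].
have supE : has_sup E.
  split; first by exists 0, fset0; rewrite big_seq_fset0.
  exists C => _ [B ->]; rewrite (le_trans _ (FC B)) //.
  by apply: ler_sum => i _; apply: ler_norm.
exists (sup E); apply/has_sumP => e e0.
have [_ [A ->] eA] := sup_adherent e0 supE.
exists A => B AB; have le_sup : \sum_(i <- B) F i <= sup E.
  by apply: ub_le_sup; [case: supE|exists B].
rewrite ger0_norm ?subr_ge0 //.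
have := ler_sum_fsub AB F0.
by lra.
Qed.

Lemma abs_has_sum F : abs_summable F -> exists S, has_sum F S.
Proof.
move=> [C FC].
have [S FS] : exists S, has_sum (fun i => `|F i|) S.
  by apply: ge0_has_sum => //; exists C => B; under eq_bigr do rewrite normr_id.
have [T FT] : exists T, has_sum (fun i => F i + `|F i|) T.
  apply: ge0_has_sum => [i|].
    by have := ler_norm (- F i); rewrite normrN; lra.
  exists (C + C) => B; apply: le_trans (lerD (FC B) (FC B)).
  rewrite -big_split /=; apply: ler_sum => i _.
  by rewrite (le_trans (ler_normD _ _)) // normr_id.
exists (T + (-1) * S); have := has_sumD FT (@has_sumZ (-1) _ _ FS).
by apply: eq_has_sum => i; rewrite mulN1r addrK.
Qed.

Lemma abs_summable_le c F G : abs_summable G -> 0 <= c ->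
  (forall i, `|F i| <= c * `|G i|) -> abs_summable F.
Proof.
move=> [C GC] c0 FG; exists (c * C) => B.
apply: le_trans (ler_wpM2l c0 (GC B)); rewrite mulr_sumr.
by apply: ler_sum.
Qed.

Lemma abs_summableM (J : choiceType) F (G : J -> R) :
  abs_summable F -> (exists C, forall B : {fset J}, \sum_(j <- B) `|G j| <= C) ->
  exists C, forall B : {fset I * J}, \sum_(p <- B) `|F p.1 * G p.2| <= C.
Proof.
move=> [C FC] [C' GC]; exists (C * C') => B.
pose B1 := [fset p.1 | p in B]%fset; pose B2 := [fset p.2 | p in B]%fset.
pose BB := [fset p in [seq (x, y) | x <- B1, y <- B2]]%fset.
apply: (@le_trans _ _ (\sum_(p <- BB) `|F p.1 * G p.2|)).
  apply: ler_sum_fsub => //; apply/fsubsetP => -[x y] xyB; rewrite !inE /=.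
  by apply/allpairsP; exists (x, y); split=> //; apply/imfsetP; exists (x, y).
rewrite (perm_big [seq (x, y) | x <- B1, y <- B2]) /=; last first.
  apply: uniq_perm; first exact: fset_uniq.
    by apply: allpairs_uniq; rewrite ?fset_uniq // => -[? ?] [? ?].
  by move=> p; rewrite !inE.
rewrite big_allpairs /=.
under eq_bigr do under eq_bigr do rewrite normrM.
under eq_bigr do rewrite -mulr_sumr.
rewrite -mulr_suml ler_pM ?sumr_ge0 //.
Qed.

(** An unconditional sum is the limit of its partial sums along any exhausting
    sequence of finite sets, so two sums, over the same indices, of different
    terms can be compared through exact identities between finite sums. *)
Lemma has_sum_exhaust (A : nat -> {fset I}) F G S T :
    (forall B : {fset I}, exists D, (B `<=` A D)%fset) ->
    {homo A : d e / (d <= e)%N >-> (d `<=` e)%fset} ->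
    (forall D, \sum_(i <- A D) F i = \sum_(i <- A D) G i) ->
  has_sum F S -> has_sum G T -> S = T.
Proof.
move=> exA incA FG /has_sumP FS /has_sumP GT; apply/eqP/negPn/negP => ST.
have e0 : 0 < `|S - T| / 2 by rewrite divr_gt0 // normr_gt0 subr_eq0.
have [B1 B1S] := FS _ e0; have [B2 B2T] := GT _ e0.
have [D BD] := exA (B1 `|` B2)%fset.
have := B1S (A D) (fsubset_trans (fsubsetUl _ _) BD).
have := B2T (A D) (fsubset_trans (fsubsetUr _ _) BD).
rewrite FG; set x := \sum_(i <- _) _ => d1 d2.
have := ler_distD x S T; rewrite (distrC x T) => d3.
by move: d1 d2 d3; lra.
Qed.

End Basic.

(** The indices outside of the image of [f] contribute zeros. *)
Lemma has_sum_reindex (I J : choiceType) (f : I -> J) (F : J -> R) S :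
    injective f -> (forall j, F j != 0 -> exists i, f i = j) ->
  has_sum F S -> has_sum (F \o f) S.
Proof.
move=> f_inj Ff /has_sumP FS; apply/has_sumP => e /FS[A AB].
pose A' := fset_set [set i | f i \in A].
have finA : finite_set [set i | f i \in A].
  apply: (@finite_preimage _ _ [set` A] f) => //; first by move=> x y _ _ /f_inj.
have A'P i : (i \in A') = (f i \in A).
  by rewrite in_fset_set //; apply/idP/idP => [/set_mem|/mem_set].
exists A' => B A'B.
suff -> : \sum_(i <- B) (F \o f) i = \sum_(j <- (A `|` (f @` B))%fset) F j.
  by apply: AB; apply: fsubsetUl.
rewrite -(@big_fset_incl _ _ _ _ (f @` B)%fset) ?fsubsetUr //.
  by rewrite big_imfset //= => x y _ _ /f_inj.
move=> j; rewrite inE => /orP[jA|->//] jB; apply/eqP/negPn/negP => /Ff[i ij].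
case/negP: jB; rewrite -ij in_imfset //= (fsubsetP A'B) // A'P ij //.
Qed.

End HasSum.

Section FpsHasSum.
Context (R : realType) (V : choiceType) (I : choiceType).
Implicit Types (F : I -> fps V R) (S : fps V R).

Lemma fps_has_sum_unique F S T : fps_has_sum F S -> fps_has_sum F T -> S = T.
Proof. by move=> FS FT; apply: fpsP => m; apply: has_sum_unique (FS m) (FT m). Qed.

Lemma eq_fps_has_sum F G S : F =1 G -> fps_has_sum F S -> fps_has_sum G S.
Proof. by move=> /funext ->. Qed.

Lemma fps_has_sumD F G S T : fps_has_sum F S -> fps_has_sum G T ->
  fps_has_sum (fun i => F i + G i) (S + T).
Proof. by move=> FS GT m; apply: has_sumD (FS m) (GT m). Qed.

Lemma fps_has_sumM G F S : fps_has_sum F S ->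
  fps_has_sum (fun i => G * F i) (G * S).
Proof.
move=> FS m; rewrite -/(has_sum _ _) fcoefME.
apply: (@eq_has_sum _ _ (fun i => \sum_(a <- cmdivs m) \sum_(b <- cmdivs m)
   (mmul a b == m)%:R * (G a * F i b))) => [i|]; first by rewrite fcoefME.
apply: has_sum_big => a _; apply: has_sum_big => b _.
rewrite mulrA; under eq_fun do rewrite mulrA.
by apply: has_sumZ; apply: FS.
Qed.

Lemma fps_has_sumZ c F S : fps_has_sum F S ->
  fps_has_sum (fun i => c *: F i) (c *: S).
Proof. by move=> FS m; apply: has_sumZ (FS m). Qed.

End FpsHasSum.

Lemma fps_has_sum_reindex (R : realType) (V I J : choiceType) (f : I -> J)
    (F : J -> fps V R) S :
    injective f -> (forall j, F j != 0 -> exists i, f i = j) ->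
  fps_has_sum F S -> fps_has_sum (F \o f) S.
Proof.
move=> f_inj Ff FS m; apply: (@has_sum_reindex _ _ _ f (fun j => F j m) _ _ _ (FS m)) => //.
by move=> j Fm; apply: Ff; apply: contraNneq Fm => ->.
Qed.

(** ** A submultiplicative norm on the coefficients dividing a monomial *)

Section DivNorm.
Context (R : realType) (V : choiceType) (m : {cmonom V}).
Implicit Types f g : fps V R.

(** A single coefficient of a product is not bounded by the corresponding
    coefficients of the factors, but it only involves their coefficients on
    divisors of the monomial. *)
Definition divnorm f : R := \sum_(a <- cmdivs m) `|f a|.

Lemma divnorm_ge0 f : 0 <= divnorm f.
Proof. exact: sumr_ge0. Qed.

Lemma coef_le_divnorm f a : a \in cmdivs m -> `|f a| <= divnorm f.
Proof. by move=> am; rewrite /divnorm (big_fsetD1 a) //= lerDl sumr_ge0. Qed.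

Lemma coef_le_divnorm1 f : `|f m| <= divnorm f.
Proof. by apply/coef_le_divnorm/(@mem_cmdivs _ _ _ mone); rewrite mulm1. Qed.

Lemma divnormM f g : divnorm (f * g) <= divnorm f * divnorm g.
Proof.
rewrite {1}/divnorm.
have -> : divnorm f * divnorm g =
    \sum_(a <- cmdivs m) \sum_(b <- cmdivs m) `|f a * g b|.
  rewrite mulr_suml; apply: eq_bigr => a _; rewrite mulr_sumr.
  by apply: eq_bigr => b _; rewrite normrM.
apply: (@le_trans _ _ (\sum_(c <- cmdivs m) \sum_(a <- cmdivs m)
   \sum_(b <- cmdivs m) (mmul a b == c)%:R * `|f a * g b|)).
  rewrite big_seq [leRHS]big_seq; apply: ler_sum => c /cmdivsP[e cem].
  rewrite [(f * g) c](@fps_mulE _ _ (cmdivs m)) => [|a b abc]; last first.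
    by apply: (@mem_cmdivs _ _ _ (mmul b e)); rewrite mulmA abc.
  apply: le_trans (ler_norm_sum _ _ _) _; apply: ler_sum => a _.
  apply: le_trans (ler_norm_sum _ _ _) _; apply: ler_sum => b _.
  by rewrite normrM normr_nat.
rewrite exchange_big; apply: ler_sum => a _; rewrite exchange_big.
apply: ler_sum => b _; rewrite -mulr_suml ler_piMl //.
have [abm|abm] := boolP (mmul a b \in cmdivs m).
  rewrite (big_fset_pick abm) ?eqxx // => c; rewrite eq_sym => /negbTE -> //.
rewrite big_seq big1 ?ler01 // => c cm; case: eqP => // abc.
by rewrite abc cm in abm.
Qed.

Lemma divnormZ c f : divnorm (c *: f) = `|c| * divnorm f.
Proof. by rewrite /divnorm mulr_sumr; apply: eq_bigr => a _; rewrite fcoefZ normrM. Qed.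

Lemma divnorm1 : divnorm 1 = 1.
Proof.
rewrite /divnorm (big_fset_pick (mone_cmdivs m)) => [|a /negbTE a1].
  by rewrite fcoef1 eqxx normr1.
by rewrite fcoef1 a1 normr0.
Qed.

Lemma divnorm0 : divnorm 0 = 0.
Proof. by rewrite /divnorm big1 // => a _; rewrite normr0. Qed.

Lemma divnorm_sum (I : Type) (r : seq I) (P : pred I) (F : I -> fps V R) :
  divnorm (\sum_(i <- r | P i) F i) <= \sum_(i <- r | P i) divnorm (F i).
Proof.
elim/big_rec2: _ => [|i x f _ fx]; first by rewrite divnorm0.
apply: le_trans (lerD (lexx _) fx); rewrite /divnorm -big_split /=.
by apply: ler_sum => a _; apply: ler_normD.
Qed.

Lemma divnorm_prod (I : Type) (r : seq I) (P : pred I) (F : I -> fps V R)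
    (G : I -> R) : (forall i, P i -> divnorm (F i) <= G i) ->
  divnorm (\prod_(i <- r | P i) F i) <= \prod_(i <- r | P i) G i.
Proof.
move=> FG; elim/big_rec2: _ => [|i x f Pi fx]; first by rewrite divnorm1.
by apply: le_trans (divnormM _ _) _; rewrite ler_pM ?divnorm_ge0 ?FG.
Qed.

Lemma divnormX f k : divnorm (f ^+ k) <= divnorm f ^+ k.
Proof.
elim: k => [|k IH]; first by rewrite !expr0 divnorm1.
rewrite !exprS; apply: le_trans (divnormM _ _) _.
by rewrite ler_wpM2l ?divnorm_ge0.
Qed.

Lemma divnorm_neq0 f : divnorm f != 0 -> exists2 a, a \in cmdivs m & f a != 0.
Proof.
move=> f0; apply: contrapT => fN; case/eqP: f0.
rewrite /divnorm big_seq big1 // => a am; apply/eqP; rewrite normr_eq0.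
by apply/negPn/negP => fa; apply: fN; exists a.
Qed.

Lemma mdeg_cmdivs a : a \in cmdivs m -> (mdeg a <= mdeg m)%N.
Proof. by case/cmdivsP => b <-; rewrite mdegM leq_addr. Qed.

End DivNorm.

(** * Counting partitions *)

Section Counting.
Context (R : realType).
Implicit Types r u : R.

Lemma bernoulli (e : R) k : 0 <= e <= 1 -> 1 - k%:R * e <= (1 - e) ^+ k.
Proof.
case/andP => e0 e1; elim: k => [|k IH]; first by rewrite mul0r subr0 expr0.
have e1' : 0 <= 1 - e by lra.
rewrite exprS; apply: le_trans (ler_wpM2l e1' IH); rewrite -natr1.
have : 0 <= k%:R * e * e by rewrite !mulr_ge0.
by lra.
Qed.

(** This leaves room to share the decay of powers of [u] among several
    factors. *)
Lemma root_exists u K : 0 < u < 1 -> exists2 r : R, 0 < r < 1 & u <= r ^+ K.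
Proof.
case/andP => u0 u1; pose e := (1 - u) / K.+1%:R.
have K0 : 0 < K.+1%:R :> R by rewrite ltr0n.
have e0 : 0 < e by rewrite divr_gt0 // subr_gt0.
have Ke : K.+1%:R * e = 1 - u by rewrite /e mulrC divfK // gt_eqF.
have eu : e <= 1 - u by rewrite -Ke ler_peMl ?(ltW e0) // ler1n.
have Ke' : K%:R * e <= 1 - u by rewrite -Ke ler_wpM2r ?(ltW e0) // ler_nat.
exists (1 - e); first by lra.
have := @bernoulli e K; have : 0 <= e <= 1 by lra.
by move=> h /(_ h); lra.
Qed.

(** The factors [k.+1] are absorbed one by one by geometric factors [s ^+ k]
    with [r <= s ^+ d]. *)
Lemma poly_geometric r d : 0 < r < 1 ->
  exists2 C : R, 0 <= C & forall k, k.+1%:R ^+ d * r ^+ k <= C.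
Proof.
move=> r01; have [s s01 rs] := root_exists d r01; case/andP: s01 => s0 s1.
pose C := 1 + (1 - s)^-1.
have s1' : 0 < 1 - s by rewrite subr_gt0.
have Ck k : k.+1%:R * s ^+ k <= C.
  elim: k => [|k IH].
    by rewrite expr0 mulr1 /C lerDl invr_ge0 ltW.
  have sk : 0 <= s ^+ k by rewrite exprn_ge0 // ltW.
  rewrite -natr1 mulrDl mul1r exprS.
  have h1 : s ^+ k <= 1 by rewrite exprn_ile1 // ltW.
  rewrite mulrCA [X in X + _](_ : _ = s * (k.+1%:R * s ^+ k)) //.
  have h2 : s * (k.+1%:R * s ^+ k) <= s * C by rewrite ler_wpM2l // ltW.
  have h3 : s * s ^+ k <= s by rewrite ler_piMr // ltW.
  have h4 : s * C = C - (1 - s) - 1.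
    by rewrite /C; field; rewrite gt_eqF.
  by lra.
exists (C ^+ d) => [|k].
  by rewrite exprn_ge0 // /C addr_ge0 // invr_ge0 ltW.
apply: (@le_trans _ _ ((k.+1%:R * s ^+ k) ^+ d)).
  rewrite exprMn ler_wpM2l ?exprn_ge0 // -exprM mulnC exprM lerXn2r //.
  - by rewrite nnegrE; case/andP: r01 => /ltW.
  - by rewrite nnegrE exprn_ge0 // ltW.
by rewrite lerXn2r // nnegrE ?mulr_ge0 ?exprn_ge0 ?addr_ge0 ?invr_ge0 // ltW.
Qed.

Definition euler_prod_fin u D : R := \prod_(i < D) (1 - u ^+ i.+1).

Definition box (D : nat) : {fset intpart} :=
  [fset boxpart h | h : {ffun 'I_D -> 'I_D.+1}]%fset.

Lemma mem_box D l : (psize l <= D)%N -> l \in box D.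
Proof.
move=> lD; have [h <-] := boxpart_psize lD lD; exact: in_imfset.
Qed.

Lemma box_sum u D : \sum_(l <- box D) u ^+ psize l =
  \prod_(i < D) \sum_(k < D.+1) (u ^+ i.+1) ^+ k.
Proof.
rewrite big_imfset /=; last by move=> x y _ _ /boxpart_inj.
rewrite bigA_distr_bigA big_enum; apply: eq_bigr => h _.
rewrite psize_boxpart -prodrXr; apply: eq_bigr => i _.
by rewrite -exprM mulnC.
Qed.

(** The finite form of the product formula for the generating function of
    partitions: each part size contributes a finite geometric sum. *)
Lemma box_sum_euler u D : 0 < u < 1 ->
  (\sum_(l <- box D) u ^+ psize l) * euler_prod_fin u D =
  \prod_(i < D) (1 - (u ^+ D.+1) ^+ i.+1).
Proof.
move=> u01; rewrite box_sum /euler_prod_fin -big_split; apply: eq_bigr => i _ /=.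
rewrite mulrC -opprB mulNr -subrX1 opprB.
by rewrite -!exprM mulnC.
Qed.

Lemma prod_1sub_ge (x : nat -> R) D : (forall i, 0 <= x i <= 1) ->
  1 - \sum_(i < D) x i <= \prod_(i < D) (1 - x i).
Proof.
move=> x01; elim: D => [|D IH]; first by rewrite !big_ord0 subr0.
rewrite !big_ord_recr /=; have := x01 D => /andP[x0 x1].
have s0 : 0 <= \sum_(i < D) x i by apply: sumr_ge0 => i _; case/andP: (x01 i).
have x1' : 0 <= 1 - x D by lra.
have := ler_wpM2r x1' IH; rewrite mulrBl mul1r mulrBr mulr1.
have : 0 <= (\sum_(i < D) x i) * x D by rewrite mulr_ge0.
by lra.
Qed.

Lemma geometric_le r D : 0 < r < 1 -> \sum_(i < D) r ^+ i.+1 <= r / (1 - r).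
Proof.
case/andP => r0 r1; have r1' : 0 < 1 - r by rewrite subr_gt0.
under eq_bigr do rewrite exprS.
rewrite -mulr_sumr ler_pM2l // -[leRHS]mul1r ler_pdivlMr //.
by rewrite mulrC -opprB mulNr -subrX1 opprB gerBl exprn_ge0 // ltW.
Qed.

(** Beyond an index [K] for which the geometric tail is at most 1/2, the union
    bound [prod_1sub_ge] keeps the product above half of its value at [K]. *)
Lemma euler_prod_ge u : 0 < u < 1 ->
  exists2 c : R, 0 < c & forall D, c <= euler_prod_fin u D.
Proof.
move=> u01; case/andP: (u01) => u0 u1; have u1' : 0 < 1 - u by lra.
have pu i : 0 <= u ^+ i.+1 <= 1.
  by rewrite exprn_ge0 ?(ltW u0) // exprn_ile1 // ltW.
have [C C0 CP] := poly_geometric 1 u01.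
have [K KP] : exists K : nat, 2 * C / (1 - u) <= K%:R.
  exists (Num.bound (2 * C / (1 - u))); apply/ltW/archi_boundP.
  by rewrite divr_ge0 ?mulr_ge0 // ltW.
have K0 : 0 < K.+1%:R :> R by rewrite ltr0n.
have uK : u ^+ K / (1 - u) <= 2^-1.
  have := CP K; rewrite expr1 => h.
  have h2 : u ^+ K <= C / K.+1%:R by rewrite ler_pdivlMr // mulrC.
  have h3 : 2 * C <= K%:R * (1 - u) by rewrite -ler_pdivrMr.
  rewrite ler_pdivrMr // (le_trans h2) // ler_pdivrMr //.
  have : K.+1%:R = K%:R + 1 :> R by rewrite natr1.
  by move=> ->; nra.
have pos D : 0 < euler_prod_fin u D.
  by apply: prodr_gt0 => i _; rewrite subr_gt0 exprn_ilt1 // ltW.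
exists (euler_prod_fin u K / 2) => [|D]; first by rewrite divr_gt0.
have dec k : euler_prod_fin u (D + k) <= euler_prod_fin u D.
  elim: k => [|k IH]; first by rewrite addn0.
  rewrite addnS /euler_prod_fin big_ord_recr /=; apply: le_trans IH.
  by rewrite ler_piMr ?(ltW (pos _)) // gerBl; case/andP: (pu (D + k)%N).
apply: le_trans (dec K); rewrite addnC /euler_prod_fin big_split_ord /=.
rewrite ler_wpM2l ?(ltW (pos K)) //.
apply: le_trans (prod_1sub_ge D (x := fun i => u ^+ (K + i).+1) _) => [|i //].
rewrite lerBrDr -lerBrDl.
apply: le_trans (_ : u ^+ K * (u / (1 - u)) <= _).
  under eq_bigr do rewrite -addnS exprD.
  by rewrite -mulr_sumr ler_wpM2l ?exprn_ge0 ?geometric_le // ltW.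
have h0 : 0 <= u ^+ K / (1 - u) by rewrite divr_ge0 ?exprn_ge0 // ltW.
rewrite mulrCA; apply: (@le_trans _ _ (1 * (u ^+ K / (1 - u)))).
  by rewrite ler_wpM2r // ltW.
by lra.
Qed.

Lemma partition_summable u : 0 < u < 1 ->
  abs_summable (fun l : intpart => u ^+ psize l).
Proof.
move=> u01; have [c c0 cP] := euler_prod_ge u01; exists c^-1 => B.
case/andP: (u01) => u0 u1.
have up k : 0 <= u ^+ k by rewrite exprn_ge0 // ltW.
pose D := (\sum_(l <- B) psize l)%N.
have BD : (B `<=` box D)%fset.
  apply/fsubsetP => l lB; apply: mem_box; rewrite /D (big_fsetD1 l) //=.
  exact: leq_addr.
under eq_bigr do rewrite ger0_norm //.
apply: (@le_trans _ _ (\sum_(l <- box D) u ^+ psize l)).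
  by apply: ler_sum_fsub.
have pD : 0 < euler_prod_fin u D by apply: lt_le_trans (cP D).
rewrite -[leLHS](mulfK (lt0r_neq0 pD)) box_sum_euler // ler_pdivrMr //.
apply: (@le_trans _ _ 1); last by rewrite mulrC ler_pdivlMr // mul1r.
apply: prodr_ile1 => i _; have /andP[v0 v1] : 0 <= u ^+ D.+1 <= 1.
  by rewrite up exprn_ile1 // ltW.
by rewrite subr_ge0 exprn_ile1 //= gerBl exprn_ge0.
Qed.

Lemma has_sum_cvg (I : choiceType) (A : nat -> {fset I}) (F : I -> R) S :
    (forall B : {fset I}, exists D, forall E, (D <= E)%N -> (B `<=` A E)%fset) ->
  has_sum F S -> (fun D => \sum_(i <- A D) F i) @ \oo --> S.
Proof.
move=> exA /has_sumP FS; apply/cvgrPdist_lt => e /FS[B BP].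
by have [D DP] := exA B; exists D => // E /= DE; apply/BP/DP.
Qed.

(** By [box_sum_euler] the box sum times the Euler product differs from 1 by at
    most a geometric tail in [u ^+ D.+1]. *)
Lemma euler_prod_cvg u S : 0 < u < 1 ->
    has_sum (fun l : intpart => u ^+ psize l) S ->
  S != 0 /\ (euler_prod_fin u @ \oo --> S^-1).
Proof.
move=> u01; case/andP: (u01) => u0 u1 uS.
have exA (B : {fset intpart}) : exists D, forall E, (D <= E)%N -> (B `<=` box E)%fset.
  exists (\sum_(l <- B) psize l)%N => E DE; apply/fsubsetP => l lB; apply: mem_box.
  by apply: leq_trans DE; rewrite (big_fsetD1 l) //= leq_addr.
have boxS := has_sum_cvg exA uS.
pose f D := \sum_(l <- box D) u ^+ psize l.
have f1 D : 1 <= f D.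
  have e0 : emptyp \in box D by rewrite mem_box.
  rewrite /f (big_fsetD1 emptyp) //= expr0 lerDl sumr_ge0 // => l _.
  by rewrite exprn_ge0 // ltW.
have S1 : 1 <= S.
  rewrite -(cvg_lim (@Rhausdorff R) boxS).
  by apply: limr_ge; [apply: cvgP boxS|apply: nearW].
have S0 : S != 0 by rewrite gt_eqF // (lt_le_trans ltr01).
split=> //.
have -> : euler_prod_fin u = (fun D => (f D)^-1 * (f D * euler_prod_fin u D)).
  apply/funext => D; rewrite mulKf // gt_eqF // (lt_le_trans ltr01) //.
rewrite -[S^-1]mulr1; apply: cvgM; first exact: cvgV.
have uk0 : (fun D : nat => u ^+ D.+1) @ \oo --> (0 : R).
  have u_lt1 : `|u| < 1 by rewrite ger0_norm // ltW.
  by have := cvg_expr u_lt1; rewrite -cvg_shiftS.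
apply: (@squeeze_cvgr _ _ _ _ (fun D => 1 - u ^+ D.+1 / (1 - u ^+ D.+1)) (fun=> 1)).
- apply: nearW => D; rewrite box_sum_euler //.
  have v01 : 0 < u ^+ D.+1 < 1 by rewrite exprn_gt0 //= exprn_ilt1 // ltW.
  case/andP: (v01) => v0 v1.
  have pv i : 0 <= (u ^+ D.+1) ^+ i.+1 <= 1.
    by rewrite exprn_ge0 ?(ltW v0) // exprn_ile1 // ltW.
  apply/andP; split.
    apply: le_trans (prod_1sub_ge D (x := fun i => (u ^+ D.+1) ^+ i.+1) pv).
    by rewrite lerD2l lerN2 geometric_le.
  apply: prodr_ile1 => i _; case/andP: (pv i) => p0 p1.
  by rewrite subr_ge0 p1 gerBl.
- rewrite -[X in _ --> X]subr0 -[X in _ --> _ - X](mul0r (1 - 0)^-1).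
  apply: cvgB; first exact: cvg_cst.
  apply: cvgM => //; apply: cvgV; first by rewrite subr0 oner_neq0.
  by apply: cvgB => //; apply: cvg_cst.
- exact: cvg_cst.
Qed.

End Counting.

(** * Absolute summability of cyclic weights *)

(** A finite set of families is contained in the product of the sets of their
    values, over which the sum factors. *)
Lemma prod_summable (R : realType) (J : choiceType) (I : finType) (f : J -> R) :
  (forall j, 0 <= f j) -> abs_summable f ->
  abs_summable (fun l : {ffun I -> J} => \prod_i f (l i)).
Proof.
move=> f0 [G fG]; exists (G ^+ #|I|) => B.
under eq_bigr do rewrite ger0_norm ?prodr_ge0 //.
pose ev (p : {ffun I -> J} * I) := p.1 p.2.
pose S := [fset ev p | p in [seq (l, i) | l <- B, i <- enum I]]%fset.
pose lift (h : {ffun I -> S}) : {ffun I -> J} := [ffun i => val (h i)].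
pose BB := [fset lift h | h : {ffun I -> S}]%fset.
apply: (@le_trans _ _ (\sum_(l <- BB) \prod_i f (l i))).
  apply: ler_sum_fsub => [|l]; last exact: prodr_ge0.
  apply/fsubsetP => l lB.
  have lS i : l i \in S.
    apply/imfsetP; exists (l, i) => //=; apply/allpairsP; exists (l, i).
    by rewrite mem_enum.
  apply/imfsetP; exists [ffun i => [` lS i]%fset] => //.
  by apply/ffunP => i; rewrite !ffunE.
rewrite big_imfset /=; last first.
  move=> h g _ _ /ffunP hg; apply/ffunP => i; apply: val_inj.
  by have := hg i; rewrite !ffunE.
rewrite big_enum /=.
under eq_bigr do under eq_bigr do rewrite ffunE.
rewrite -(bigA_distr_bigA (fun (i : I) (x : S) => f (val x))).
rewrite -(@prodr_const _ I xpredT G) ; apply: ler_prod => i _.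
rewrite sumr_ge0 //= (_ : \sum_j _ = \sum_(j <- S) `|f j|); first exact: fG.
by rewrite big_seq_fsetE; apply: eq_bigr => j _; rewrite ger0_norm.
Qed.

Section CyclicSummable.
Context (R : realType) (V : choiceType) (m : {cmonom V}) (n d : nat) (u : R).
Hypothesis u01 : 0 < u < 1.
Context (s : intpart -> R) (y x : 'I_n.+1 -> intpart -> intpart -> fps V R).
Hypothesis s_gt0 : forall l, 0 < s l.
Hypothesis y_size : forall i l k, divnorm m (y i l k) != 0 ->
  (psize k <= psize l <= psize k + d)%N.
Hypothesis x_size : forall i l k, divnorm m (x i l k) != 0 ->
  (psize k <= psize l <= psize k + d)%N.
Hypothesis y_bound : forall r : R, 0 < r < 1 -> exists C : R,
  forall i l k, divnorm m (y i l k) * r ^+ psize k <= C * (s k / s l).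
Hypothesis x_bound : forall r : R, 0 < r < 1 -> exists C : R,
  forall i l k, divnorm m (x i l k) * r ^+ psize k <= C * (s l / s k).

Local Notation config := ({ffun 'I_n.+1 -> intpart} * {ffun 'I_n.+1 -> intpart})%type.

(** The bounds [y_bound] and [x_bound] only need to hold up to any geometric
    growth, because [u ^+ psize (k ord_max)] controls all the partitions of a
    configuration; the quotients of [s] telescope around the cycle. *)
Definition cyclic_weight (lk : config) : fps V R :=
  u ^+ psize (lk.2 ord_max) *:
  \prod_i (y i (lk.1 i) (lk.2 i) * x (ordS i) (lk.1 (ordS i)) (lk.2 i)).

Lemma ordS_lt (i j : 'I_n.+1) : j = i.+1 :> nat -> ordS i = j.
Proof.
by move=> ij; apply: val_inj; rewrite /= -ij modn_small // ij ltn_ord.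
Qed.

(** A nonzero weight forces the sizes to vary by at most [d] at each step of the
    cycle, so all of them are controlled by the last one. *)
Lemma cyclic_sizes (lk : config) :
    (forall i, divnorm m (y i (lk.1 i) (lk.2 i)) != 0) ->
    (forall i, divnorm m (x (ordS i) (lk.1 (ordS i)) (lk.2 i)) != 0) ->
  forall i, (psize (lk.1 i) <= psize (lk.2 ord_max) + n.+1 * d)%N /\
    (psize (lk.2 i) <= psize (lk.2 ord_max) + n.+1 * d)%N.
Proof.
case: lk => l k /= y0 x0.
have step i : (psize (k i) <= psize (k (ordS i)) + d)%N.
  have /andP[h1 _] := x_size (x0 i); have /andP[_ h2] := y_size (y0 (ordS i)).
  exact: leq_trans h1 h2.
have down j : (j <= n)%N ->
    (psize (k (inord (n - j))) <= psize (k ord_max) + j * d)%N.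
  elim: j => [|j IH] jn.
    rewrite subn0 mul0n addn0 (_ : inord n = ord_max) //.
    by apply: val_inj; rewrite /= inordK.
  have := step (inord (n - j.+1)); rewrite (@ordS_lt _ (inord (n - j))).
    move/leq_trans; apply; rewrite mulSn [(d + _)%N]addnC addnA leq_add2r IH //.
    exact: ltnW.
  by rewrite inordK ?ltnS ?leq_subr // inordK ?ltnS ?leq_subr // subnSK.
have kb i : (psize (k i) <= psize (k ord_max) + n * d)%N.
  have := down (n - i)%N; rewrite leq_subr => /(_ isT); rewrite subKn; last by rewrite -ltnS.
  rewrite inord_val => /leq_trans; apply; rewrite leq_add2l leq_mul2r leq_subr.
  by rewrite orbT.
move=> i; split.
  have /andP[_ /leq_trans] := y_size (y0 i); apply.
  by rewrite mulSn [(d + _)%N]addnC addnA leq_add2r.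
by apply: leq_trans (kb i) _; rewrite leq_add2l mulSn leq_addl.
Qed.

(** The weight is dominated by a multiple of [\prod_i r ^+ (|l i| + |k i|)],
    whose sum is a power of the generating function of partitions at [r]. *)
Lemma cyclic_summable : abs_summable (fun lk => cyclic_weight lk m).
Proof.
pose M := n.+1; pose D := (M * d)%N.
(* The power of [u] pays, for each [i], two factors in [k i] for the bounds on
   [y] and [x], and one factor in each of [l i] and [k i] for summability. *)
have [r r01 ur] := root_exists (4 * M)%N u01; case/andP: (r01) => r0 r1.
have [Cy yC] := y_bound r01; have [Cx xC] := x_bound r01.
pose C := `|Cy| + `|Cx|.
have C0 : 0 <= C by rewrite addr_ge0.
have rk k : 0 < r ^+ k by rewrite exprn_gt0.
pose e (lk : config) := (\prod_i r ^+ psize (lk.1 i)) * \prod_i r ^+ psize (lk.2 i).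
pose K := (C * C) ^+ M / r ^+ (4 * M * D)%N.
have K0 : 0 <= K by rewrite divr_ge0 ?exprn_ge0 ?mulr_ge0 // ltW.
have e_sum : abs_summable e.
  have ps := partition_summable r01.
  have rp : forall l : intpart, 0 <= r ^+ psize l by move=> l; apply: ltW.
  have pj : abs_summable (fun l : {ffun 'I_n.+1 -> intpart} =>
      \prod_i r ^+ psize (l i)).
    exact: (prod_summable _ (f := fun l : intpart => r ^+ psize l) rp ps).
  exact: (abs_summableM pj pj).
apply: (abs_summable_le e_sum K0) => -[l k].
have e0 : 0 < e (l, k) by rewrite mulr_gt0 // prodr_gt0.
rewrite (ger0_norm (ltW e0)).
pose Y i := divnorm m (y i (l i) (k i)).
pose X i := divnorm m (x (ordS i) (l (ordS i)) (k i)).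
have Y0 i : 0 <= Y i by apply: divnorm_ge0.
have X0 i : 0 <= X i by apply: divnorm_ge0.
apply: (@le_trans _ _ (u ^+ psize (k ord_max) * \prod_i (Y i * X i))).
  apply: le_trans (coef_le_divnorm1 _ _) _; rewrite divnormZ.
  rewrite ger0_norm ?exprn_ge0 //; last by case/andP: u01 => /ltW.
  rewrite ler_wpM2l ?exprn_ge0 //; first by case/andP: u01 => /ltW.
  by apply: divnorm_prod => i _; apply: divnormM.
have [/existsP[i /eqP YX0]|] := boolP [exists i, Y i * X i == 0].
  by rewrite (bigD1 i) //= YX0 mul0r mulr0 mulr_ge0 // ltW.
rewrite negb_exists => /forallP YX0.
have sizes := @cyclic_sizes (l, k).
have {}sizes i : (psize (l i) <= psize (k ord_max) + D)%N /\
    (psize (k i) <= psize (k ord_max) + D)%N.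
  apply: sizes => /= j; have := YX0 j; rewrite mulf_eq0 negb_or => /andP[]; by [].
pose b := \prod_i (r ^+ psize (k i) * r ^+ psize (k i)).
have b0 : 0 < b by apply: prodr_gt0 => i _; rewrite mulr_gt0.
have ab : (\prod_i (Y i * X i)) * b <= (C * C) ^+ M.
  rewrite /b -big_split /=.
  apply: (@le_trans _ _ (\prod_i ((C * (s (k i) / s (l i))) *
                                 (C * (s (l (ordS i)) / s (k i)))))).
    apply: ler_prod => i _; rewrite !mulr_ge0 ?(ltW (rk _)) //= mulrACA.
    have yi := yC i (l i) (k i); have xi := xC (ordS i) (l (ordS i)) (k i).
    apply: ler_pM; rewrite ?mulr_ge0 ?(ltW (rk _)) //.
      apply: le_trans yi _; rewrite ler_wpM2r ?divr_ge0 ?(ltW (s_gt0 _)) //.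
      by rewrite /C; have := ler_norm Cy; have := normr_ge0 Cx; lra.
    apply: le_trans xi _; rewrite ler_wpM2r ?divr_ge0 ?(ltW (s_gt0 _)) //.
    by rewrite /C; have := ler_norm Cx; have := normr_ge0 Cy; lra.
  have -> : \prod_i (C * (s (k i) / s (l i)) * (C * (s (l (ordS i)) / s (k i)))) =
      \prod_(i < n.+1) (C * C * (s (l (ordS i)) / s (l i))).
    have cancel_mid (c a1 a2 a3 : R) : 0 < a1 -> 0 < a2 ->
        c * (a2 / a1) * (c * (a3 / a2)) = c * c * (a3 / a1).
      by move=> a10 a20; field; rewrite !gt_eqF.
    by apply: eq_bigr => i _; apply: cancel_mid.
  rewrite big_split /= [X in _ * X]big_split /=.
  have -> : \prod_i s (l (ordS i)) = \prod_i s (l i).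
    by rewrite [RHS](reindex_inj (bij_inj (ordS_bij n))).
  rewrite -big_split /= [X in _ * X]big1 ?mulr1 => [|i _]; last first.
    by rewrite divff // gt_eqF.
  by rewrite prodr_const card_ord.
have be : r ^+ (4 * M * (psize (k ord_max) + D))%N <= b * e (l, k).
  rewrite /b /e -!big_split /= mulnAC exprM -(card_ord M) -prodr_const.
  apply: ler_prod => i _; rewrite ltW //= -!exprD.
  have [h1 h2] := sizes i.
  rewrite ler_wiXn2l ?(ltW r0) ?(ltW r1) //.
  apply: leq_trans (leq_add (leq_add h2 h2) (leq_add h1 h2)) _.
  by move: (psize (k ord_max) + D)%N; clear; lia.
have uk : u ^+ psize (k ord_max) * r ^+ (4 * M * D)%N <= b * e (l, k).
  apply: le_trans be; rewrite mulnDr exprD ler_wpM2r ?(ltW (rk _)) //.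
  by rewrite exprM lerXn2r // nnegrE ?exprn_ge0 //; [case/andP: u01 => /ltW|apply: ltW].
have -> : K * e (l, k) = (C * C) ^+ M * (b * e (l, k)) / (b * r ^+ (4 * M * D)%N).
  have cancel_b (a b' c f : R) : 0 < b' -> 0 < c ->
      a / c * f = a * (b' * f) / (b' * c).
    by move=> b'0 c0; field; rewrite !gt_eqF.
  exact: cancel_b.
rewrite ler_pdivlMr ?mulr_gt0 //.
have u0 : 0 <= u ^+ psize (k ord_max) by rewrite exprn_ge0 //; case/andP: u01 => /ltW.
rewrite [leLHS](_ : _ = ((\prod_i (Y i * X i)) * b) *
   (u ^+ psize (k ord_max) * r ^+ (4 * M * D)%N)); last first.
  by rewrite [RHS]mulrACA; congr (_ * _); apply: mulrC.
apply: ler_pM => //; rewrite mulr_ge0 ?(ltW b0) ?(ltW (rk _)) //.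
by apply: prodr_ge0 => i _; rewrite mulr_ge0.
Qed.

End CyclicSummable.

(** * Subexponential bounds for skew functions *)

Section Bounds.
Context (R : realType) (V : choiceType) (m : {cmonom V}) (X : nat -> V).
Hypothesis X_inj : injective X.
Context (q t : R).
Hypotheses (q01 : 0 < q < 1) (t01 : 0 < t < 1).
Local Notation d := (mdeg m).
Local Notation z := (macdonald_norm q t).
Local Notation pX := (pw R X).
Let z_gt0 lam : 0 < z lam := macdonald_norm_gt0 q01 t01 lam.

Lemma pskew_sizes l k : divnorm m (pskew pX l k) != 0 ->
  (psize k <= psize l <= psize k + d)%N.
Proof.
case/divnorm_neq0 => a am /pskew_homog <- => [|n]; last exact: homog_pw.
by rewrite leq_addr leq_add2l mdeg_cmdivs.
Qed.

Lemma divnorm_pw n : divnorm m (pX n) <= (size (cmdivs m))%:R.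
Proof.
rewrite /divnorm -sum1_size natr_sum; apply: ler_sum => a _.
by rewrite pwE // normr_nat; case: `[< _ >].
Qed.

Lemma bin_le_exp l k : (k <= l)%N -> ('C(l, k) <= l ^ (l - k))%N.
Proof.
move=> kl; rewrite -bin_sub //; elim: (l - k)%N => [|j IH]; first by rewrite bin0.
rewrite expnS -(leq_pmul2l (ltn0Sn j)) mul_bin_left.
apply: leq_trans (leq_mul (leq_subr j l) IH) _.
by rewrite leq_pmull.
Qed.

Lemma skew_degree_le M l k : (forall i, (M <= i)%N -> mult l i.+1 = 0%N) ->
    (forall i, (mult k i.+1 <= mult l i.+1)%N) ->
  (\sum_(i < M) (mult l i.+1 - mult k i.+1) + psize k <= psize l)%N.
Proof.
move=> l0 kl.
have k0 i : (M <= i)%N -> mult k i.+1 = 0%N.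
  by move=> Mi; apply/eqP; rewrite -leqn0 -(l0 i Mi).
rewrite (psizeE l0) (psizeE k0) -big_split /=; apply: leq_sum => i _.
by rewrite -{2}(subnK (kl i)) mulnDl leq_add2r leq_pmulr.
Qed.

(** Removing a part divides the norm by a quantity bounded below, uniformly in
    the part. *)
Lemma kap_ge n : 1 - q <= kap q t n.
Proof.
case/andP: (q01) => q0 q1; case/andP: (t01) => t0 t1.
rewrite /kap ler_pdivlMr ?onesub_gt0 //.
have q2 : q ^+ n.+1 <= q by rewrite exprS ler_piMr ?exprn_ile1 // ltW.
have t2 : 0 <= t ^+ n.+1 by rewrite exprn_ge0 // ltW.
have : 0 <= (1 - q) * t ^+ n.+1 by rewrite mulr_ge0 // subr_ge0 ltW.
by lra.
Qed.

Lemma normf_ratio n a b : (b <= a)%N ->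
  normf q t n b <= normf q t n a * ((1 - q)^-1) ^+ (a - b).
Proof.
move=> ba; have q1 : 0 < 1 - q by case/andP: q01 => _; lra.
have kn := kap_ge n.
rewrite /normf; set v := n.+1%:R * _.
have -> : v ^+ a = v ^+ b * v ^+ (a - b) by rewrite -exprD subnKC.
have v0 : 0 < v by rewrite mulr_gt0 ?ltr0n ?kap_gt0.
rewrite -!mulrA -exprMn.
apply: ler_pM => //; first by rewrite exprn_ge0 // ltW.
  by rewrite ler_nat leq_fact.
rewrite ler_peMr ?exprn_ge0 ?(ltW v0) // exprn_ege1 //.
rewrite ler_pdivlMr // mul1r (le_trans kn) // /v ler_peMl ?ler1n //.
by rewrite ltW ?kap_gt0.
Qed.

(** At most [d] parts are removed from [l]. Each removal costs a binomial factor
    polynomial in the size of [l], absorbed by [r ^+ psize k], and a bounded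
    factor of the norms. *)
Lemma pskew_bound (r : R) : 0 < r < 1 -> exists C : R, forall l k,
  divnorm m (pskew pX l k) * r ^+ psize k <=
  C * (Num.sqrt (z l) / Num.sqrt (z k)).
Proof.
move=> r01; case/andP: (r01) => r0 r1.
have [C0 C0_ge0 C0P] := poly_geometric d r01.
pose B : R := (size (cmdivs m))%:R; pose c := (1 - q)^-1.
have q1 : 0 < 1 - q by case/andP: q01 => _; lra.
have B1 : 1 <= B.
  by rewrite /B ler1n -has_predT; apply/hasP; exists mone => //; apply: mone_cmdivs.
have c1 : 1 <= c by rewrite invf_ge1 //; case/andP: q01; lra.
pose C := (d.+1%:R * B) ^+ d * C0 * c ^+ d.
have C_ge0 : 0 <= C.
  rewrite /C mulr_ge0 ?exprn_ge0 //; last by lra.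
  by rewrite mulr_ge0 // exprn_ge0 // mulr_ge0 //; lra.
have s0 l : 0 < Num.sqrt (z l) by rewrite sqrtr_gt0.
exists C => l k.
have [->|N0] := eqVneq (divnorm m (pskew pX l k)) 0.
  by rewrite mul0r mulr_ge0 // divr_ge0 // ltW.
have /andP[kl lk] := pskew_sizes N0.
have ml : forall i, (mult k i.+1 <= mult l i.+1)%N.
  by apply: (@pskew_neq0 _ pX); apply: contraNneq N0 => ->; rewrite divnorm0.
pose M := maxn (psize l) (psize k).
have l0 i : (M <= i)%N -> mult l i.+1 = 0%N.
  by rewrite geq_max => /andP[/mult_psize].
have k0 i : (M <= i)%N -> mult k i.+1 = 0%N.
  by rewrite geq_max => /andP[_ /mult_psize].
pose e := (\sum_(i < M) (mult l i.+1 - mult k i.+1))%N.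
have ed : (e <= d)%N.
  by have := skew_degree_le l0 ml; rewrite -/e => h; rewrite -(leq_add2r (psize k)) (leq_trans h) // addnC.
pose K : R := (psize l).+1%:R.
have K1 : 1 <= K by rewrite ler1n.
have h1 : divnorm m (pskew pX l k) <= (K * B) ^+ d.
  apply: (@le_trans _ _ ((K * B) ^+ e)); last first.
    by rewrite ler_weXn2l // -[1]mulr1 ler_pM.
  rewrite /e -prodrXr /pskew; apply: divnorm_prod => i _.
  rewrite /binx mulr_natl -scaler_nat divnormZ normr_nat exprMn.
  apply: ler_pM; rewrite ?divnorm_ge0 //.
    rewrite /K -natrX ler_nat; apply: leq_trans (bin_le_exp (ml i)) _.
    have := mult_le_psize l i; case: (mult l i.+1 - _)%N => [//|j] h.
    by rewrite leq_exp2r // (leq_trans h).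
  apply: le_trans (divnormX _ _ _) _.
  by rewrite lerXn2r ?nnegrE ?divnorm_ge0 ?divnorm_pw //; lra.
have h2 : 1 <= Num.sqrt (z l) / Num.sqrt (z k) * c ^+ d.
  rewrite mulrAC ler_pdivlMr // mul1r.
  have cd0 : 0 <= c ^+ d by rewrite exprn_ge0 // (le_trans ler01).
  rewrite -[c ^+ d](@ger0_norm _ (c ^+ d)) // -sqrtr_sqr -sqrtrM ?(ltW (z_gt0 _)) //.
  rewrite ler_wsqrtr // (macdonald_normE q t k0) (macdonald_normE q t l0).
  apply: (@le_trans _ _ ((\prod_(i < M) normf q t i (mult l i.+1)) * c ^+ e)).
    rewrite /e -prodrXr -big_split /=; apply: ler_prod => i _.
    by rewrite (ltW (normf_gt0 q01 t01 _ _)) normf_ratio.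
  rewrite ler_wpM2l //.
    by apply: prodr_ge0 => i _; apply/ltW/normf_gt0.
  rewrite -exprM ler_weXn2l // mulnC; apply: leq_trans ed _.
  by rewrite mul2n -addnn leq_addr.
apply: (@le_trans _ _ ((d.+1%:R * B) ^+ d * C0)).
  apply: (@le_trans _ _ ((d.+1%:R * B * (psize k).+1%:R) ^+ d * r ^+ psize k)).
    rewrite ler_wpM2r ?exprn_ge0 ?(ltW r0) //; apply: le_trans h1 _.
    rewrite lerXn2r ?nnegrE ?mulr_ge0 // mulrAC ler_wpM2r //.
    rewrite /K -natrM ler_nat; apply: leq_trans (_ : (psize k + d).+1 <= _)%N => //.
    by rewrite mulSn mulnS; clear; lia.
  rewrite [(_ * (psize k).+1%:R) ^+ d]exprMn -mulrA ler_wpM2l //.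
  by rewrite exprn_ge0 // mulr_ge0 //; lra.
rewrite /C -mulrA [c ^+ d * _]mulrC ler_peMr //.
by rewrite mulr_ge0 // exprn_ge0 // mulr_ge0 //; lra.
Qed.

End Bounds.

Lemma ler_sum_size (R : numDomainType) (T : eqType) (s : seq T) (F : T -> R) c :
  {in s, forall x, F x <= c} -> \sum_(x <- s) F x <= (size s)%:R * c.
Proof.
move=> Fc; rewrite big_seq (le_trans (ler_sum _ Fc)) // -big_seq.
by rewrite big_const_seq count_predT iter_addr_0 mulr_natl.
Qed.

Section SkewBounds.
Context (R : realType) (V : choiceType) (m : {cmonom V}) (X : nat -> V).
Hypothesis X_inj : injective X.
Context (q t : R).
Hypotheses (q01 : 0 < q < 1) (t01 : 0 < t < 1).
Context (form : {bilinear symf R -> symf R -> R | *%R & *%R}).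
Context (P : intpart -> symf R).
Hypotheses (formE : is_macdonald_form q t form) (PE : is_macdonald_P form P).
Context (A : intpart -> intpart -> R).
Hypothesis AE : forall lam,
  P lam = \sum_(l <- parts_of (psize lam)) A lam l *: symf_p l /\
  forall l, psize l != psize lam -> A lam l = 0.
Local Notation d := (mdeg m).
Local Notation z := (macdonald_norm q t).
Local Notation N := (norm_mac form P).
Local Notation Ainv := (inv_coef q t form P A).
Local Notation skewP := (skew_mac q t form P A).
Local Notation sqrt := Num.sqrt.
Let z_gt0 lam : 0 < z lam := macdonald_norm_gt0 q01 t01 lam.
Let N_gt0 lam : 0 < N lam := normP_gt0 q01 t01 formE PE AE lam.
Let sz_gt0 lam : 0 < sqrt (z lam). Proof. by rewrite sqrtr_gt0. Qed.
Let sN_gt0 lam : 0 < sqrt (N lam). Proof. by rewrite sqrtr_gt0. Qed.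

(** Bessel inequality for the expansion of [P l] in the orthogonal family of
    power sums. *)
Lemma A_bound l r : `|A l r| <= sqrt (N l) / sqrt (z r).
Proof.
have [rl|rl] := eqVneq (psize r) (psize l); last first.
  by rewrite (AE l).2 // normr0 divr_ge0 // ltW.
rewrite ler_pdivlMr // -sqrtr_sqr -sqrtrM ?sqr_ge0 // ler_wsqrtr //.
have rS : r \in parts_le (psize l) by rewrite mem_parts_le rl.
rewrite (normPE formE AE (leqnn _)) (big_fsetD1 r rS) /= lerDl sumr_ge0 // => s _.
by rewrite mulr_ge0 ?sqr_ge0 // ltW.
Qed.

Lemma Ainv_bound s k : `|Ainv s k| <= sqrt (z s) / sqrt (N k).
Proof.
rewrite /inv_coef (normrM _ _^-1) (normrM (z s)) (ger0_norm (ltW (z_gt0 s))).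
have iN : 0 <= (N k)^-1 by rewrite invr_ge0 ltW.
rewrite (ger0_norm iN).
apply: (@le_trans _ _ (z s * (sqrt (N k) / sqrt (z s)) / N k)).
  by apply: ler_wpM2r => //; apply: ler_wpM2l; [exact: ltW|exact: A_bound].
rewrite -{1}(sqr_sqrtr (ltW (z_gt0 s))) -{2}(sqr_sqrtr (ltW (N_gt0 k))).
have frac (a b : R) : 0 < a -> 0 < b -> a ^+ 2 * (b / a) / b ^+ 2 = a / b.
  by move=> a0 b0; field; rewrite !gt_eqF.
by rewrite frac.
Qed.

Lemma skewP_at l k : symf_at X (skewP l k) =
  \sum_(r <- parts_of (psize l)) \sum_(s <- parts_of (psize k))
    (A l r * Ainv s k) *: pskew (pw R X) r s.
Proof.
rewrite symf_at_sum //; apply: eq_bigr => r _.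
rewrite symf_at_sum //; apply: eq_bigr => s _.
by rewrite symf_atZ // symf_at_pskew.
Qed.

Lemma skewP_sizes l k : divnorm m (symf_at X (skewP l k)) != 0 ->
  (psize k <= psize l <= psize k + d)%N.
Proof.
move=> N0; apply: contrapT => sz; case/eqP: N0.
apply/eqP; rewrite eq_le divnorm_ge0 andbT skewP_at.
apply: le_trans (divnorm_sum _ _ _ _) _.
rewrite big_seq big1 // => r; rewrite mem_parts_of => /eqP rl.
apply/eqP; rewrite eq_le divnorm_ge0 andbT.
apply: le_trans (divnorm_sum _ _ _ _) _.
rewrite big_seq big1 // => s; rewrite mem_parts_of => /eqP sk.
rewrite divnormZ; have [->|] := eqVneq (divnorm m (pskew (pw R X) r s)) 0.
  by rewrite mulr0.
by move/(pskew_sizes X_inj); rewrite rl sk => /sz.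
Qed.

Lemma parts_of_bound (r : R) : 0 < r < 1 -> exists2 G : R, 0 <= G &
  forall k, (size (parts_of k))%:R * r ^+ k <= G.
Proof.
move=> r01; have [G GP] := partition_summable r01; case/andP: (r01) => r0 _.
exists G => [|k]; first by apply: le_trans (GP fset0); rewrite big_seq_fset0.
apply: le_trans (GP (parts_of k)); rewrite big_seq.
rewrite (eq_bigr (fun _ => r ^+ k)) => [|l].
  by rewrite -big_seq big_const_seq count_predT iter_addr_0 mulr_natl.
by rewrite mem_parts_of => /eqP ->; rewrite ger0_norm // exprn_ge0 // ltW.
Qed.

(** The bound for skew power sums survives the change of basis: the quotients of
    norms compose, and the numbers of partitions of [psize l] and [psize k] grow
    subexponentially. *)
Lemma skewP_bound (r : R) : 0 < r < 1 -> exists C : R, forall l k,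
  divnorm m (symf_at X (skewP l k)) * r ^+ psize k <=
  C * (sqrt (N l) / sqrt (N k)).
Proof.
move=> r01.
(* One factor [r1 ^+ psize k] for the bound on skew power sums and one for each
   of the two numbers of partitions. *)
have [r1 r1_01 rr1] := root_exists 3 r01.
case/andP: (r01) => r0 _; case/andP: (r1_01) => r10 r11.
have [C' CP'] := pskew_bound m X_inj q01 t01 r1_01.
have [G G0 GP] := parts_of_bound r1_01.
pose C := `|C'|; have C0 : 0 <= C by exact: normr_ge0.
have rk k : 0 < r1 ^+ k by rewrite exprn_gt0.
exists (C * G * G / r1 ^+ d) => l k.
have K0 : 0 <= C * G * G / r1 ^+ d * (sqrt (N l) / sqrt (N k)).
  by rewrite mulr_ge0 // divr_ge0 ?mulr_ge0 // ltW.
have [->|N0] := eqVneq (divnorm m (symf_at X (skewP l k))) 0; first by rewrite mul0r.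
have /andP[_ lk] := skewP_sizes N0.
pose T : R := sqrt (N l) / sqrt (N k).
have T0 : 0 <= T by rewrite divr_ge0 // ltW.
have h1 : divnorm m (symf_at X (skewP l k)) * r1 ^+ psize k <=
    (size (parts_of (psize l)))%:R * ((size (parts_of (psize k)))%:R * (C * T)).
  rewrite skewP_at; apply: le_trans (ler_wpM2r (ltW (rk _)) (divnorm_sum _ _ _ _)) _.
  rewrite mulr_suml; apply: ler_sum_size => a _.
  apply: le_trans (ler_wpM2r (ltW (rk _)) (divnorm_sum _ _ _ _)) _.
  rewrite mulr_suml; apply: ler_sum_size => b; rewrite mem_parts_of => /eqP bk.
  rewrite divnormZ normrM -mulrA.
  apply: (@le_trans _ _ ((sqrt (N l) / sqrt (z a)) * (sqrt (z b) / sqrt (N k)) *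
     (C * (sqrt (z a) / sqrt (z b))))).
    apply: ler_pM; rewrite ?mulr_ge0 ?divnorm_ge0 ?(ltW (rk _)) //.
      by apply: ler_pM => //; [apply: A_bound|apply: Ainv_bound].
    rewrite -bk; apply: le_trans (CP' a b) _.
    by rewrite ler_wpM2r ?ler_norm // divr_ge0 // ltW.
  have frac (x y v w c : R) : 0 < y -> 0 < v -> 0 < w ->
      (x / y) * (v / w) * (c * (y / v)) = c * (x / w).
    by move=> y0 v0 w0; field; rewrite !gt_eqF.
  by rewrite frac // /T.
have r3 : r ^+ psize k <= r1 ^+ psize k * (r1 ^+ psize k * r1 ^+ psize k).
  rewrite -!exprD; apply: (@le_trans _ _ ((r1 ^+ 3) ^+ psize k)).
    by rewrite lerXn2r ?nnegrE ?exprn_ge0 // ltW.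
  by rewrite -exprM mulSn mulSn mul1n.
have rl : r1 ^+ psize k <= r1 ^+ psize l / r1 ^+ d.
  rewrite ler_pdivlMr // -exprD ler_wiXn2l // ltW //.
apply: le_trans (ler_wpM2l (divnorm_ge0 _ _) r3) _.
have rr : 0 <= r1 ^+ psize k * r1 ^+ psize k by rewrite mulr_ge0 // ltW.
rewrite [leLHS]mulrA; apply: le_trans (ler_wpM2r rr h1) _.
apply: (@le_trans _ _ ((size (parts_of (psize l)))%:R * ((size (parts_of (psize k)))%:R * (C * T)) *
   (r1 ^+ psize l / r1 ^+ d * r1 ^+ psize k))).
  apply: ler_wpM2l.
    by apply: mulr_ge0 => //; apply: mulr_ge0 => //; apply: mulr_ge0.
  by apply: ler_wpM2r => //; apply: ltW.
have regroup (a b c v w x y : R) : a * (b * (c * v)) * (w / x * y) =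
    c / x * v * ((a * w) * (b * y)) by ring.
rewrite regroup.
have -> : C * G * G / r1 ^+ d * (sqrt (N l) / sqrt (N k)) =
    C / r1 ^+ d * T * (G * G) by rewrite /T; ring.
apply: ler_wpM2l.
  by apply: mulr_ge0 => //; apply: divr_ge0 => //; apply: ltW.
by apply: ler_pM => //; rewrite mulr_ge0 // ltW.
Qed.

End SkewBounds.

(** * Moving a part around the cycle *)

Section Shift.
Context (R : realType) (n : nat) (q t u : R).
Hypotheses (q01 : 0 < q < 1) (t01 : 0 < t < 1).
Local Notation V := (alphabets n.+1).
Local Notation z := (macdonald_norm q t).
Local Notation ffp := {ffun 'I_n.+1 -> intpart}.
Let z_gt0 lam : 0 < z lam := macdonald_norm_gt0 q01 t01 lam.

Definition pwX (i : 'I_n.+1) p : fps V R := pw R (Xplus i) p.+1.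
Definition pwY (i : 'I_n.+1) p : fps V R := pw R (Yminus i) p.+1.

(** The skew functions of the power sum basis and of its dual basis. *)
Definition wX (i : 'I_n.+1) l k : fps V R := pskew (pw R (Xplus i)) l k.
Definition wY (i : 'I_n.+1) l k : fps V R :=
  (z k / z l) *: pskew (pw R (Yminus i)) l k.

Definition cfac p : R := (p.+1%:R * kap q t p)^-1.

Let cfac0 p : p.+1%:R * kap q t p != 0.
Proof. by rewrite mulf_neq0 ?pnatr_eq0 // gt_eqF ?kap_gt0. Qed.

Lemma scale_nat (k : nat) (f : fps V R) : k%:R *: f = k%:R * f.
Proof. by rewrite scaler_nat mulr_natl. Qed.

Lemma scale_mul (a b : R) (f g : fps V R) : (a *: f) * (b *: g) = (a * b) *: (f * g).
Proof. by rewrite -scalerAl -scalerAr scalerA. Qed.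

Lemma scaleAl (a : R) (f g : fps V R) : a *: (f * g) = (a *: f) * g.
Proof. exact: scalerAl. Qed.

Lemma scaleAr (a : R) (f g : fps V R) : a *: (f * g) = f * (a *: g).
Proof. exact: scalerAr. Qed.

Lemma wX_diag i p l k : (mult k p.+1).+1%:R *: wX i (addp p l) (addp p k) =
  (mult l p.+1).+1%:R *: wX i l k.
Proof. by have := pskew_diag (pw R (Xplus i)) p l k; rewrite !scale_nat. Qed.

Lemma wX_up i p l k : pwX i p * ((mult k p.+1).+1%:R *: wX i l (addp p k)) =
  (mult l p.+1 - mult k p.+1)%:R *: wX i l k.
Proof. by have := pskew_up (pw R (Xplus i)) p l k; rewrite !scale_nat. Qed.

(** The multiplication by a power sum and its adjoint commute up to a scalar. *)
Lemma wY_commute i p l k :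
  (mult l p.+1).+1%:R *: wY i (addp p l) (addp p k) -
    (cfac p *: pwY i p) * wY i l (addp p k) =
  (mult k p.+1).+1%:R *: wY i l k.
Proof.
have cancel1 (L M v a b : R) : L != 0 -> v != 0 -> a != 0 ->
    L * (M * v * b / (L * v * a)) = M * (b / a).
  by move=> L0 v0 a0; field; rewrite L0 v0 a0.
have cancel2 (M v a b : R) : v != 0 -> a != 0 ->
    v^-1 * (M * v * b / a) = M * (b / a).
  by move=> v0 a0; field; rewrite v0 a0.
have zl := lt0r_neq0 (z_gt0 l).
have l0 : (mult l p.+1).+1%:R != 0 :> R by rewrite pnatr_eq0.
rewrite /wY pskew_addpp -/(pwY i p) (macdonald_norm_addp q01 t01 p l).
rewrite (macdonald_norm_addp q01 t01 p k) scalerA cancel1 //.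
rewrite scale_mul /cfac cancel2 // scalerA.
by rewrite scalerDr addrAC subrr add0r.
Qed.

Lemma wY_commute0 i p l k : mult k p.+1 = 0%N ->
  (mult l p.+1).+1%:R *: wY i (addp p l) k = (cfac p *: pwY i p) * wY i l k.
Proof.
have cancel (L v a b : R) : L != 0 -> v != 0 -> a != 0 ->
    L * (b / (L * v * a)) = v^-1 * (b / a).
  by move=> L0 v0 a0; field; rewrite L0 v0 a0.
have zl := lt0r_neq0 (z_gt0 l).
have l0 : (mult l p.+1).+1%:R != 0 :> R by rewrite pnatr_eq0.
move=> k0; rewrite /wY pskew_addp0 // -/(pwY i p) (macdonald_norm_addp q01 t01 p l).
by rewrite scalerA scale_mul cancel.
Qed.

Definition addat p (i : 'I_n.+1) (f : ffp) : ffp :=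
  [ffun j => if j == i then addp p (f j) else f j].

Lemma addat_inj p i : injective (addat p i).
Proof.
move=> f g /ffunP fg; apply/ffunP => j; have := fg j; rewrite !ffunE.
by case: ifP => // _ /addp_inj.
Qed.

Lemma addat_surj p i (f : ffp) : mult (f i) p.+1 != 0%N -> exists g, addat p i g = f.
Proof.
case/addp_surj => mu fE; exists [ffun j => if j == i then mu else f j].
by apply/ffunP => j; rewrite !ffunE; case: eqP => // ->.
Qed.

Definition Yprod (a b : ffp) : fps V R := \prod_i wY i (a i) (b i).
Definition Xprod (c e : ffp) : fps V R := \prod_i wX (ordS i) (c (ordS i)) (e i).

Definition pweight (lk : ffp * ffp) : fps V R :=
  u ^+ psize (lk.2 ord_max) *: (Yprod lk.1 lk.2 * Xprod lk.1 lk.2).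

(** In terms of operators, the cyclic sum is a trace of half vertex operators.
    Both [gweight] and [kweight] are the weights of the trace with a derivation
    [d / d p_(p+1)] inserted: [gweight] after the factor with values in
    [Yminus i], on the side of [k i], and [kweight] before it, on the side of
    [l i]. *)
Definition gweight i p (lk : ffp * ffp) : fps V R :=
  u ^+ psize (lk.2 ord_max) *: (Yprod lk.1 lk.2 *
    ((mult (lk.2 i) p.+1).+1%:R *: Xprod lk.1 (addat p i lk.2))).

Definition kweight i p (lk : ffp * ffp) : fps V R :=
  u ^+ psize (lk.2 ord_max) *: (((mult (lk.1 i) p.+1).+1%:R *:
    Yprod (addat p i lk.1) lk.2) * Xprod lk.1 lk.2).

Lemma Yprod_at i (a b l k : ffp) : (forall j, j != i -> a j = l j) ->
    (forall j, j != i -> b j = k j) ->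
  Yprod a b = wY i (a i) (b i) * \prod_(j | j != i) wY j (l j) (k j).
Proof.
move=> al bk; rewrite /Yprod (bigD1 i) //=; congr (_ * _).
by apply: eq_bigr => j ji; rewrite al ?bk.
Qed.

Lemma Xprod_at i (c e l k : ffp) : (forall j, j != ordS i -> c j = l j) ->
    (forall j, j != i -> e j = k j) ->
  Xprod c e = wX (ordS i) (c (ordS i)) (e i) *
    \prod_(j | j != i) wX (ordS j) (l (ordS j)) (k j).
Proof.
move=> cl ek; rewrite /Xprod (bigD1 i) //=; congr (_ * _).
apply: eq_bigr => j ji; rewrite cl ?ek //.
by rewrite (inj_eq (bij_inj (@ordS_bij n))).
Qed.

Lemma addat_id p i (f : ffp) : addat p i f i = addp p (f i).
Proof. by rewrite ffunE eqxx. Qed.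

Lemma addat_ne p i (f : ffp) j : j != i -> addat p i f j = f j.
Proof. by rewrite ffunE => /negbTE ->. Qed.

Lemma gweight_shift i p l k :
  gweight i p (addat p (ordS i) l, k) =
  u ^+ psize (k ord_max) *: (Yprod (addat p (ordS i) l) k *
    ((mult (l (ordS i)) p.+1).+1%:R *: Xprod l k)).
Proof.
rewrite /gweight /=; congr (_ *: (_ * _)).
have cl j : j != ordS i -> addat p (ordS i) l j = l j by apply: addat_ne.
have ek j : j != i -> addat p i k j = k j by apply: addat_ne.
rewrite (Xprod_at cl ek) (@Xprod_at i l k l k) // !addat_id.
by rewrite [LHS]scaleAl wX_diag -scaleAl.
Qed.

(** The derivation commutes with the skewing operator in the variables
    [Xplus (ordS i)]. *)
Lemma gweight_kweight i p l k :
  gweight i p (addat p (ordS i) l, k) = kweight (ordS i) p (l, k).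
Proof. by rewrite gweight_shift /kweight /=; congr (_ *: _); rewrite -scaleAr scaleAl. Qed.

Lemma gweight_support i p lk : gweight i p lk != 0 ->
  exists lk', (addat p (ordS i) lk'.1, lk'.2) = lk.
Proof.
case: lk => l k g0; have : mult (l (ordS i)) p.+1 != 0%N.
  apply: contraNneq g0 => l0.
  have X0 : Xprod l (addat p i k) = 0.
    rewrite /Xprod (bigD1 i) //= addat_id [wX _ _ _](_ : _ = 0) ?mul0r //.
    exact: pskew_0addp.
  by rewrite /gweight /= X0 scaler0 mulr0 scaler0.
by case/addat_surj => l' <-; exists (l', k).
Qed.

(** Crossing the factor in [Yminus i] produces a multiple of the weight itself,
    by [wY_commute]; crossing the degree operator [u ^+ psize (k ord_max)]
    produces a power of [u]. *)
Lemma kweight_shift i p l k :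
  kweight i p (l, addat p i k) - (cfac p *: pwY i p) * pweight (l, addat p i k) =
  u ^+ ((i == ord_max) * p.+1)%N *: gweight i p (l, k).
Proof.
rewrite /kweight /gweight /pweight /=.
have -> : psize (addat p i k ord_max) =
    ((i == ord_max) * p.+1 + psize (k ord_max))%N.
  by rewrite ffunE eq_sym; case: eqP => _; rewrite ?mul1n // psize_addp.
rewrite -scaleAr -scalerBr scalerA -exprD; congr (_ *: _).
have ll j : j != i -> l j = l j by [].
have kk j : j != i -> k j = k j by [].
have cl j : j != i -> addat p i l j = l j by apply: addat_ne.
have ek j : j != i -> addat p i k j = k j by apply: addat_ne.
rewrite (Yprod_at cl ek) (Yprod_at ll ek) (Yprod_at ll kk) !addat_id.
set r := \prod_(j | _) _; set x := Xprod _ _.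
have := wY_commute i p (l i) (k i); rewrite !scale_nat => e.
move: (cfac p *: _) e => y e.
transitivity (((mult (k i) p.+1).+1%:R * wY i (l i) (k i)) * (r * x)).
  by rewrite -e; ring.
by ring.
Qed.

Lemma kweight_support i p lk :
  kweight i p lk - (cfac p *: pwY i p) * pweight lk != 0 ->
  exists lk', (lk'.1, addat p i lk'.2) = lk.
Proof.
case: lk => l k h0; have : mult (k i) p.+1 != 0%N.
  apply: contraNneq h0 => k0; rewrite /kweight /pweight /=.
  rewrite -scaleAr -scalerBr.
  have cl j : j != i -> addat p i l j = l j by apply: addat_ne.
  rewrite (@Yprod_at i _ k l k cl) // (@Yprod_at i l k l k) // addat_id.
  set r := \prod_(j | _) _; set x := Xprod _ _.
  have := wY_commute0 i (l i) k0; rewrite !scale_nat => e.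
  rewrite mulrA e [X in X - _](_ : _ = cfac p *: pwY i p * (wY i (l i) (k i) * r * x)).
    by rewrite subrr scaler0.
  by rewrite !mulrA.
by case/addat_surj => k' <-; exists (l, k').
Qed.

(** The inserted derivation acts as the derivative of the weight with respect to
    the power sum of [Xplus (ordS i)], whose degree in the weight is the number
    of parts [p.+1] removed. *)
Lemma gweight_up i p lk : pwX (ordS i) p * gweight i p lk =
  (mult (lk.1 (ordS i)) p.+1 - mult (lk.2 i) p.+1)%:R *: pweight lk.
Proof.
case: lk => l k; rewrite /gweight /pweight /= -scaleAr [RHS]scalerA.
rewrite [X in _ = X *: _]mulrC -[RHS]scalerA.
congr (_ *: _).
have ll j : j != ordS i -> l j = l j by [].
have kk j : j != i -> k j = k j by [].
have ek j : j != i -> addat p i k j = k j by apply: addat_ne.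
rewrite (Xprod_at ll ek) (Xprod_at ll kk) addat_id.
set r := \prod_(j | _) _; set y := Yprod _ _.
have := wX_up (ordS i) p (l (ordS i)) (k i); rewrite !scale_nat => e.
transitivity (y * ((mult (l (ordS i)) p.+1 - mult (k i) p.+1)%:R *
    wX (ordS i) (l (ordS i)) (k i)) * r); last by ring.
by rewrite -e; ring.
Qed.

End Shift.

(** * The cyclic sum in the basis of power sums *)

Lemma uniform_bound (R : realDomainType) (I : finType) (T U : Type)
    (f : I -> T -> U -> R) (g : T -> U -> R) : (forall x y, 0 <= g x y) ->
    (forall i, exists C, forall x y, f i x y <= C * g x y) ->
  exists C, forall i x y, f i x y <= C * g x y.
Proof.
move=> g0 /choice[C CP]; exists (\sum_i `|C i|) => i x y.
apply: le_trans (CP i x y) _; rewrite ler_wpM2r // (bigD1 i) //=.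
by rewrite (le_trans (ler_norm _)) // lerDl sumr_ge0.
Qed.

(** For a family of norm [N] and its dual family the quotients of square roots
    of norms appear with opposite exponents, as [cyclic_summable] requires. *)
Lemma dual_cyclic_summable (R : realType) (V : choiceType) (m : {cmonom V})
    (n : nat) (u : R) (N : intpart -> R)
    (bY bX : 'I_n.+1 -> intpart -> intpart -> fps V R) :
    0 < u < 1 -> (forall l, 0 < N l) ->
    (forall i l k, divnorm m (bY i l k) != 0 ->
       (psize k <= psize l <= psize k + mdeg m)%N) ->
    (forall i l k, divnorm m (bX i l k) != 0 ->
       (psize k <= psize l <= psize k + mdeg m)%N) ->
    (forall i (r : R), 0 < r < 1 -> exists C : R, forall l k,
       divnorm m (bY i l k) * r ^+ psize k <= C * (Num.sqrt (N l) / Num.sqrt (N k))) ->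
    (forall i (r : R), 0 < r < 1 -> exists C : R, forall l k,
       divnorm m (bX i l k) * r ^+ psize k <= C * (Num.sqrt (N l) / Num.sqrt (N k))) ->
  abs_summable (fun lk =>
    cyclic_weight u (fun i l k => (N k / N l) *: bY i l k) bX lk m).
Proof.
move=> u01 N0 Ys Xs Yb Xb.
have s0 l : 0 < Num.sqrt (N l) by rewrite sqrtr_gt0.
apply: (@cyclic_summable _ _ m n (mdeg m) u u01 (fun l => Num.sqrt (N l))) => //.
- move=> i l k; rewrite divnormZ mulf_eq0 negb_or => /andP[_]; exact: Ys.
- move=> r r01; apply: (@uniform_bound _ _ _ _
    (fun i l k => divnorm m ((N k / N l) *: bY i l k) * r ^+ psize k)
    (fun l k => Num.sqrt (N k) / Num.sqrt (N l))) => [l k|i].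
    by rewrite divr_ge0 // ltW.
  have [C CP] := Yb i r r01; exists C => l k.
  rewrite divnormZ ger0_norm ?divr_ge0 ?(ltW (N0 _)) // -mulrA.
  apply: le_trans (ler_wpM2l _ (CP l k)) _; first by rewrite divr_ge0 ?(ltW (N0 _)).
  rewrite -{1}(sqr_sqrtr (ltW (N0 k))) -{1}(sqr_sqrtr (ltW (N0 l))).
  have frac (a b c : R) : 0 < a -> 0 < b ->
      a ^+ 2 / b ^+ 2 * (c * (b / a)) = c * (a / b).
    by move=> a0 b0; field; rewrite !gt_eqF.
  by rewrite frac.
- move=> r r01; apply: (@uniform_bound _ _ _ _
    (fun i l k => divnorm m (bX i l k) * r ^+ psize k)
    (fun l k => Num.sqrt (N l) / Num.sqrt (N k))) => [l k|i].
    by rewrite divr_ge0 // ltW.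
  exact: Xb.
Qed.

Section Positive.
Context (R : realType) (V : choiceType).
Implicit Types f g : fps V R.

(** The weights in the basis of power sums have nonnegative coefficients; this
    is used to dominate [gweight] by a multiple of [pweight]. *)
Definition fps_ge0 f := forall a, 0 <= f a.

Lemma fps_ge0M f g : fps_ge0 f -> fps_ge0 g -> fps_ge0 (f * g).
Proof.
move=> f0 g0 a; rewrite fcoefME; apply: sumr_ge0 => b _; apply: sumr_ge0 => c _.
by rewrite !mulr_ge0.
Qed.

Lemma fps_ge01 : fps_ge0 1.
Proof. by move=> a; rewrite fcoef1. Qed.

Lemma fps_ge0_prod (I : Type) (r : seq I) (P : pred I) (F : I -> fps V R) :
  (forall i, P i -> fps_ge0 (F i)) -> fps_ge0 (\prod_(i <- r | P i) F i).
Proof.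
move=> F0; elim/big_rec: _ => [|i x Pi x0]; first exact: fps_ge01.
by apply: fps_ge0M => //; apply: F0.
Qed.

Lemma fps_ge0Z c f : 0 <= c -> fps_ge0 f -> fps_ge0 (c *: f).
Proof. by move=> c0 f0 a; rewrite fcoefZ mulr_ge0. Qed.

Lemma fps_ge0_pskew (x : nat -> fps V R) l k : (forall n, fps_ge0 (x n)) ->
  fps_ge0 (pskew x l k).
Proof.
move=> x0; apply: fps_ge0_prod => i _; rewrite /binx mulr_natl -scaler_nat.
apply: fps_ge0Z => //; elim: (_ - _)%N => [|j IH]; first by rewrite expr0; apply: fps_ge01.
by rewrite exprS; apply: fps_ge0M.
Qed.

Lemma fps_ge0_pw (X : nat -> V) p : injective X -> fps_ge0 (pw R X p).
Proof. by move=> X_inj a; rewrite pwE. Qed.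

End Positive.

Lemma Xplus_inj n (i : 'I_n) : injective (Xplus i).
Proof. by move=> a b [].  Qed.

Lemma Yminus_inj n (i : 'I_n) : injective (Yminus i).
Proof. by move=> a b [].  Qed.

Section PSum.
Context (R : realType) (n : nat) (q t u : R).
Hypotheses (q01 : 0 < q < 1) (t01 : 0 < t < 1) (u01 : 0 < u < 1).
Local Notation V := (alphabets n.+1).
Local Notation z := (macdonald_norm q t).
Local Notation ffp := {ffun 'I_n.+1 -> intpart}.
Local Notation pW := (@pweight R n q t u).
Local Notation gW := (@gweight R n q t u).
Local Notation kW := (@kweight R n q t u).
Let z_gt0 lam : 0 < z lam := macdonald_norm_gt0 q01 t01 lam.

Lemma pweightE lk : pW lk = cyclic_weight u
  (fun i l k => (z k / z l) *: pskew (pw R (Yminus i)) l k)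
  (fun i l k => pskew (pw R (Xplus i)) l k) (lk : ffp * ffp).
Proof. by rewrite /cyclic_weight big_split. Qed.

Lemma pweight_summable m : abs_summable (fun lk => pW lk m).
Proof.
have [C CP] := @dual_cyclic_summable R V m n u z
  (fun i => pskew (pw R (Yminus i))) (fun i => pskew (pw R (Xplus i))) u01 z_gt0
  (fun i => pskew_sizes (@Yminus_inj _ i)) (fun i => pskew_sizes (@Xplus_inj _ i))
  (fun i => pskew_bound m (@Yminus_inj _ i) q01 t01)
  (fun i => pskew_bound m (@Xplus_inj _ i) q01 t01).
by exists C => B; under eq_bigr do rewrite pweightE.
Qed.

Lemma wX_ge0 i l k : fps_ge0 (wX R i l k : fps V R).
Proof. by apply: fps_ge0_pskew => p; apply/fps_ge0_pw/Xplus_inj. Qed.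

Lemma wY_ge0 i l k : fps_ge0 (wY q t i l k : fps V R).
Proof.
apply: fps_ge0Z; first by rewrite divr_ge0 // ltW.
by apply: fps_ge0_pskew => p; apply/fps_ge0_pw/Yminus_inj.
Qed.

Lemma gweight_ge0 i p lk : fps_ge0 (gW i p lk).
Proof.
have u0 : 0 <= u by case/andP: u01 => /ltW.
apply: fps_ge0Z; first by rewrite exprn_ge0.
apply: fps_ge0M; first by apply: fps_ge0_prod => j _; apply: wY_ge0.
by apply: fps_ge0Z => //; apply: fps_ge0_prod => j _; apply: wX_ge0.
Qed.

Lemma pweight_sizes lk m : pW lk m != 0 -> forall i,
  [/\ (psize (lk.2 i) <= psize (lk.1 i))%N,
      (psize (lk.2 i) <= psize (lk.1 (ordS i)))%N &
      (psize (lk.1 (ordS i)) - psize (lk.2 i) <= mdeg m)%N].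
Proof.
move=> W0 i.
have : divnorm m (pW lk) != 0.
  by apply: contraNneq W0 => d0; rewrite -normr_eq0 eq_le normr_ge0 andbT -d0 coef_le_divnorm1.
move=> {}W0; have [Y0 X0] : divnorm m (wY q t i (lk.1 i) (lk.2 i)) != 0 /\
    divnorm m (wX R (ordS i) (lk.1 (ordS i)) (lk.2 i)) != 0.
  have fac f g : divnorm m (f * g) != 0 -> divnorm m f != 0 /\ divnorm m g != 0.
    move=> fg; split; apply: contraNneq fg => e; rewrite eq_le divnorm_ge0 andbT.
      by apply: le_trans (divnormM _ _ _) _; rewrite e mul0r.
    by apply: le_trans (divnormM _ _ _) _; rewrite e mulr0.
  move: W0; rewrite /pweight divnormZ mulf_eq0 negb_or => /andP[_ /fac[]].
  rewrite /Yprod /Xprod (bigD1 i) //= => /fac[Yi _].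
  by rewrite (bigD1 i) //= => /fac[Xi _].
have /andP[h1 h2] := pskew_sizes (@Xplus_inj _ _) X0.
have h3 : (psize (lk.2 i) <= psize (lk.1 i))%N.
  move: Y0; rewrite divnormZ mulf_eq0 negb_or => /andP[_ Y0].
  by have /andP[] := pskew_sizes (@Yminus_inj _ _) Y0.
by split=> //; rewrite leq_subLR.
Qed.

(** Multiplying by a monomial of the power sum embeds the coefficients of
    [gweight] into those of its product with the power sum, which is a bounded
    multiple of the weight by [gweight_up]. *)
Lemma gweight_summable i p m : abs_summable (fun lk => gW i p lk m).
Proof.
pose e : {cmonom V} := expcmn (ucm (Xplus (ordS i) 0%N)) p.+1.
apply: (@abs_summable_le _ _ (mdeg (mmul e m))%:R _ _
  (pweight_summable (mmul e m))) => // lk.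
have := gweight_up q t u i p lk => up.
have : gW i p lk m <= (pwX R (ordS i) p * gW i p lk) (mmul e m).
  have em : m \in cmdivs (mmul e m) by apply: (@mem_cmdivs _ _ _ e); rewrite mulmC.
  have px : pwX R (ordS i) p e = 1.
    rewrite /pwX pwE; last exact: Xplus_inj.
    by rewrite asboolT //; exists 0%N.
  have x0 : fps_ge0 (pwX R (ordS i) p : fps V R) by apply/fps_ge0_pw/Xplus_inj.
  have := @gweight_ge0 i p lk.
  move: (pwX R (ordS i) p) (gW i p lk) px x0 => f g px f0 g0.
  rewrite fcoefME (big_fsetD1 e) ?(mem_cmdivs (erefl (mmul e m))) //=.
  rewrite (big_fsetD1 m em) /= eqxx px !mul1r -addrA lerDl addr_ge0 //.
    by apply: sumr_ge0 => a _; rewrite mulr_ge0 // mulr_ge0.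
  by apply: sumr_ge0 => a _; apply: sumr_ge0 => b _; rewrite mulr_ge0 // mulr_ge0.
rewrite up fcoefZ ger0_norm ?gweight_ge0 // => /le_trans; apply.
have [->|W0] := eqVneq (pW lk (mmul e m)) 0; first by rewrite mulr0 normr0 mulr0.
apply: (@le_trans _ _ ((mult (lk.1 (ordS i)) p.+1 - mult (lk.2 i) p.+1)%:R *
   `|pW lk (mmul e m)|)); first by rewrite ler_wpM2l // ler_norm.
rewrite ler_wpM2r // ler_nat.
have [_ h1 h2] := pweight_sizes W0 i; apply: leq_trans h2.
have kl : forall j, (mult (lk.2 i) j.+1 <= mult (lk.1 (ordS i)) j.+1)%N.
  apply: (@pskew_neq0 _ (pw R (Xplus (ordS i)))); apply: contraNneq W0 => X0.
  have XP0 : Xprod R lk.1 lk.2 = 0.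
    by rewrite /Xprod (bigD1 i) //= [wX _ _ _ _](X0 : _ = 0) mul0r.
  by rewrite /pweight XP0 mulr0 scaler0.
set l := lk.1 (ordS i); set k := lk.2 i.
have l0 j : (psize l + p.+1 <= j)%N -> mult l j.+1 = 0%N.
  by move=> lj; rewrite mult_psize // (leq_trans _ lj) // leq_addr.
have := skew_degree_le l0 kl.
have pM : (p < psize l + p.+1)%N by rewrite addnS ltnS leq_addl.
rewrite (bigD1 (Ordinal pM)) //= => h.
by rewrite leq_subRL // addnC; apply: leq_trans h; rewrite -addnA leq_add2l leq_addl.
Qed.

End PSum.

Lemma abs_fps_has_sum (R : realType) (V I : choiceType) (F : I -> fps V R) :
  (forall m, abs_summable (fun i => F i m)) -> exists S, fps_has_sum F S.
Proof.
move=> FS; have /choice[S SP] : forall m, exists S, has_sum (fun i => F i m) S.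
  by move=> m; apply: abs_has_sum.
by exists (Fps S).
Qed.

Section PSumEuler.
Context (R : realType) (n : nat) (q t u : R).
Hypotheses (q01 : 0 < q < 1) (t01 : 0 < t < 1) (u01 : 0 < u < 1).
Local Notation V := (alphabets n.+1).
Local Notation z := (macdonald_norm q t).
Local Notation ffp := {ffun 'I_n.+1 -> intpart}.
Local Notation pW := (@pweight R n q t u).
Local Notation gW := (@gweight R n q t u).
Local Notation kW := (@kweight R n q t u).
Local Notation cf := (cfac q t).
Let z_gt0 lam : 0 < z lam := macdonald_norm_gt0 q01 t01 lam.

Context (Z : fps V R).
Hypothesis ZE : fps_has_sum pW Z.

(** Summing the two shifts over all configurations gives a relation between the
    sums of [kweight] at consecutive places of the cycle. *)
Lemma kweight_sums : exists K : 'I_n.+1 -> nat -> fps V R,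
  (forall i p, fps_has_sum (gW i p) (K (ordS i) p)) /\
  (forall i p, K i p - (cf p *: pwY R i p) * Z =
     u ^+ ((i == ord_max) * p.+1)%N *: K (ordS i) p).
Proof.
have /choice[G GP] : forall ip : 'I_n.+1 * nat, exists G, fps_has_sum (gW ip.1 ip.2) G.
  by move=> [i p]; apply: abs_fps_has_sum => m; apply: gweight_summable.
exists (fun i p => G (ord_pred i, p)); split=> i p.
  by rewrite ordSK; apply: (GP (i, p)).
have kS : fps_has_sum (kW i p) (G (ord_pred i, p)).
  pose f (lk : ffp * ffp) := (addat p i lk.1, lk.2).
  have f_inj : injective f by move=> [l k] [l' k'] [/addat_inj -> ->].
  have gf := GP (ord_pred i, p).
  have fE lk : gW (ord_pred i) p (f lk) = kW i p lk.
    case: lk => l k; have := gweight_kweight q t u (ord_pred i) p l k.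
    by rewrite ord_predK.
  apply: (eq_fps_has_sum fE); apply: (fps_has_sum_reindex f_inj _ gf) => lk.
  by move/gweight_support => [lk' <-]; exists lk'; rewrite /f ord_predK.
have hS := fps_has_sumD kS (fps_has_sumM (G := - (cf p *: pwY R i p)) ZE).
pose f (lk : ffp * ffp) := (lk.1, addat p i lk.2).
have f_inj : injective f by move=> [l k] [l' k'] [-> /addat_inj ->].
have fE lk : kW i p (f lk) + - (cf p *: pwY R i p) * pW (f lk) =
    u ^+ ((i == ord_max) * p.+1)%N *: gW i p lk.
  by case: lk => l k; rewrite mulNr kweight_shift.
rewrite ordSK; apply: (@fps_has_sum_unique _ _ _ (fun lk =>
  u ^+ ((i == ord_max) * p.+1)%N *: gW i p lk)); last first.
  by apply: fps_has_sumZ; apply: (GP (i, p)).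
rewrite -mulNr; apply: (eq_fps_has_sum fE).
apply: (fps_has_sum_reindex f_inj _ hS) => lk.
by rewrite mulNr => /kweight_support[] // lk' <-; exists lk'.
Qed.

Definition one_sub p : R := 1 - u ^+ p.+1.

(** Going once around the cycle gives back the same sum multiplied by
    [u ^+ p.+1], and this determines it. *)
Lemma kweight_solve (K : 'I_n.+1 -> nat -> fps V R) p :
    (forall i, K i p - (cf p *: pwY R i p) * Z =
      u ^+ ((i == ord_max) * p.+1)%N *: K (ordS i) p) ->
  forall i : 'I_n.+1, K i p = cf p *:
    ((one_sub p)^-1 *: (\sum_j pwY R j p) - \sum_(j < n.+1 | (j < i)%N) pwY R j p) * Z.
Proof.
move=> KE.
have low j : (j <= n)%N -> K (inord j) p = K ord0 p -
    (cf p *: \sum_(i < n.+1 | (i < j)%N) pwY R i p) * Z.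
  elim: j => [|j IH] jn.
    rewrite big_pred0 // scaler0 mul0r subr0; congr (K _ _); apply: val_inj.
    by rewrite /= inordK.
  have jn' : (j < n.+1)%N by rewrite ltnS ltnW.
  have jE : inord j = Ordinal jn' by apply: val_inj; rewrite /= inordK.
  have := KE (inord j); rewrite jE -val_eqE /= (ltn_eqF jn) mul0n expr0 scale1r.
  rewrite (@ordS_lt _ _ (inord j.+1)) ?inordK // => <-.
  rewrite -[in LHS]jE IH 1?ltnW // jE.
  have -> : \sum_(i < n.+1 | (i < j.+1)%N) pwY R i p =
      \sum_(i < n.+1 | (i < j)%N) pwY R i p + pwY R (Ordinal jn') p.
    rewrite (bigD1 (Ordinal jn')) //= addrC; congr (_ + _).
    apply: eq_bigl => i; rewrite ltnS leq_eqVlt -val_eqE /=.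
    by case: (ltngtP i j).
  by rewrite scalerDr mulrDl opprD addrA.
have a1 : one_sub p != 0 by rewrite gt_eqF // onesub_gt0.
have K0 : K ord0 p = (cf p *: ((one_sub p)^-1 *: \sum_j pwY R j p)) * Z.
  have := KE ord_max; rewrite eqxx mul1n.
  have -> : ordS ord_max = ord0 :> 'I_n.+1 by apply: val_inj; rewrite /= modnn.
  have maxE : ord_max = inord n :> 'I_n.+1 by apply: val_inj; rewrite /= inordK.
  have -> : \sum_j pwY R j p = \sum_(i < n.+1 | (i < n)%N) pwY R i p + pwY R ord_max p.
    rewrite (bigD1 ord_max) //= addrC; congr (_ + _).
    by apply: eq_bigl => i; rewrite -val_eqE /= ltn_neqAle -ltnS ltn_ord andbT.
  rewrite {1}maxE low //.
  move: (\sum_(i < _ | _) _) (pwY R ord_max p) => Y y h.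
  have e : one_sub p *: K ord0 p = (cf p *: (Y + y)) * Z.
    by rewrite /one_sub scalerBl scale1r -h scalerDr mulrDl -addrA -opprD subKr.
  rewrite -[LHS](scalerK a1) e scaleAl scalerA.
  by rewrite [X in X *: _]mulrC -scalerA.
move=> i; have := low i; rewrite -ltnS ltn_ord => /(_ isT).
rewrite inord_val => ->; rewrite K0.
by rewrite scalerBr mulrBl.
Qed.

Lemma homog_pskew (x : nat -> fps V R) l k : (forall p, homog p.+1 (x p.+1)) ->
  homog (psize l - psize k)%N (pskew x l k).
Proof.
by move=> hx m; apply: contraNeq => /(pskew_homog hx) <-; rewrite addKn.
Qed.

Lemma homog_pweight (lk : ffp * ffp) : homog
  (\sum_(i < n.+1) (psize (lk.1 i) - psize (lk.2 i)) +
   \sum_(i < n.+1) (psize (lk.1 (ordS i)) - psize (lk.2 i)))%N (pW lk).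
Proof.
apply: homogZ; apply: homogM; apply: homog_prod => i.
  apply: homogZ; apply: homog_pskew => p; exact/homog_pw/Yminus_inj.
by apply: homog_pskew => p; apply/homog_pw/Xplus_inj.
Qed.

Lemma psize_sub l k d : (forall j, (mult k j.+1 <= mult l j.+1)%N) ->
    (psize l - psize k <= d)%N ->
  (\sum_(p < d) p.+1 * (mult l p.+1 - mult k p.+1) = psize l - psize k)%N.
Proof.
move=> kl ld; pose M := maxn (psize l) d.
have l0 j : (M <= j)%N -> mult l j.+1 = 0%N.
  by rewrite geq_max => /andP[/mult_psize].
have k0 j : (M <= j)%N -> mult k j.+1 = 0%N.
  by move=> /l0 lj; apply/eqP; rewrite -leqn0 -lj.
pose F p := (p.+1 * (mult l p.+1 - mult k p.+1))%N.
have FM : (\sum_(p < M) F p = psize l - psize k)%N.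
  rewrite (psizeE l0) (psizeE k0) -sumnB => [|i _]; last by rewrite leq_mul2r kl orbT.
  by apply: eq_bigr => i _; rewrite /F mulnC mulnBl.
rewrite -FM -/(F _) (big_ord_widen _ F (leq_maxr (psize l) d)) big_mkcond.
apply: eq_bigr => i _; case: ltnP => // di; apply/eqP; rewrite eq_sym.
have FiM : (F i <= psize l - psize k)%N by rewrite -FM (bigD1 i) //= leq_addr.
have : (F i < i.+1)%N by rewrite ltnS (leq_trans FiM) // (leq_trans ld).
by rewrite /F; case: (_ - _)%N => [|a]; rewrite ?muln0 // mulnS ltnNge leq_addr.
Qed.

Lemma pweight_mult (lk : ffp * ffp) m : pW lk m != 0 ->
  forall i j, (mult (lk.2 i) j.+1 <= mult (lk.1 (ordS i)) j.+1)%N.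
Proof.
move=> W0 i; apply: (@pskew_neq0 _ (pw R (Xplus (ordS i)))).
apply: contraNneq W0 => X0.
have XP0 : Xprod R lk.1 lk.2 = 0.
  by rewrite /Xprod (bigD1 i) //= [wX _ _ _ _](X0 : _ = 0) mul0r.
by rewrite /pweight XP0 mulr0 scaler0.
Qed.

Lemma pweight_degree (lk : ffp * ffp) m : pW lk m != 0 ->
  mdeg m = (2 * \sum_(i < n.+1) (psize (lk.1 (ordS i)) - psize (lk.2 i)))%N.
Proof.
move=> W0; have sz := pweight_sizes W0.
have -> : mdeg m = (\sum_(i < n.+1) (psize (lk.1 i) - psize (lk.2 i)) +
   \sum_(i < n.+1) (psize (lk.1 (ordS i)) - psize (lk.2 i)))%N.
  by apply/eqP; apply: contraNT W0 => /homog_pweight ->.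
rewrite mul2n -addnn; congr (_ + _)%N.
rewrite !sumnB; first last.
- by move=> i _; case: (sz i).
- by move=> i _; case: (sz i).
by congr (_ - _)%N; rewrite (reindex_inj (bij_inj (ordS_bij n))).
Qed.

(** In a monomial of a weight the variables [Xplus] and [Yminus] have the same
    total degree, the number of boxes removed around the cycle, and this number
    is counted part by part by [gweight_up]. *)
Lemma euler_coef_psum m : (mdeg m)%:R * Z m =
  \sum_(i < n.+1) \sum_(p < mdeg m)
    (2 * p.+1%:R * cf p) * ((pwX R i p *
    (((one_sub p)^-1 *: (\sum_j pwY R j p) -
      \sum_(j < n.+1 | (j < i)%N) pwY R j p))) * Z) m.
Proof.
have [K [gK KE]] := kweight_sums.
have KS p := kweight_solve (fun i => KE i p).
rewrite (reindex_inj (bij_inj (ordS_bij n))).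
apply: (@has_sum_unique _ _ (fun lk => (mdeg m)%:R * pW lk m)).
  by apply: has_sumZ; apply: ZE.
apply: (@eq_has_sum _ _ (fun lk => \sum_(i < n.+1) \sum_(p < mdeg m)
   (2 * p.+1%:R) * (pwX R (ordS i) p * gW i p lk) m)) => [lk|].
  have [W0|W0] := eqVneq (pW lk m) 0.
    rewrite W0 mulr0 big1 // => i _; rewrite big1 // => p _.
    by rewrite gweight_up fcoefZ W0 !mulr0.
  rewrite [X in _ = X%:R * _](pweight_degree W0) natrM natr_sum mulr_sumr mulr_suml.
  apply: eq_bigr => i _; have [_ _ h] := pweight_sizes W0 i.
  rewrite -(psize_sub (pweight_mult W0 i) h) natr_sum mulr_sumr mulr_suml.
  apply: eq_bigr => p _; rewrite gweight_up fcoefZ natrM.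
  by rewrite !mulrA.
apply: has_sum_big => i _; apply: has_sum_big => p _.
have regroup (c d : R) (x T : fps V R) :
    c *: (x * ((d *: T) * Z)) = (c * d) *: ((x * T) * Z).
  by rewrite -scaleAl -scaleAr scalerA mulrA.
set T := (X in pwX R (ordS i) p * X).
have KT : K (ordS i) p = (cf p *: T) * Z by apply: KS.
have h := fps_has_sumZ (c := 2 * p.+1%:R)
  (fps_has_sumM (G := pwX R (ordS i) p) (gK i p)).
by move: (h m); rewrite KT (regroup (2 * p.+1%:R) (cf p) (pwX R (ordS i) p) T) fcoefZ.
Qed.

Lemma fcoef1_nat k : (k%:R : fps V R) mone = k%:R.
Proof.
elim: k => [|k IH]; first by [].
by rewrite -[k.+1%:R in LHS]natr1 fcoefD IH fcoef1 eqxx natr1.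
Qed.

Lemma wX1 i l k : (wX R i l k : fps V R) mone = (l == k)%:R.
Proof.
rewrite -(@pskew_delta _ (fun p => pw R (Xplus i) p mone)) => [|p].
  apply: (pskew_morph (phi := fun f : fps V R => f mone)) => //.
    exact: fcoefM1.
  exact: fcoef1_nat.
by rewrite (homog_pw _ (@Xplus_inj _ i)) // mdeg1.
Qed.

Lemma wY1 i l k : (wY q t i l k : fps V R) mone = (l == k)%:R.
Proof.
rewrite fcoefZ [X in _ * X](_ : _ = (l == k)%:R).
  case: eqP => [->|_]; last by rewrite mulr0.
  by rewrite divff ?mulr1 // gt_eqF.
rewrite -(@pskew_delta _ (fun p => pw R (Yminus i) p mone)) => [|p].
  apply: (pskew_morph (phi := fun f : fps V R => f mone)) => //.
    exact: fcoefM1.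
  exact: fcoef1_nat.
by rewrite (homog_pw _ (@Yminus_inj _ i)) // mdeg1.
Qed.

Lemma pweight1 (lk : ffp * ffp) : pW lk mone =
  u ^+ psize (lk.2 ord_max) * (\prod_i ((lk.1 i == lk.2 i)%:R *
    (lk.1 (ordS i) == lk.2 i)%:R)).
Proof.
rewrite fcoefZ fcoefM1 !fcoef_prod1 (eq_bigr _ (fun i _ => wY1 i _ _)).
by rewrite [X in _ * (_ * X)](eq_bigr _ (fun i _ => wX1 _ _ _)) -big_split.
Qed.

(** Only constant configurations contribute to the constant term. *)
Lemma psum1 : has_sum (fun l : intpart => u ^+ psize l) (Z mone).
Proof.
pose f (l : intpart) : ffp * ffp := ([ffun=> l], [ffun=> l]).
have f_inj : injective f.
  by move=> l k [/ffunP/(_ ord0)]; rewrite !ffunE.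
have := has_sum_reindex f_inj _ (@ZE mone).
have fE : (fun lk => pW lk mone) \o f = fun l => u ^+ psize l.
  apply/funext => l; rewrite /comp pweight1 /f /= big1 ?mulr1 => [|i _].
    by rewrite ffunE.
  by rewrite !ffunE !eqxx mulr1.
rewrite fE; apply=> -[l k]; rewrite pweight1 mulf_eq0 negb_or => /andP[_ /prodf_neq0 lk].
have lki i : l i = k i /\ l (ordS i) = k i.
  have := lk i isT; rewrite mulf_eq0 negb_or !pnatr_eq0 !eqb0 !negbK.
  by case/andP => /eqP -> /eqP ->.
have step i : l (ordS i) = l i by have [-> ->] := lki i.
have l0 j : (j <= n)%N -> l (inord j) = l ord0.
  elim: j => [|j IH] jn; first by congr (l _); apply: val_inj; rewrite /= inordK.
  rewrite -IH 1?ltnW // -(step (inord j)); congr (l _).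
  by apply/esym/ordS_lt; rewrite !inordK // ltnS ltnW.
have lE i : l i = l ord0 by rewrite -(l0 i) ?inord_val // -ltnS.
exists (l ord0); congr (_, _); apply/ffunP => i; rewrite ffunE.
  by rewrite (lE i).
by have [<- _] := lki i; rewrite (lE i).
Qed.

End PSumEuler.

(** * Coefficientwise limits and the Euler derivation *)

Section FpsLimit.
Context (R : realType) (V : choiceType).
Implicit Types (F G S : nat -> fps V R) (a f g : fps V R).

Definition cvg_coef F f := forall m, (fun k => F k m) @ \oo --> f m.

Lemma cvg_sum_seq (I : Type) (r : seq I) (P : pred I) (f : I -> nat -> R) (l : I -> R) :
  (forall i, P i -> f i @ \oo --> l i) ->
  (fun k => \sum_(i <- r | P i) f i k) @ \oo --> \sum_(i <- r | P i) l i.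
Proof.
move=> fl; elim: r => [|i r IH].
  by rewrite big_nil; under eq_fun do rewrite big_nil; apply: cvg_cst.
rewrite big_cons; under eq_fun do rewrite big_cons.
by case: ifP => Pi //; apply: cvgD => //; apply: fl.
Qed.

Lemma cvg_coefM F G f g : cvg_coef F f -> cvg_coef G g ->
  cvg_coef (fun k => F k * G k) (f * g).
Proof.
move=> Ff Gg m; rewrite fcoefME; under eq_fun do rewrite fcoefME.
apply: cvg_sum_seq => a _; apply: cvg_sum_seq => b _.
by apply: cvgMr; apply: cvgM; [apply: Ff|apply: Gg].
Qed.

Lemma cvg_coefZ c F f : cvg_coef F f -> cvg_coef (fun k => c *: F k) (c *: f).
Proof.
move=> Ff m; rewrite fcoefZ; under eq_fun do rewrite fcoefZ.
by apply: cvgMr; apply: Ff.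
Qed.

Lemma cvg_coef_lim F f : cvg_coef F f -> fps_lim F = f.
Proof. by move=> Ff; apply: fpsP => m; apply: cvg_lim; [|apply: Ff]. Qed.

(** Convergence of the logarithmic derivatives forces convergence of the
    series themselves, by recursion on the degree of the coefficient. *)
Lemma fps_lim_euler F S f :
    (forall k, euler (F k) = S k * F k) -> (forall k, F k mone = 1) ->
    (forall k, S k mone = 0) -> cvg_coef S f ->
  [/\ cvg_coef F (fps_lim F), euler (fps_lim F) = f * fps_lim F
    & fps_lim F mone = 1].
Proof.
move=> FS F1 S1 Sf.
have cF m : cvgn (fun k => F k m).
  have [d md] := ubnP (mdeg m); elim: d m md => // d IH m md.
  have [->|m1] := eqVneq m mone.
    by under eq_fun do rewrite F1; apply: is_cvg_cst.
  have m0 : (mdeg m)%:R != 0 :> R by rewrite pnatr_eq0 mdeg_eq0.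
  have FE k : F k m = (mdeg m)%:R^-1 * \sum_(a <- cmdivs m) \sum_(b <- cmdivs m)
      (mmul a b == m)%:R * (S k a * F k b).
    by rewrite -fcoefME -FS [X in _ = _ * X](_ : _ = (mdeg m)%:R * F k m) ?mulKf.
  have [l ab] : exists l : {cmonom V} -> {cmonom V} -> R, forall a b : {cmonom V},
      (fun k => (mmul a b == m)%:R * (S k a * F k b)) @ \oo --> l a b.
    have : forall ab : {cmonom V} * {cmonom V}, exists l : R,
        (fun k => (mmul ab.1 ab.2 == m)%:R * (S k ab.1 * F k ab.2)) @ \oo --> l.
      move=> [a b] /=; have [abm|_] := eqVneq (mmul a b) m; last first.
        by exists 0; under eq_fun do rewrite mul0r; apply: cvg_cst.
      have [a1|a1] := eqVneq a mone.
        exists 0; have -> : (fun k => true%:R * (S k a * F k b)) = fun=> 0.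
          by apply/funext => k; rewrite a1 S1 mul0r mulr0.
        exact: cvg_cst.
      have bd : (mdeg b < d)%N.
        have a0 : (0 < mdeg a)%N by rewrite lt0n mdeg_eq0.
        by move: md a0; rewrite -abm mdegM; clear; lia.
      have /cvg_ex[lb Fb] := IH b bd.
      exists (1 * (f a * lb)); apply: cvgMr; apply: cvgM => //; exact: Sf.
    by move=> /choice[l lP]; exists (fun a b : {cmonom V} => l (a, b)) => a b; apply: (lP (a, b)).
  apply/cvg_ex; exists ((mdeg m)%:R^-1 * \sum_(a <- cmdivs m) \sum_(b <- cmdivs m) l a b).
  under eq_fun do rewrite FE.
  by apply: cvgMr; apply: cvg_sum_seq => a _; apply: cvg_sum_seq => b _.
have FL : cvg_coef F (fps_lim F) by move=> m; apply: cF.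
split=> //.
  apply: fpsP => m; have h := cvg_coefM Sf FL (m := m).
  have h1 : (fun k => (S k * F k) m) @ \oo --> (mdeg m)%:R * fps_lim F m.
    have -> : (fun k => (S k * F k) m) = (fun k => (mdeg m)%:R * F k m).
      by apply/funext => k; rewrite -FS.
    by apply: cvgMr; apply: FL.
  by rewrite -[LHS](cvg_lim (@Rhausdorff R) h1) (cvg_lim (@Rhausdorff R) h).
have := FL mone; under eq_fun do rewrite F1.
by move=> /(cvg_lim (@Rhausdorff R)) <-; apply: lim_cst.
Qed.

(** ** Power series in a homogeneous element *)

(** The series [\sum_p s p * a ^+ p.+1]; when [a] has no constant term, only
    the terms with [p < mdeg m] contribute to the coefficient of [m]. *)
Definition gser (s : nat -> R) a : fps V R :=
  Fps (fun m => \sum_(p < mdeg m) s p * (a ^+ p.+1) m).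

Lemma gserE s a d m : a mone = 0 -> (mdeg m <= d)%N ->
  gser s a m = (\sum_(p < d) s p *: a ^+ p.+1) m.
Proof.
move=> a1 md; rewrite /gser /= fcoef_sum.
rewrite (big_ord_widen _ (fun p => s p * (a ^+ p.+1) m) md) big_mkcond.
apply: eq_bigr => p _; case: ltnP => // mp.
by rewrite fcoefZ homogX_lt ?mulr0 // ltnS.
Qed.

Lemma gser1 s a : gser s a mone = 0.
Proof. by rewrite /gser /= mdeg1 big_ord0. Qed.

Lemma gser_geometric c a : a mone = 0 ->
  gser (fun p => c ^+ p.+1) a * (1 - c *: a) = c *: a.
Proof.
move=> a1; apply: fpsP => m; pose d := mdeg m; pose w := c *: a.
have w1 : w mone = 0 by rewrite fcoefZ a1 mulr0.
rewrite (@eq_fcoefM _ _ _ _ (w * \sum_(p < d) w ^+ p) (- (w - 1))) => [|x y xy].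
  rewrite mulrN -mulrA [_ * (w - 1)]mulrC -subrX1 -mulrN opprB mulrBr mulr1 -exprS.
  by rewrite fcoefB [X in _ - X]homogX_lt ?subr0.
rewrite opprB (@gserE _ _ d) //; last by rewrite /d -xy mdegM leq_addr.
congr (fcoef _ x * _); rewrite mulr_sumr; apply: eq_bigr => p _.
by rewrite -exprS /w exprZn.
Qed.

Lemma euler_1sub c a : homog 2 a ->
  euler (1 - c *: a) = (- 2%:R *: gser (fun p => c ^+ p.+1) a) * (1 - c *: a).
Proof.
move=> a2; have a1 : a mone = 0 by apply: a2; rewrite mdeg1.
rewrite -scalerAl gser_geometric // scalerA mulrC -scalerA scaleNr.
have -> : euler (1 - c *: a) = - euler (c *: a).
  apply: fpsP => m.
  rewrite [LHS](_ : _ = euler (1 : fps V R) m - euler (c *: a) m); last exact: mulrBr.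
  by rewrite euler1 sub0r.
rewrite (euler_homog (homogZ _ a2)) scalerN; congr (- _).
by rewrite !scalerA mulrC.
Qed.

Lemma gser_sum (I : Type) (r : seq I) (s : I -> nat -> R) a :
  \sum_(i <- r) gser (s i) a = gser (fun p => \sum_(i <- r) s i p) a.
Proof.
apply: fpsP => m; rewrite fcoef_sum /gser /= exchange_big; apply: eq_bigr => p _.
by rewrite mulr_suml.
Qed.

Lemma gserZ c s a : gser s (c *: a) = gser (fun p => c ^+ p.+1 * s p) a.
Proof.
apply: fpsP => m; apply: eq_bigr => p _.
by rewrite exprZn fcoefZ mulrA [s p * _]mulrC.
Qed.

Lemma cvg_gser (s : nat -> nat -> R) (l : nat -> R) a :
  (forall p, (fun k => s k p) @ \oo --> l p) ->
  cvg_coef (fun k => gser (s k) a) (gser l a).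
Proof. by move=> sl m; apply: cvg_sum_seq => p _; apply: cvgMl; apply: sl. Qed.

Lemma cvg_geometric_series (v : R) : 0 <= v < 1 ->
  (fun k => \sum_(j < k) v ^+ j) @ \oo --> (1 - v)^-1.
Proof.
case/andP => v0 v1; have v1' : 1 - v != 0 by rewrite subr_eq0 gt_eqF.
have -> : (fun k => \sum_(j < k) v ^+ j) = (fun k => (1 - v ^+ k) * (1 - v)^-1).
  apply/funext => k; rewrite -[LHS](mulfK v1'); congr (_ / _).
  by rewrite mulrC -opprB mulNr -subrX1 opprB.
rewrite -[X in _ --> X]mul1r; apply: cvgMl.
rewrite -[X in _ --> X]subr0; apply: cvgB; first exact: cvg_cst.
by apply: cvg_expr; rewrite ger0_norm.
Qed.

Lemma cvg_prod_seq (I : Type) (r : seq I) (f : I -> nat -> R) (l : I -> R) :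
  (forall i, f i @ \oo --> l i) ->
  (fun k => \prod_(i <- r) f i k) @ \oo --> \prod_(i <- r) l i.
Proof.
move=> fl; elim: r => [|i r IH].
  by rewrite big_nil; under eq_fun do rewrite big_nil; apply: cvg_cst.
by rewrite big_cons; under eq_fun do rewrite big_cons; apply: cvgM.
Qed.

(** The logarithmic derivative of [1 - c *: a] is a geometric series, and the
    sum over [c = p_1 ^ i_1 ... p_n ^ i_n] of its coefficients is a product of
    geometric series. *)
Lemma qpochhammer_euler (n : nat) a (ps : n.-tuple R) : homog 2 a ->
    (forall l, 0 <= tnth ps l < 1) ->
  euler (qpochhammer a ps) =
    (- 2%:R *: gser (fun p => \prod_(l < n) (1 - tnth ps l ^+ p.+1)^-1) a) *
    qpochhammer a ps /\
  qpochhammer a ps mone = 1.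
Proof.
move=> a2 ps01; have a1 : a mone = 0 by apply: a2; rewrite mdeg1.
pose c k (i : {ffun 'I_n -> 'I_k}) : R := \prod_(l < n) tnth ps l ^+ i l.
pose s k p : R := \sum_(i : {ffun 'I_n -> 'I_k}) c k i ^+ p.+1.
pose F k : fps V R := \prod_(i : {ffun 'I_n -> 'I_k}) (1 - c k i *: a).
suff [] : [/\ cvg_coef F (fps_lim F), euler (fps_lim F) =
    (- 2%:R *: gser (fun p => \prod_(l < n) (1 - tnth ps l ^+ p.+1)^-1) a) *
    fps_lim F & fps_lim F mone = 1] by move=> _.
apply: (@fps_lim_euler F (fun k => - 2%:R *: gser (s k) a)).
- move=> k; rewrite (@euler_prod _ _ _ _ _ _ (fun i => - 2%:R *: gser (fun p => c k i ^+ p.+1) a)).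
    by rewrite -scaler_sumr gser_sum.
  by move=> i _; apply: euler_1sub.
- move=> k; rewrite fcoef_prod1 big1 // => i _.
  by rewrite fcoefB fcoefZ a1 mulr0 subr0 fcoef1 eqxx.
- by move=> k; rewrite fcoefZ gser1 mulr0.
apply/cvg_coefZ/cvg_gser => p.
have -> : (s^~ p) = (fun k => \prod_(l < n) \sum_(j < k) (tnth ps l ^+ p.+1) ^+ j).
  apply/funext => k; rewrite bigA_distr_bigA; apply: eq_bigr => i _.
  by rewrite /c -prodrXl; apply: eq_bigr => l _; rewrite -!exprM mulnC.
apply: cvg_prod_seq => l; apply: cvg_geometric_series.
by have /andP[p0 p1] := ps01 l; rewrite exprn_ge0 // exprn_ilt1.
Qed.

End FpsLimit.

(** * The factors of the product formula *)

Section Factors.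
Context (R : realType) (V : choiceType).

Lemma monomial_mul (a b : {cmonom V}) (f g : fps V R) :
    (forall m, f m = (m == a)%:R) -> (forall m, g m = (m == b)%:R) ->
  forall m, (f * g) m = (m == mmul a b)%:R.
Proof.
move=> fa gb m; rewrite fcoefME.
have [mab|mab] := eqVneq m (mmul a b); last first.
  rewrite big1 // => x _; rewrite big1 // => y _.
  rewrite fa gb; case: (eqVneq x a) => [->|_]; last by rewrite mul0r mulr0.
  case: (eqVneq y b) => [->|_]; last by rewrite !mulr0.
  by rewrite eq_sym (negbTE mab) mul0r.
have am : a \in cmdivs m by apply: (@mem_cmdivs _ _ _ b).
have bm : b \in cmdivs m by apply: (@mem_cmdivs _ _ _ a); rewrite mulmC.
rewrite (big_fset_pick am) => [|x /negbTE xa]; last first.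
  by rewrite big1 // => y _; rewrite fa xa mul0r mulr0.
rewrite (big_fset_pick bm) => [|y /negbTE yb]; last by rewrite gb yb !mulr0.
by rewrite fa gb mab !eqxx !mulr1.
Qed.

Lemma fps_varX (v : V) k m : (fps_var R v ^+ k) m = (m == expcmn (ucm v) k)%:R.
Proof.
elim: k m => [|k IH] m; first by rewrite expr0 fcoef1.
rewrite exprS (@monomial_mul (ucm v) (expcmn (ucm v) k) _ _ _ IH) //.
congr ((m == _)%:R); apply/eqP/cmP => i.
by rewrite cmM !expcmnE mulSn.
Qed.

Lemma homog_var (v : V) : homog 1 (fps_var R v).
Proof. by move=> m; apply: contraNeq; rewrite /= pnatr_eq0 eqb0 negbK => /eqP ->; rewrite mdegU. Qed.

Lemma cvg_pw (X : nat -> V) p : injective X ->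
  cvg_coef (fun k => \sum_(i < k) fps_var R (X i) ^+ p.+1) (pw R X p.+1).
Proof.
move=> X_inj m; rewrite pwE //.
have -> : (fun k => (\sum_(i < k) fps_var R (X i) ^+ p.+1) m) =
    (fun k => \sum_(i < k) (m == expcmn (ucm (X i)) p.+1)%:R).
  by apply/funext => k; rewrite fcoef_sum; apply: eq_bigr => i _; rewrite fps_varX.
case: asboolP => [[i mE]|/forallNP mN]; last first.
  rewrite (_ : (fun k => _) = fun=> 0); first exact: cvg_cst.
  by apply/funext => k; rewrite big1 // => i _; case: eqP => // /mN.
have ne j : j != i -> (m == expcmn (ucm (X j)) p.+1) = false.
  move=> ji; apply/negbTE; apply: contraNneq ji => mj.
  have := congr1 (fun c : {cmonom V} => c (X i)) mj.
  rewrite mE 2!expcmnE !cmU eqxx (inj_eq X_inj).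
  by case: eqP => // _; rewrite muln0.
apply: cvg_near_cst; exists i.+1 => //= k ik.
rewrite (bigD1 (Ordinal ik)) //= {1}mE eqxx big1 => [|j ji]; first exact: addr0.
by rewrite ne // -val_eqE.
Qed.

Lemma qpochhammer_const (u L : R) : euler_prod_fin u @ \oo --> L ->
  qpochhammer (u%:A : fps V R) [tuple u] = L%:A.
Proof.
move=> uL; apply: cvg_coef_lim => m.
rewrite (_ : (fun k => _) = fun k => euler_prod_fin u k * (m == mone)%:R).
  by rewrite fcoef_scale1; apply: cvgMl.
apply/funext => k; rewrite -fcoef_scale1; congr (fcoef _ m).
rewrite (reindex (fun j : 'I_k => [ffun=> j])) /=; last first.
  exists (fun f : {ffun 'I_1 -> 'I_k} => f ord0) => [j _|f _]; first by rewrite ffunE.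
  by apply/ffunP => i; rewrite ffunE (ord1 i).
rewrite /euler_prod_fin -[RHS]/(in_alg (fps V R) _) rmorph_prod.
apply: eq_bigr => j _; rewrite big_ord1 ffunE (tnth_nth 0) /=.
by rewrite scalerA -exprSr -[RHS]/((1 - u ^+ j.+1) *: (1 : fps V R)) scalerBl scale1r.
Qed.

Context (X Y : nat -> V).
Hypotheses (X_inj : injective X) (Y_inj : injective Y).
Variables (q t u : R).
Hypotheses (q01 : 0 <= q < 1) (u01 : 0 <= u < 1).

(** The coefficients of [log Pi_tilde] in the products of power sums, up to the
    factor [1 / p.+1], which [euler] cancels. *)
Definition pi_coef p : R := (1 - t ^+ p.+1) / ((1 - q ^+ p.+1) * (1 - u ^+ p.+1)).

Definition pi_series : fps V R :=
  Fps (fun m => \sum_(p < mdeg m) pi_coef p * (pw R X p.+1 * pw R Y p.+1) m).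

Lemma pi_series1 : pi_series mone = 0.
Proof. by rewrite /pi_series /= mdeg1 big_ord0. Qed.

Lemma pi_factor_euler i j
    (a := fps_var R (X i) * fps_var R (Y j))
    (f := qpochhammer (t *: a) [tuple q; u] / qpochhammer a [tuple q; u]) :
  euler f = (2%:R *: gser pi_coef a) * f /\ f mone = 1.
Proof.
have a2 : homog 2 a by apply: (@homogM _ _ 1 1); apply: homog_var.
have ps01 l : 0 <= tnth [tuple q; u] l < 1.
  by rewrite (tnth_nth 0); case: l => -[|[|]].
have [e1 c1] := qpochhammer_euler (homogZ t a2) ps01.
have [e2 c2] := qpochhammer_euler a2 ps01.
have U2 := fps_unit1 c2.
rewrite /f; split; last first.
  rewrite fcoefM1 c1 mul1r; have := congr1 (fun g : fps V R => g mone) (mulVr U2).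
  by rewrite fcoefM1 c2 mulr1 fcoef1 eqxx.
rewrite eulerM e1 (euler_inv U2 e2).
set A := gser _ (t *: a); set B := gser _ a.
have -> : gser pi_coef a = B - A.
  apply: fpsP => m; rewrite fcoefB /A gserZ /gser /= -sumrB; apply: eq_bigr => p _.
  rewrite -mulrBl; congr (_ * _); rewrite big_ord_recl big_ord1 !(tnth_nth 0) /=.
  by rewrite /pi_coef invfM mulrBl mul1r.
have regroup (x y g h : fps V R) : (- 2%:R *: x) * g * h + g * (- (- 2%:R *: y) * h) =
    (2%:R *: (y - x)) * (g * h).
  rewrite (scaleNr _ x) (scaleNr _ y) scalerBr.
  by move: (2%:R *: x) (2%:R *: y) => x' y'; ring.
exact: regroup.
Qed.

(** Summing over the two alphabets turns powers of [x_i y_j] into products of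
    power sums. *)
Lemma Pi_tilde_euler :
  euler (Pi_tilde q t u X Y) = (2%:R *: pi_series) * Pi_tilde q t u X Y /\
  Pi_tilde q t u X Y mone = 1.
Proof.
pose a i j := fps_var R (X i) * fps_var R (Y j).
pose f i j := qpochhammer (t *: a i j) [tuple q; u] / qpochhammer (a i j) [tuple q; u].
pose F k := \prod_(i < k) \prod_(j < k) f i j.
suff [] : [/\ cvg_coef F (fps_lim F), euler (fps_lim F) =
    (2%:R *: pi_series) * fps_lim F & fps_lim F mone = 1] by move=> _.
apply: (@fps_lim_euler _ _ F
  (fun k => 2%:R *: \sum_(i < k) \sum_(j < k) gser pi_coef (a i j))).
- move=> k; rewrite scaler_sumr; apply: euler_prod => i _.
  by rewrite scaler_sumr; apply: euler_prod => j _; case: (pi_factor_euler i j).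
- move=> k; rewrite fcoef_prod1 big1 // => i _; rewrite fcoef_prod1 big1 // => j _.
  by case: (pi_factor_euler i j).
- move=> k; rewrite fcoefZ fcoef_sum big1 ?mulr0 // => i _.
  by rewrite fcoef_sum big1 // => j _; rewrite gser1.
apply: cvg_coefZ => m.
rewrite (_ : (fun k => _) = fun k => \sum_(p < mdeg m) pi_coef p *
    ((\sum_(i < k) fps_var R (X i) ^+ p.+1) * (\sum_(j < k) fps_var R (Y j) ^+ p.+1)) m).
  by apply: cvg_sum_seq => p _; apply: cvgMr; apply: cvg_coefM; apply: cvg_pw.
apply/funext => k; rewrite fcoef_sum.
under eq_bigr do rewrite fcoef_sum.
transitivity (\sum_(i < k) \sum_(p < mdeg m) \sum_(j < k) pi_coef p * (a i j ^+ p.+1) m).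
  by apply: eq_bigr => i _; rewrite exchange_big.
rewrite exchange_big; apply: eq_bigr => p _.
rewrite big_distrlr /= fcoef_sum mulr_sumr; apply: eq_bigr => i _.
rewrite fcoef_sum mulr_sumr; apply: eq_bigr => j _.
by rewrite exprMn.
Qed.

End Factors.

(** * Both sides satisfy the same Euler equation *)

Lemma pi_seriesE (R : realType) (V : choiceType) (X Y : nat -> V) (q t u : R)
    (m : {cmonom V}) d : injective X -> injective Y -> (mdeg m <= d)%N ->
  pi_series X Y q t u m =
  \sum_(p < d) pi_coef q t u p * (pw R X p.+1 * pw R Y p.+1) m.
Proof.
move=> X_inj Y_inj md; pose F p := pi_coef q t u p * (pw R X p.+1 * pw R Y p.+1) m.
rewrite [LHS](_ : _ = \sum_(p < mdeg m) F p) //.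
rewrite (big_ord_widen _ F md).
rewrite big_mkcond; apply: eq_bigr => p _; case: ltnP => // mp.
rewrite /F; have h : homog (p.+1 + p.+1) (pw R X p.+1 * pw R Y p.+1).
  by apply: homogM; apply: homog_pw.
rewrite h ?mulr0 //.
by rewrite neq_ltn; apply/orP; left; move: mp; clear; lia.
Qed.

Section Product.
Context (R : realType) (n : nat) (q t u : R).
Hypotheses (q01 : 0 < q < 1) (t01 : 0 < t < 1) (u01 : 0 < u < 1).
Local Notation V := (alphabets n.+1).

Definition macdonald_product : fps V R :=
  (qpochhammer u%:A [tuple u])^-1 *
     ((\prod_(i < n.+1) \prod_(j < n.+1)
         Pi_tilde q t u (Xplus i) (Yminus j)) /
      (\prod_(i < n.+1) \prod_(j < n.+1 | (j < i)%N)
         Pi_tilde q t 0 (Xplus i) (Yminus j))).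

Definition product_log : fps V R :=
  \sum_(i < n.+1) \sum_(j < n.+1) 2%:R *: pi_series (Xplus i) (Yminus j) q t u -
  \sum_(i < n.+1) \sum_(j < n.+1 | (j < i)%N)
    2%:R *: pi_series (Xplus i) (Yminus j) q t 0.

Let Pi_euler (v : R) : 0 <= v < 1 -> forall i j : 'I_n.+1,
  euler (Pi_tilde q t v (Xplus i) (Yminus j)) =
    (2%:R *: pi_series (Xplus i) (Yminus j) q t v) *
    Pi_tilde q t v (Xplus i) (Yminus j) /\
  Pi_tilde q t v (Xplus i) (Yminus j) mone = 1.
Proof.
move=> v01 i j; apply: Pi_tilde_euler => //; [exact: Xplus_inj|exact: Yminus_inj|].
by case/andP: q01 => /ltW -> ->.
Qed.

Lemma macdonald_product_euler (L : R) : euler_prod_fin u @ \oo --> L^-1 -> L != 0 ->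
  euler macdonald_product = product_log * macdonald_product /\
  macdonald_product mone = L.
Proof.
move=> uL L0; have u01' : 0 <= u < 1 by case/andP: u01 => /ltW -> ->.
have o01 : 0 <= (0 : R) < 1 by rewrite lexx ltr01.
pose A : fps V R := \prod_(i < n.+1) \prod_(j < n.+1)
  Pi_tilde q t u (Xplus i) (Yminus j).
pose B : fps V R := \prod_(i < n.+1) \prod_(j < n.+1 | (j < i)%N)
  Pi_tilde q t 0 (Xplus i) (Yminus j).
have -> : macdonald_product = L%:A * (A / B).
  rewrite /macdonald_product (qpochhammer_const V uL); congr (_ * _).
  by rewrite -[_%:A]/(in_alg (fps V R) L^-1) fmorphV invrK.
have A1 : A mone = 1.
  rewrite fcoef_prod1 big1 // => i _; rewrite fcoef_prod1 big1 // => j _.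
  by case: (Pi_euler u01' i j).
have B1 : B mone = 1.
  rewrite fcoef_prod1 big1 // => i _; rewrite fcoef_prod1 big1 // => j _.
  by case: (Pi_euler o01 i j).
have uB := fps_unit1 B1.
have BV1 : B^-1 mone = 1.
  have := congr1 (fun g : fps V R => g mone) (mulVr uB).
  by rewrite fcoefM1 B1 mulr1 fcoef1 eqxx.
split; last by rewrite !fcoefM1 A1 BV1 fcoef_scale1 eqxx !mulr1.
pose SA : fps V R := \sum_(i < n.+1) \sum_(j < n.+1)
  2%:R *: pi_series (Xplus i) (Yminus j) q t u.
pose SB : fps V R := \sum_(i < n.+1) \sum_(j < n.+1 | (j < i)%N)
  2%:R *: pi_series (Xplus i) (Yminus j) q t 0.
have eA : euler A = SA * A.
  apply: euler_prod => i _; apply: euler_prod => j _.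
  by case: (Pi_euler u01' i j).
have eB : euler B = SB * B.
  apply: euler_prod => i _; apply: euler_prod => j _.
  by case: (Pi_euler o01 i j).
rewrite -[product_log]/(SA - SB) eulerM eulerM eA (euler_inv uB eB).
have -> : euler (L%:A : fps V R) = 0.
  by rewrite (euler_homog (homogZ L (@homog1 _ _))) scale0r.
by ring.
Qed.

Lemma product_log1 : product_log mone = 0.
Proof.
rewrite fcoefB !fcoef_sum !big1 ?subr0 // => i _.
  by rewrite fcoef_sum big1 // => j _; rewrite fcoefZ pi_series1 mulr0.
by rewrite fcoef_sum big1 // => j _; rewrite fcoefZ pi_series1 mulr0.
Qed.

(** The sums over the cycle produce, for [Xplus i], all the [Yminus j] with the
    geometric factor in [u], minus those with [j < i] without it: these are the
    numerator and the denominator of the product. *)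
Lemma product_logE d (a : {cmonom V}) : (mdeg a <= d)%N -> product_log a =
  (\sum_(i < n.+1) \sum_(p < d) (2 * p.+1%:R * cfac q t p) *: (pwX R i p *
    (((one_sub u p)^-1 *: (\sum_j pwY R j p) -
      \sum_(j < n.+1 | (j < i)%N) pwY R j p)))) a.
Proof.
move=> ad; rewrite fcoefB !fcoef_sum -sumrB; apply: eq_bigr => i _.
rewrite !fcoef_sum.
have pE (P : pred 'I_n.+1) v :
    \sum_(j < n.+1 | P j) (2%:R *: pi_series (Xplus i) (Yminus j) q t v) a =
    \sum_(p < d) 2%:R * pi_coef q t v p * (pwX R i p * \sum_(j < n.+1 | P j) pwY R j p) a.
  transitivity (\sum_(j < n.+1 | P j) \sum_(p < d)
      2%:R * pi_coef q t v p * (pwX R i p * pwY R j p) a).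
    apply: eq_bigr => j _; rewrite fcoefZ (pi_seriesE _ _ _ _ _ ad).
    - by rewrite mulr_sumr; apply: eq_bigr => p _; rewrite mulrA.
    - exact: Xplus_inj.
    - exact: Yminus_inj.
  rewrite exchange_big; apply: eq_bigr => p _.
  by rewrite [pwX R i p * _]mulr_sumr fcoef_sum mulr_sumr.
rewrite !pE -sumrB; apply: eq_bigr => p _.
rewrite fcoefZ [X in _ = _ * fcoef X a]mulrBr -scaleAr fcoefB fcoefZ mulrBr mulrA.
have cE v : 2%:R * pi_coef q t v p = 2 * p.+1%:R * cfac q t p * (1 - v ^+ p.+1)^-1.
  rewrite /pi_coef /cfac /kap !invfM invrK.
  have p0 : p.+1%:R != 0 :> R by rewrite pnatr_eq0.
  move: p.+1%:R p0 (1 - t ^+ p.+1) (1 - q ^+ p.+1)^-1 (1 - v ^+ p.+1)^-1.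
  by move=> x x0 a1 b c; field.
rewrite !cE; congr (_ * _ - _ * _).
by rewrite expr0n subr0 invr1 mulr1.
Qed.

Lemma psum_product Z : fps_has_sum (@pweight R n q t u) Z -> Z = macdonald_product.
Proof.
move=> ZE; have := psum1 q01 t01 ZE => Z1.
have [L0 uL] := euler_prod_cvg u01 Z1.
have [eP P1] := macdonald_product_euler uL L0.
apply: (euler_unique product_log1 _ eP); last by rewrite P1.
apply: fpsP => m; have := euler_coef_psum q01 t01 u01 ZE m => e.
rewrite [LHS](_ : _ = (mdeg m)%:R * Z m) // e.
rewrite [RHS](@eq_fcoefM _ _ _ _ (\sum_(i < n.+1) \sum_(p < mdeg m)
  (2 * p.+1%:R * cfac q t p) *: (pwX R i p *
    (((one_sub u p)^-1 *: (\sum_j pwY R j p) -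
      \sum_(j < n.+1 | (j < i)%N) pwY R j p)))) Z) => [|a b abm].
  rewrite mulr_suml fcoef_sum; apply: eq_bigr => i _.
  rewrite mulr_suml fcoef_sum; apply: eq_bigr => p _.
  by rewrite -scaleAl fcoefZ.
by rewrite (product_logE (d := mdeg m)) // -abm mdegM leq_addr.
Qed.

End Product.

(** * The cyclic sum does not depend on the basis *)

Section Configurations.
Context (n : nat).
Local Notation ffp := {ffun 'I_n.+1 -> intpart}.

(** Configurations of partitions of size at most [D]: over them the cyclic sum is
    a trace of finite matrices. *)
Definition config_val D (h : {ffun 'I_n.+1 -> parts_le D}) : ffp :=
  [ffun i => val (h i)].

Definition configs D : {fset ffp * ffp} :=
  [fset (config_val hk.1, config_val hk.2) |
    hk : {ffun 'I_n.+1 -> parts_le D} * {ffun 'I_n.+1 -> parts_le D}]%fset.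

Lemma config_val_inj D : injective (@config_val D).
Proof.
move=> h g /ffunP hg; apply/ffunP => i; apply: val_inj.
by have := hg i; rewrite !ffunE.
Qed.

Lemma sum_configs (V : nmodType) D (F : ffp * ffp -> V) :
  \sum_(lk <- configs D) F lk =
  \sum_(h : {ffun 'I_n.+1 -> parts_le D}) \sum_(g : {ffun 'I_n.+1 -> parts_le D})
    F (config_val h, config_val g).
Proof.
rewrite big_imfset /=; last by move=> [h g] [h' g'] _ _ [/config_val_inj -> /config_val_inj ->].
by rewrite big_enum /= pair_big.
Qed.

Lemma mem_configs D (lk : ffp * ffp) :
  (lk \in configs D) = [forall i, (psize (lk.1 i) <= D) && (psize (lk.2 i) <= D)]%N.
Proof.
apply/imfsetP/forallP => [[[h g] _ -> i]|lkD].
  by rewrite /= !ffunE -!mem_parts_le !fsvalP.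
have l1 i : lk.1 i \in parts_le D by rewrite mem_parts_le; case/andP: (lkD i).
have l2 i : lk.2 i \in parts_le D by rewrite mem_parts_le; case/andP: (lkD i).
exists ([ffun i => [` l1 i]%fset], [ffun i => [` l2 i]%fset]) => //.
by case: lk {lkD} l1 l2 => l k l1 l2; congr (_, _); apply/ffunP => i; rewrite !ffunE.
Qed.

Lemma configs_exhaust (B : {fset ffp * ffp}) : exists D, (B `<=` configs D)%fset.
Proof.
exists (\sum_(lk <- B) \sum_i (psize (lk.1 i) + psize (lk.2 i)))%N.
apply/fsubsetP => lk lkB; rewrite mem_configs; apply/forallP => i.
rewrite (big_fsetD1 lk) //= (bigD1 i) //=.
by apply/andP; split; lia.
Qed.

Lemma configs_homo : {homo configs : d e / (d <= e)%N >-> (d `<=` e)%fset}.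
Proof.
move=> d e de; apply/fsubsetP => lk; rewrite !mem_configs => /forallP lkd.
by apply/forallP => i; have /andP[h1 h2] := lkd i; rewrite !(leq_trans _ de).
Qed.

End Configurations.

Section MacdonaldSum.
Context (R : realType) (n : nat) (q t u : R).
Hypotheses (q01 : 0 < q < 1) (t01 : 0 < t < 1) (u01 : 0 < u < 1).
Context (form : {bilinear symf R -> symf R -> R | *%R & *%R}).
Context (P : intpart -> symf R).
Hypotheses (formE : is_macdonald_form q t form) (PE : is_macdonald_P form P).
Context (A : intpart -> intpart -> R).
Hypothesis AE : forall lam,
  P lam = \sum_(l <- parts_of (psize lam)) A lam l *: symf_p l /\
  forall l, psize l != psize lam -> A lam l = 0.
Local Notation V := (alphabets n.+1).
Local Notation z := (macdonald_norm q t).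
Local Notation N := (norm_mac form P).
Local Notation Ainv := (inv_coef q t form P A).
Local Notation skewP := (skew_mac q t form P A).
Let z_gt0 lam : 0 < z lam := macdonald_norm_gt0 q01 t01 lam.
Let N_gt0 lam : 0 < N lam := normP_gt0 q01 t01 formE PE AE lam.

Definition macX (i : 'I_n.+1) l k : fps V R := symf_at (Xplus i) (skewP l k).
Definition macY (i : 'I_n.+1) l k : fps V R :=
  (N k / N l) *: symf_at (Yminus i) (skewP l k).

Let scal (c : R) : fps V R := c%:A.

Let scalM (c : R) (f : fps V R) : scal c * f = c *: f.
Proof. by rewrite /scal -scalerAl mul1r. Qed.

Lemma macX_sum i D l k : (psize l <= D)%N -> (psize k <= D)%N ->
  macX i l k = \sum_(r : parts_le D) \sum_(s : parts_le D)
    scal (A l (val r)) * wX R i (val r) (val s) * scal (Ainv (val s) k).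
Proof.
move=> lD kD; rewrite /macX (skewP_le q t form AE lD kD).
rewrite symf_at_sum; last exact: Xplus_inj.
rewrite big_seq_fsetE; apply: eq_bigr => r _.
rewrite symf_at_sum; last exact: Xplus_inj.
rewrite big_seq_fsetE; apply: eq_bigr => s _.
rewrite symf_atZ ?symf_at_pskew; try exact: Xplus_inj.
by rewrite [RHS]mulrC !scalM scalerA [in RHS]mulrC.
Qed.

Lemma macY_sum i D l k : (psize l <= D)%N -> (psize k <= D)%N ->
  macY i l k = \sum_(r : parts_le D) \sum_(s : parts_le D)
    scal (Ainv (val r) l) * wY q t i (val r) (val s) * scal (A k (val s)).
Proof.
move=> lD kD; rewrite /macY (skewP_le q t form AE lD kD).
rewrite symf_at_sum; last exact: Yminus_inj.
rewrite big_seq_fsetE scaler_sumr; apply: eq_bigr => r _.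
rewrite symf_at_sum; last exact: Yminus_inj.
rewrite big_seq_fsetE scaler_sumr; apply: eq_bigr => s _.
rewrite symf_atZ ?symf_at_pskew; try exact: Yminus_inj.
rewrite [RHS]mulrC !scalM /wY !scalerA; congr (_ *: _); rewrite /inv_coef.
have := N_gt0 l; have := N_gt0 k; have := z_gt0 (val r).
move: (N l) (N k) (z (val r)) => a b c c0 b0 a0.
by field; rewrite !gt_eqF.
Qed.

(** The power of [u] as a family of diagonal matrices, one at each place of the
    cycle. *)
Definition cyc_factor (i : 'I_n.+1) (l : intpart) : fps V R :=
  if i == ord_max then scal (u ^+ psize l) else 1.

Lemma cyclic_weight_factor (y x : 'I_n.+1 -> intpart -> intpart -> fps V R) D
    (h g : {ffun 'I_n.+1 -> parts_le D}) :
  cyclic_weight u y x (config_val h, config_val g) =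
  \prod_i (cyc_factor i (val (g i)) * y i (val (h i)) (val (g i)) *
    x (ordS i) (val (h (ordS i))) (val (g i))).
Proof.
rewrite /cyclic_weight /= ffunE; under [RHS]eq_bigr do rewrite -mulrA.
have wE : \prod_i cyc_factor i (val (g i)) = scal (u ^+ psize (val (g ord_max))).
  rewrite (bigD1 ord_max) //= [X in _ * X]big1 => [|i /negbTE im].
    by rewrite mulr1 /cyc_factor eqxx.
  by rewrite /cyc_factor im.
rewrite [RHS]big_split [X in _ = X * _]wE scalM; congr (_ *: _).
by apply: eq_bigr => i _; rewrite !ffunE.
Qed.

(** The transition matrix preserves sizes. It therefore restricts to the
    truncations, and commutes with the diagonal matrices [cyc_factor]. *)
Lemma sum_mac_psum D :
  \sum_(lk <- configs n D) cyclic_weight u macY macX lk =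
  \sum_(lk <- configs n D) @pweight R n q t u lk.
Proof.
rewrite !sum_configs.
pose c (r l : parts_le D) := scal (Ainv (val r) (val l)).
pose a (l s : parts_le D) := scal (A (val l) (val s)).
have valD (r : parts_le D) : (psize (val r) <= D)%N by rewrite -mem_parts_le fsvalP.
have ca r s : \sum_l c r l * a l s = (r == s)%:R.
  transitivity (scal (\sum_(l <- parts_le D) Ainv (val r) l * A l (val s))).
    rewrite big_seq_fsetE /scal scaler_suml; apply: eq_bigr => l _.
    by rewrite scalM scalerA.
  rewrite (Ainv_A q01 t01 formE PE AE) ?fsvalP // -val_eqE.
  by rewrite /scal scaler_nat.
have caw i r s : \sum_l c r l * cyc_factor i (val l) * a l s =
    cyc_factor i (val s) * (r == s)%:R.
  rewrite -ca mulr_sumr; apply: eq_bigr => l _; rewrite mulrAC mulrC /cyc_factor.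
  have [sl|sl] := eqVneq (psize (val s)) (psize (val l)); first by rewrite sl.
  by rewrite /a (AE _).2 // /scal scale0r !(mulr0, mul0r).
transitivity (\sum_(h : {ffun 'I_n.+1 -> parts_le D})
    \sum_(g : {ffun 'I_n.+1 -> parts_le D}) \prod_i
    (cyc_factor i (val (g i)) *
     (\sum_r \sum_s c r (h i) * wY q t i (val r) (val s) * a (g i) s) *
     (\sum_r \sum_s a (h (ordS i)) r * wX R (ordS i) (val r) (val s) * c s (g i)))).
  apply: eq_bigr => h _; apply: eq_bigr => g _.
  rewrite cyclic_weight_factor; apply: eq_bigr => i _.
  by rewrite (@macY_sum _ D) // (@macX_sum _ D).
rewrite (@cyclic_basis_change _ _ n c a
  (fun i r s => wY q t i (val r) (val s)) (fun i r s => wX R i (val r) (val s))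
  (fun i l => cyc_factor i (val l)) ca caw).
apply: eq_bigr => h _; apply: eq_bigr => g _.
by rewrite pweightE cyclic_weight_factor.
Qed.

Lemma mac_summable m : abs_summable (fun lk => cyclic_weight u macY macX lk m).
Proof.
have [C CP] := (@dual_cyclic_summable R V m n u N
  (fun i l k => symf_at (Yminus i) (skewP l k))
  (fun i l k => symf_at (Xplus i) (skewP l k)) u01 N_gt0
  (fun i => @skewP_sizes _ _ _ _ (@Yminus_inj _ i) q t form P A)
  (fun i => @skewP_sizes _ _ _ _ (@Xplus_inj _ i) q t form P A)
  (fun i => skewP_bound m (@Yminus_inj _ i) q01 t01 formE PE AE)
  (fun i => skewP_bound m (@Xplus_inj _ i) q01 t01 formE PE AE)).
by exists C; apply: CP.
Qed.

(** Both sums converge absolutely, and agree on every truncation. *)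
Lemma mac_has_sum :
  fps_has_sum (cyclic_weight u macY macX) (macdonald_product n q t u).
Proof.
have [Z ZE] := abs_fps_has_sum (pweight_summable (n := n) q01 t01 u01).
rewrite -(psum_product q01 t01 u01 ZE).
have [S SE] := abs_fps_has_sum mac_summable.
suff -> : Z = S by [].
apply: fpsP => m; apply: (has_sum_exhaust (@configs_exhaust n) (@configs_homo n) _ (ZE m) (SE m)).
by move=> D; rewrite -!fcoef_sum sum_mac_psum.
Qed.

End MacdonaldSum.

Theorem proposition1p1 (R : realType) (n : nat) (q t u : R)
  (q01 : 0 < q < 1) (t01 : 0 < t < 1) (u01 : 0 < u < 1)
  (form : {bilinear symf R -> symf R -> R | *%R & *%R})
  (P : intpart -> symf R) (Psk Qsk : intpart -> intpart -> symf R)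
  (formE : is_macdonald_form q t form)
  (PE : is_macdonald_P form P)
  (PskE : is_skew P Psk)
  (QskE : is_skew (macdonald_Q form P) Qsk) :
  fps_has_sum
    (fun lm : {ffun 'I_n.+1 -> intpart} * {ffun 'I_n.+1 -> intpart} =>
       periodic_weight u Psk Qsk lm.1 lm.2)
    ((qpochhammer u%:A [tuple u])^-1 *
     ((\prod_(i < n.+1) \prod_(j < n.+1)
         Pi_tilde q t u (Xplus i) (Yminus j)) /
      (\prod_(i < n.+1) \prod_(j < n.+1 | (j < i)%N)
         Pi_tilde q t 0 (Xplus i) (Yminus j)))).
Proof.
have [A AE] := macdonald_expansion q01 t01 formE PE.
apply: (eq_fps_has_sum _ (mac_has_sum (n := n) q01 t01 u01 formE PE AE)) => lk.
rewrite /periodic_weight /cyclic_weight; congr (_ *: _); apply: eq_bigr => i _.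
rewrite (skew_PE q01 t01 formE PE AE PskE) (skew_QE q01 t01 formE PE AE QskE).
by rewrite symf_atZ //; apply: Yminus_inj.
Qed.
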